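(* Let $n\ge2$, let $\epsilon$ be a real constant, and let $f\colon M^n\to\widetilde M^n(4\epsilon)$ be a biharmonic Lagrangian $H$-umbilical (isometric) immersion of a connected $n$-dimensional Riemannian manifold $M^n$ into a complex space form of complex dimension $n$ and constant holomorphic sectional curvature $4\epsilon$. If $\epsilon\le0$, then $f$ is minimal.
   Context: Complex space forms. $\widetilde M^n(4\epsilon)$ denotes a Kähler manifold of complex dimension $n$, with metric $\langle\ ,\ \rangle$, complex structure $J$, and curvature tensor $$\widetilde R(X,Y)Z=\epsilon\{\langle Y,Z\rangle X-\langle X,Z\rangle Y+\langle JY,Z\rangle JX-\langle JX,Z\rangle JY+2\langle X,JY\rangle JZ\}.$$ Submanifolds. For an isometric immersion $f\colon M^n\to\widetilde M$, $h$ is the second fundamental form and $H=\frac1n\operatorname{trace} h$ is the mean curvature vector field; $f$ is minimal if $H\equiv0$ and totally geodesic if $h\equiv0$. An immersion of a real $n$-dimensional manifold into $\widetilde M^n(4\epsilon)$ is Lagrangian if $J$ interchanges the tangent and normal spaces at every point. A Lagrangian immersion of $M^n$ into $\widetilde M^n(4\epsilon)$ is called Lagrangian $H$-umbilical if it is not totally geodesic and every point of $M^n$ has a neighborhood $W$ on which there are an orthonormal frame field $\{e_1,\dots,e_n\}$ and functions $\lambda,\mu$ with $$h(e_1,e_1)=\lambda Je_1,\quad h(e_2,e_2)=\cdots=h(e_n,e_n)=\mu Je_1,\quad h(e_1,e_j)=\mu Je_j,\quad h(e_j,e_k)=0\quad(2\le j\ne k\le n).$$ Biharmonicity. For a smooth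 map $f\colon(M^n,g)\to(N,\overline g)$ of Riemannian manifolds, the tension field is $\tau(f)=\operatorname{trace}_g(\nabla df)$, and $f$ is biharmonic if it is a critical point of the bienergy $E_2(f;\Omega)=\frac12\int_\Omega|\tau(f)|^2dv_g$ under compactly supported variations for every relatively compact domain $\Omega\subset M^n$; equivalently, $$\tau_2(f)=\sum_{i=1}^n\left\{\nabla^f_{e_i}\nabla^f_{e_i}\tau(f)-\nabla^f_{\nabla_{e_i}e_i}\tau(f)+\overline R(\tau(f),df(e_i))df(e_i)\right\}=0,$$ where $\{e_i\}$ is a local orthonormal frame, $\nabla^f$ is the induced connection on $f^*TN$ and $\overline R$ is the curvature tensor of $N$, $\overline R(X,Y)=[\overline\nabla_X,\overline\nabla_Y]-\overline\nabla_{[X,Y]}$. For an isometric immersion, $\tau(f)=nH$. *)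

(* Defs.v *)
From HB Require Import structures.
From mathcomp Require Import all_boot all_order all_algebra.
From mathcomp Require Import all_classical all_reals all_analysis.
Import Order.TTheory GRing.Theory Num.Theory numFieldNormedType.Exports.

Set Implicit Arguments.
Unset Strict Implicit.
Unset Printing Implicit Defensive.

Local Open Scope classical_set_scope.
Local Open Scope ring_scope.

(* MathComp-Analysis has no manifolds.  Manifolds are given by an atlas, and
   tensor fields by their components in every chart together with the usual
   transformation law under changes of charts.  Tangent vectors are row
   vectors, and the differential of F at x applied to u is 'D_u F x. *)

Section Smooth.
Context {R : realType} {m : nat} {V : normedModType R}.

Definition iterD (s : seq 'rV[R]_m) (f : 'rV[R]_m -> V) : 'rV[R]_m -> V :=
  foldr (fun v g x => 'D_v g x) f s.

(* C^infinity on an open set U: all iterated directional derivatives, of all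
   orders, exist and are continuous on U. *)
Definition smooth_on (U : set 'rV[R]_m) (f : 'rV[R]_m -> V) : Prop :=
  forall (s : seq 'rV[R]_m) (x : 'rV[R]_m), U x ->
    {for x, continuous (iterD s f)} /\ forall v, derivable (iterD s f) x v.

End Smooth.

(* coord i and param i are mutually inverse homeomorphisms between dom i and
   rng i; their values elsewhere are irrelevant. *)
Record manifold (R : realType) (m : nat) := Manifold {
  points :> topologicalType ;
  chart : Type ;
  dom : chart -> set points ;
  rng : chart -> set 'rV[R]_m ;
  coord : chart -> points -> 'rV[R]_m ;
  param : chart -> 'rV[R]_m -> points ;
  manifold_hausdorff : hausdorff_space points ;
  manifold_second_countable : @second_countable points ;
  dom_cover : forall p, exists i, dom i p ;
  dom_open : forall i, open (dom i) ;
  rng_open : forall i, open (rng i) ;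
  coordK : forall i p, dom i p -> rng i (coord i p) /\ param i (coord i p) = p ;
  paramK : forall i x, rng i x -> dom i (param i x) /\ coord i (param i x) = x ;
  coord_continuous : forall i p, dom i p -> {for p, continuous (coord i)} ;
  param_continuous : forall i x, rng i x -> {for x, continuous (param i)} ;
  trans_smooth : forall i j,
    smooth_on (rng i `&` param i @^-1` dom j) (coord j \o param i) }.

Arguments dom {R m m0} i _ : rename.
Arguments rng {R m m0} i _ : rename.
Arguments coord {R m m0} i _ : rename.
Arguments param {R m m0} i _ : rename.

Section VectorFields.
Context {R : realType} {m : nat} (M : manifold R m).

Definition overlap (i j : chart M) : set 'rV[R]_m :=
  rng i `&` param i @^-1` dom j.

Definition trans (i j : chart M) : 'rV[R]_m -> 'rV[R]_m := coord j \o param i.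

(* X i x is the row of components of X in the chart i at the point with
   coordinates x. *)
Definition vector_field (W : set M) (X : chart M -> 'rV[R]_m -> 'rV[R]_m) :=
  (forall i, smooth_on (rng i `&` param i @^-1` W) (X i)) /\
  (forall i j x, overlap i j x -> W (param i x) ->
     X j (trans i j x) = 'D_(X i x) (trans i j) x).

End VectorFields.

Definition ip {R : realType} {m : nat} (G : 'M[R]_m) (u v : 'rV[R]_m) : R :=
  (u *m G *m v^T) 0 0.

Record riemannian (R : realType) (m : nat) (M : manifold R m) := Riemannian {
  gram : chart M -> 'rV[R]_m -> 'M[R]_m ;
  gram_smooth : forall i, smooth_on (rng i) (gram i) ;
  gram_sym : forall i x, rng i x -> (gram i x)^T = gram i x ;
  gram_pos : forall i x v, rng i x -> v != 0 -> 0 < ip (gram i x) v v ;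
  gram_trans : forall i j x u v, overlap i j x ->
    ip (gram j (trans i j x)) ('D_u (trans i j) x) ('D_v (trans i j) x)
    = ip (gram i x) u v }.

(* Calculus in one chart of the source (metric g) and one chart of the target
   (metric G), F being the coordinate expression of a map. *)
Section LocalCalculus.
Context {R : realType}.

Definition basis_vec {m} (k : 'I_m) : 'rV[R]_m := delta_mx 0 k.

(* Nabla_u v at x for constant fields u, v, Nabla being the Levi-Civita
   connection of G: by the Koszul formula, the vector w such that
   2 <w, z> = u<v, z> + v<u, z> - z<u, v> for every constant z. *)
Definition christoffel {m} (G : 'rV[R]_m -> 'M[R]_m) (x u v : 'rV[R]_m) :
    'rV[R]_m :=
  (\row_k (2^-1 * (ip ('D_u G x) v (basis_vec k) + ip ('D_v G x) u (basis_vec k)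
                   - ip ('D_(basis_vec k) G x) u v))) *m invmx (G x).

(* Nabla^F_X V for a section V of F^*TN; the Levi-Civita connection itself is
   the case F = id. *)
Definition cov_along {m k} (G : 'rV[R]_k -> 'M[R]_k) (F : 'rV[R]_m -> 'rV[R]_k)
    (X : 'rV[R]_m -> 'rV[R]_m) (V : 'rV[R]_m -> 'rV[R]_k) : 'rV[R]_m -> 'rV[R]_k :=
  fun x => 'D_(X x) V x + christoffel G (F x) ('D_(X x) F x) (V x).

Definition levi_civita {m} (G : 'rV[R]_m -> 'M[R]_m)
    (X Y : 'rV[R]_m -> 'rV[R]_m) : 'rV[R]_m -> 'rV[R]_m :=
  cov_along G id X Y.

Definition lie_bracket {m} (X Y : 'rV[R]_m -> 'rV[R]_m) : 'rV[R]_m -> 'rV[R]_m :=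
  fun x => 'D_(X x) Y x - 'D_(Y x) X x.

Definition curvature_op {m} (G : 'rV[R]_m -> 'M[R]_m)
    (X Y Z : 'rV[R]_m -> 'rV[R]_m) : 'rV[R]_m -> 'rV[R]_m :=
  fun x => levi_civita G X (levi_civita G Y Z) x
         - levi_civita G Y (levi_civita G X Z) x
         - levi_civita G (lie_bracket X Y) Z x.

(* R(u, v)w at y; the curvature being tensorial, u, v, w may be extended to
   constant fields. *)
Definition curvature {m} (G : 'rV[R]_m -> 'M[R]_m) (y u v w : 'rV[R]_m) :
    'rV[R]_m :=
  curvature_op G (cst u) (cst v) (cst w) y.

Definition push {m k} (F : 'rV[R]_m -> 'rV[R]_k) (X : 'rV[R]_m -> 'rV[R]_m) :
    'rV[R]_m -> 'rV[R]_k :=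
  fun x => 'D_(X x) F x.

(* (Nabla dF)(X, Y); for an isometric immersion this is h(X, Y), by the Gauss
   formula. *)
Definition second_form {m k} (g : 'rV[R]_m -> 'M[R]_m) (G : 'rV[R]_k -> 'M[R]_k)
    (F : 'rV[R]_m -> 'rV[R]_k) (X Y : 'rV[R]_m -> 'rV[R]_m) : 'rV[R]_m -> 'rV[R]_k :=
  fun x => cov_along G F X (push F Y) x - push F (levi_civita g X Y) x.

Definition metric_trace {m k} (g : 'M[R]_m)
    (B : 'rV[R]_m -> 'rV[R]_m -> 'rV[R]_k) : 'rV[R]_k :=
  \sum_a \sum_b invmx g a b *: B (basis_vec a) (basis_vec b).

Definition tension {m k} (g : 'rV[R]_m -> 'M[R]_m) (G : 'rV[R]_k -> 'M[R]_k)
    (F : 'rV[R]_m -> 'rV[R]_k) : 'rV[R]_m -> 'rV[R]_k :=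
  fun x => metric_trace (g x) (fun u v => second_form g G F (cst u) (cst v) x).

Definition mean_curvature {m k} (g : 'rV[R]_m -> 'M[R]_m)
    (G : 'rV[R]_k -> 'M[R]_k) (F : 'rV[R]_m -> 'rV[R]_k) (x : 'rV[R]_m) : 'rV[R]_k :=
  m%:R^-1 *:
    metric_trace (g x) (fun u v => second_form g G F (cst u) (cst v) x).

Definition bitension {m k} (g : 'rV[R]_m -> 'M[R]_m) (G : 'rV[R]_k -> 'M[R]_k)
    (F : 'rV[R]_m -> 'rV[R]_k) (E : 'I_m -> 'rV[R]_m -> 'rV[R]_m) (x : 'rV[R]_m) :
    'rV[R]_k :=
  let tau := tension g G F in
  \sum_a (cov_along G F (E a) (cov_along G F (E a) tau) x
          - cov_along G F (levi_civita g (E a) (E a)) tau x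
          + curvature G (F x) (tau x) (push F (E a) x) (push F (E a) x)).

End LocalCalculus.

Definition orthonormal_frame {R : realType} {m : nat} {M : manifold R m}
    (g : riemannian M) (W : set M)
    (E : 'I_m -> chart M -> 'rV[R]_m -> 'rV[R]_m) : Prop :=
  (forall a, vector_field W (E a)) /\
  (forall i x a b, rng i x -> W (param i x) ->
     ip (gram g i x) (E a i x) (E b i x) = (a == b)%:R).

(* The real dimension is 2n, and J acts on row vectors on the right: in the
   chart i, J u is u *m cplx J i x.  Kaehler means almost Hermitian with
   Nabla J = 0 (integrability of J then follows). *)
Record kahler (R : realType) (n : nat) (N : manifold R n.*2)
    (g : riemannian N) := Kahler {
  cplx : chart N -> 'rV[R]_(n.*2) -> 'M[R]_(n.*2) ;
  cplx_smooth : forall i, smooth_on (rng i) (cplx i) ;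
  cplx_trans : forall i j x u, overlap i j x ->
    'D_u (trans i j) x *m cplx j (trans i j x) = 'D_(u *m cplx i x) (trans i j) x ;
  cplx_sqr : forall i x, rng i x -> cplx i x *m cplx i x = - 1%:M ;
  cplx_hermitian : forall i x u v, rng i x ->
    ip (gram g i x) (u *m cplx i x) (v *m cplx i x) = ip (gram g i x) u v ;
  cplx_parallel : forall i x u v, rng i x ->
    levi_civita (gram g i) (cst u) (fun y => v *m cplx i y) x
    = levi_civita (gram g i) (cst u) (cst v) x *m cplx i x }.

(* Constant holomorphic sectional curvature 4 eps. *)
Definition complex_space_form {R : realType} {n : nat} {N : manifold R n.*2}
    {g : riemannian N} (J : kahler g) (eps : R) : Prop :=
  forall i x u v w, rng i x ->
    let G := gram g i x in
    let Jx (z : 'rV[R]_(n.*2)) := z *m cplx J i x in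
    curvature (gram g i) x u v w =
    eps *: (ip G v w *: u - ip G u w *: v
            + ip G (Jx v) w *: Jx u - ip G (Jx u) w *: Jx v
            + (2 * ip G u (Jx v)) *: Jx w).

Section Maps.
Context {R : realType} {m k : nat} {M : manifold R m} {N : manifold R k}.
Variables (gM : riemannian M) (gN : riemannian N) (f : M -> N).

Definition expr (i : chart M) (j : chart N) : 'rV[R]_m -> 'rV[R]_k :=
  coord j \o f \o param i.

Definition expr_dom (i : chart M) (j : chart N) : set 'rV[R]_m :=
  rng i `&` (f \o param i) @^-1` dom j.

Definition smooth_map : Prop :=
  continuous f /\ forall i j, smooth_on (expr_dom i j) (expr i j).

(* Injectivity of the differential is implied. *)
Definition isometric_immersion : Prop :=
  smooth_map /\
  forall i j x u v, expr_dom i j x ->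
    ip (gram gN j (expr i j x)) ('D_u (expr i j) x) ('D_v (expr i j) x)
    = ip (gram gM i x) u v.

Definition totally_geodesic : Prop :=
  forall i j x u v, expr_dom i j x ->
    second_form (gram gM i) (gram gN j) (expr i j) (cst u) (cst v) x = 0.

Definition minimal : Prop :=
  forall i j x, expr_dom i j x ->
    mean_curvature (gram gM i) (gram gN j) (expr i j) x = 0.

(* The Euler-Lagrange equation tau_2(f) = 0 of the bienergy. *)
Definition biharmonic : Prop :=
  smooth_map /\
  forall (W : set M) (E : 'I_m -> chart M -> 'rV[R]_m -> 'rV[R]_m),
    open W -> orthonormal_frame gM W E ->
    forall i j x, expr_dom i j x -> W (param i x) ->
      bitension (gram gM i) (gram gN j) (expr i j) (E ^~ i) x = 0.

Definition tangent_space (i : chart M) (j : chart N) (x : 'rV[R]_m) :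
    set 'rV[R]_k :=
  [set 'D_u (expr i j) x | u in setT].

Definition normal_space (i : chart M) (j : chart N) (x : 'rV[R]_m) :
    set 'rV[R]_k :=
  [set w | forall t, tangent_space i j x t ->
             ip (gram gN j (expr i j x)) w t = 0].

End Maps.

Section Lagrangian.
Context {R : realType} {n : nat} {M : manifold R n} {N : manifold R n.*2}.
Variables (gM : riemannian M) (gN : riemannian N) (J : kahler gN) (f : M -> N).

Definition lagrangian : Prop :=
  isometric_immersion gM gN f /\
  forall i j x, expr_dom f i j x ->
    let Jx (z : 'rV[R]_(n.*2)) := z *m cplx J j (expr f i j x) in
    Jx @` tangent_space f i j x = normal_space gN f i j x /\
    Jx @` normal_space gN f i j x = tangent_space f i j x.

(* The distinguished frame vector e_1 is the one of index 0 in 'I_n. *)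
Definition lagrangian_H_umbilical : Prop :=
  lagrangian /\ ~ totally_geodesic gM gN f /\
  forall p : M, exists (W : set M)
      (E : 'I_n -> chart M -> 'rV[R]_n -> 'rV[R]_n) (lam mu : M -> R),
    open W /\ W p /\ orthonormal_frame gM W E /\
    forall i j x, expr_dom f i j x -> W (param i x) ->
      let F := expr f i j in
      let h a b := second_form (gram gM i) (gram gN j) F (E a i) (E b i) x in
      let JE a := push F (E a i) x *m cplx J j (F x) in
      let l := lam (param i x) in
      let m := mu (param i x) in
      forall a : 'I_n, a = 0%N :> nat ->
        [/\ h a a = l *: JE a,
            forall b, b != a -> h b b = m *: JE a,
            forall b, b != a -> h a b = m *: JE b &
            forall b c, b != a -> c != a -> b != c -> h b c = 0].

End Lagrangian.

(* Main.v *)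
(* Around a point, write h in the given frame e_1, ..., e_n with functions lam, mu, put
   m = n - 1 and al = lam + m mu, so that the tension field is al J e_1.  The Codazzi
   equations and the components of the bitension field along e_j and J e_1 show that
   where al <> 0 the other derivatives e_j al vanish and e_1 is geodesic; where moreover
   lam <> 2 mu one has nabla_{e_j} e_1 = kap e_j.  Differentiating along e_1 gives
     mu' = (lam - 2 mu) kap,   2 lam al' + al lam' + m al lam kap = 0,
     kap' = - kap^2 - eps - lam mu + mu^2,
     al'' + m kap al' = al (m kap^2 + lam^2 + m mu^2 - (m + 4) eps).
   If al' = 0 on an open set the last equation forces lam = mu = 0, since eps <= 0.
   Otherwise, with phi = al' / (al kap) and a scale c, the functions al, mu, lam are c times
   polynomials in phi, phi' is kap times a polynomial psi(phi), and the last equation is a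
   linear relation between kap^2, c^2 and eps with coefficients polynomial in phi.
   Differentiating it twice gives three such relations; as c <> 0 their determinant, a
   polynomial in phi, vanishes identically.  It is not the zero polynomial, so phi is
   constant and a root of psi, and then the signs of the coefficients in the relation
   contradict eps <= 0. *)

From HB Require Import structures.
Require Import Defs.
From mathcomp Require Import all_boot all_order all_algebra.
From mathcomp Require Import all_classical all_reals all_analysis.
From mathcomp Require Import ring lra.
Import Order.TTheory GRing.Theory Num.Theory numFieldNormedType.Exports.

Set Implicit Arguments.
Unset Strict Implicit.
Unset Printing Implicit Defensive.

Local Open Scope classical_set_scope.
Local Open Scope ring_scope.


(** * Differential calculus in several variables *)

(** The parameter phi comes from homogeneity. Divided by al kap, with lam' eliminated through al'
    and mu', the tangential equation along e_1 reads 3 al phi = 2 m mu (phi - 1), so phi alone fixes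
    the ratios al : mu : lam. The unknowns reduce to phi, kap and the scale c, and in the last
    equation every term is quadratic in (kap, c) or a multiple of eps; hence its linearity in kap^2,
    c^2 and eps. The determinant is evaluated only at roots of psi, where the derivatives of the
    coefficients drop out. It vanishes at the root 1, where al would be 0; at -m/3 it is nonzero
    unless m = 3, and then the value at -2 is nonzero. At the root -2 the sign argument fails for m
    = 1, a case that the determinant excludes. Two obstacles shape the text. The functions lam and
    mu come without any regularity, so smooth substitutes are built by pairing h with the frame. And
    each nonvanishing condition is reached only on a smaller nonempty open set, so the equations are
    kept in a form that restricts to open subsets while the base point moves. *)

Section C1.
Context {R : realType} {m : nat}.
Notation E := 'rV[R]_m.

Lemma is_derive_line (f : E -> R) (y v : E) (s : R) :
  derivable f (y + s *: v) v ->
  is_derive s 1 (fun t => f (y + t *: v) : R) ('D_v f (y + s *: v)).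
Proof.
move=> df.
have eqg : (fun h : R => h^-1 *: (((fun t => f (y + t *: v) : R) \o shift s) (h *: 1)
      - f (y + s *: v)))
   = (fun h => h^-1 *: ((f \o shift (y + s *: v)) (h *: v) - f (y + s *: v))).
  apply/funext => h /=; congr (_ *: (f _ - _)).
  by rewrite [h%:A]mulr1 scalerDl addrCA.
split; first by rewrite /derivable eqg.
by rewrite {1}/derive eqg.
Qed.

Lemma mvt_line (f : E -> R) (y v : E) (c : R) :
  (forall s, `|s| <= `|c| -> derivable f (y + s *: v) v) ->
  exists2 s, `|s| <= `|c| & f (y + c *: v) - f y = c * 'D_v f (y + s *: v).
Proof.
move=> df.
have cont a b : (forall s, s \in `[a, b] -> `|s| <= `|c|) ->
    {within `[a, b], continuous (fun t => f (y + t *: v) : R)}.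
  move=> H; apply: derivable_within_continuous => s sab.
  by case: (is_derive_line (df s (H s sab))).
have [c0|c0] := leP 0 c.
  have [s sc||s sc Hs] := @MVT_segment _ (fun t => f (y + t *: v) : R)
    (fun s => 'D_v f (y + s *: v)) _ _ c0.
  - apply: is_derive_line; apply: df.
    by move: sc; rewrite in_itv /= => /andP[/ltW s0 /ltW sc]; rewrite !ger0_norm.
  - apply: cont => s; rewrite in_itv /= => /andP[s0 sc].
    by rewrite !ger0_norm.
  - exists s; last by move: Hs; rewrite scale0r addr0 subr0 mulrC.
    by move: sc; rewrite in_itv /= => /andP[s0 sc]; rewrite !ger0_norm.
have [s sc||s sc Hs] := @MVT_segment _ (fun t => f (y + t *: v) : R)
    (fun s => 'D_v f (y + s *: v)) _ _ (ltW c0).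
- apply: is_derive_line; apply: df.
  move: sc; rewrite in_itv /= => /andP[/ltW s0 /ltW sc].
  by rewrite !ler0_norm ?lerN2 // ltW.
- apply: cont => s; rewrite in_itv /= => /andP[s0 sc].
  by rewrite !ler0_norm ?lerN2 // ltW.
- exists s; last first.
    move: Hs; rewrite scale0r addr0 sub0r => Hs.
    by rewrite -opprB Hs mulrN opprK mulrC.
  move: sc; rewrite in_itv /= => /andP[s0 sc].
  by rewrite !ler0_norm ?lerN2 // ltW.
Qed.

Lemma mxnorm_le (x : E) (e : R) :
  0 <= e -> (forall i, `|x 0 i| <= e) -> `|x| <= e.
Proof.
move=> e0 H; rewrite /Num.Def.normr /= mx_normrE; apply: bigmax_le => // -[i j] _ /=.
by rewrite ord1.
Qed.

Lemma mxnorm_entry (x : E) i : `|x 0 i| <= `|x|.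
Proof.
by rewrite [leRHS]/Num.Def.normr /= mx_normrE; apply: (le_bigmax _ _ (0, i)).
Qed.

Lemma rV_near0_lt (e : R) : 0 < e -> \forall h \near (0 : E), `|h| < e.
Proof.
move=> e0; apply/nbhs_ballP; exists e => // z.
by rewrite -ball_normE /ball_ /= sub0r normrN.
Qed.

(* The increment is telescoped along the coordinate axes and the mean value theorem is
   applied on each segment. *)
Lemma C1_differentiable (O : set E) (f : E -> R) : open O ->
  (forall x, O x -> forall v, derivable f x v) ->
  (forall v x, O x -> {for x, continuous (fun y => 'D_v f y)}) ->
  forall x, O x -> differentiable f x.
Proof.
move=> oO df cf x Ox.
pose d k : R := 'D_(basis_vec k) f x.
pose trunc (h : E) (k : nat) : E := \row_l (if (l < k)%N then h 0 l else 0).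
have key e : 0 < e -> \forall h \near (0 : E), forall k, (k <= m)%N ->
    `|f (x + trunc h k) - f x - \sum_(l < m | (l < k)%N) h 0 l * d l|
      <= k%:R * (e * `|h|).
  move=> e0.
  have nb : \forall z \near x, O z /\ forall k, `|'D_(basis_vec k) f z - d k| <= e.
    near=> z; split; first by near: z; exact: open_nbhs_nbhs.
    move=> k; move: k; near: z; apply: filter_forall => k.
    have /cvgrPdist_le/(_ _ e0) := cf (basis_vec k) x Ox.
    by apply: filterS => z; rewrite distrC.
  have /nbhs_ballP[r /= r0 Hr] := nb.
  near=> h.
  have hr : `|h| < r by near: h; exact: rV_near0_lt.
  have inb z : `|z| <= `|h| -> O (x + z) /\
      forall k, `|'D_(basis_vec k) f (x + z) - d k| <= e.
    move=> zh; apply: Hr; rewrite -ball_normE /ball_ /=.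
    by rewrite opprD addrA subrr sub0r normrN (le_lt_trans zh).
  elim => [|k IHk] km.
    rewrite big_pred0 // subr0 mul0r (_ : trunc h 0%N = 0) ?addr0 ?subrr ?normr0 //.
    by apply/rowP => l; rewrite !mxE ltn0.
  pose ko := Ordinal km.
  have truncS : trunc h k.+1 = trunc h k + h 0 ko *: basis_vec ko.
    apply/rowP => l; rewrite !mxE eqxx /= ltnS.
    case: ltngtP => [lk|lk|lk]; rewrite ?mulr0 ?addr0 //.
    - rewrite (_ : l == ko = false) ?mulr0 ?addr0 //.
      by apply/negbTE; rewrite -val_eqE /= neq_ltn lk.
    - rewrite (_ : l == ko = false) ?mulr0 ?addr0 //.
      by apply/negbTE; rewrite -val_eqE /= neq_ltn lk orbT.
    - have -> : l = ko by apply/val_inj.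
      by rewrite eqxx mulr1 add0r.
  have small s : `|s| <= `|h 0 ko| -> `|trunc h k + s *: basis_vec ko| <= `|h|.
    move=> sh; apply: mxnorm_le => // l; rewrite !mxE eqxx /=.
    case: (ltngtP l k) => lk.
    - rewrite (_ : l == ko = false) ?mulr0 ?addr0 ?mxnorm_entry //.
      by apply/negbTE; rewrite -val_eqE /= neq_ltn lk.
    - rewrite (_ : l == ko = false) ?mulr0 ?addr0 ?normr0 //.
      by apply/negbTE; rewrite -val_eqE /= neq_ltn lk orbT.
    - have -> : l = ko by apply/val_inj.
      by rewrite eqxx mulr1 add0r (le_trans sh) ?mxnorm_entry.
  have [s sh mv] : exists2 s, `|s| <= `|h 0 ko| &
     f (x + trunc h k + h 0 ko *: basis_vec ko) - f (x + trunc h k) =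
     h 0 ko * 'D_(basis_vec ko) f (x + trunc h k + s *: basis_vec ko).
    apply: mvt_line => s sh; apply: df; rewrite -addrA.
    by have [] := inb _ (small _ sh).
  rewrite truncS addrA (bigD1 ko) //=.
  have -> : \sum_(l < m | (l < k.+1)%N && (l != ko)) h 0 l * d l =
            \sum_(l < m | (l < k)%N) h 0 l * d l.
    by apply: eq_bigl => l; rewrite ltnS -val_eqE /= andbC -ltn_neqAle.
  set S := \sum_(l < m | _) _.
  rewrite (_ : f (x + trunc h k + h 0 ko *: basis_vec ko) - f x - _ =
    (f (x + trunc h k + h 0 ko *: basis_vec ko) - f (x + trunc h k) - h 0 ko * d ko)
    + (f (x + trunc h k) - f x - S)); last by ring.
  rewrite mv -mulrBr -natr1 mulrDl mul1r addrC (le_trans (ler_normD _ _)) //.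
  apply: lerD; first exact: IHk (ltnW km).
  rewrite normrM mulrC; apply: ler_pM => //; last exact: mxnorm_entry.
  by rewrite -addrA; have [_ ->] := inb _ (small _ sh).
pose L (h : E) : R := \sum_(l < m) h 0 l * d l.
have linL : linear L.
  move=> a u v; rewrite /L /GRing.scale /= mulr_sumr -big_split /=; apply: eq_bigr => l _.
  by rewrite !mxE mulrDl mulrA.
pose LL : {linear E -> R} := HB.pack L (GRing.isLinear.Build _ _ _ _ L linL).
have cL : continuous LL.
  apply: (@continuous_big _ _ _ _ _ add_continuous) => l _ z.
  exact: (@continuousM R E (fun h => h 0 l) (fun=> d l) z (@coord_continuous _ _ _ 0 l z) (@cst_continuous _ _ (d l) z)).
have HL : f \o shift x = cst (f x) + LL +o_ (0 : E) id.
  apply/eqaddoP => e e0; near=> h => /=.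
  (* Sharing the error among [m.+1] rather than [m] axes covers [m = 0]. *)
  have m0 : 0 < m.+1%:R :> R by rewrite ltr0n.
  have /(_ m (leqnn _)) : forall k, (k <= m)%N ->
    `|f (x + trunc h k) - f x - \sum_(l < m | (l < k)%N) h 0 l * d l|
      <= k%:R * ((e / m.+1%:R) * `|h|) by near: h; apply: key; rewrite divr_gt0.
  have -> : trunc h m = h by apply/rowP => l; rewrite mxE ltn_ord.
  under eq_bigl => l do rewrite ltn_ord.
  rewrite -/(L h) => H.
  rewrite -[X in `|X|]/(f (h + x) - (f x + L h)) opprD addrA [h + x]addrC.
  rewrite (le_trans H) // mulrA; apply: ler_wpM2r => //.
  rewrite mulrCA ler_piMr ?(ltW e0) // ler_pdivrMr // mul1r ler_nat //.
have dE := diff_unique cL HL.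
by apply/diff_locallyP; rewrite dE; split.
Unshelve. all: by end_near. Qed.

End C1.

(** * Symmetry of mixed second derivatives *)

Section Schwarz.
Context {R : realType} {m : nat}.
Notation E := 'rV[R]_m.

(** Mean value theorem twice: along [u] for the difference [f (y + t *: v) - f y], then along [v]
    for ['D_u f]. Exchanging [u] and [v] leaves the left-hand side unchanged and yields the other
    mixed derivative. *)
Lemma second_difference (f : E -> R) (x u v : E) (t : R) : 0 < t ->
  (forall a b : R, `|a| <= t -> `|b| <= t ->
    let y := x + a *: u + b *: v in
    derivable f y u /\ derivable (fun z => 'D_u f z) y v) ->
  exists a b, [/\ `|a| <= t, `|b| <= t &
   f (x + t *: u + t *: v) - f (x + t *: u) - (f (x + t *: v) - f x)
   = t * t * 'D_v (fun z => 'D_u f z) (x + a *: u + b *: v)].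
Proof.
move=> t0 H.
have nt : `|t| = t by rewrite gtr0_norm.
pose g (y : E) : R := f (y + t *: v) - f y.
have shift_der (y : E) : derivable f (y + t *: v) u ->
    is_derive y u (fun z : E => f (z + t *: v) : R) ('D_u f (y + t *: v)).
  move=> dy.
  have e : (fun h : R => h^-1 *: (((fun z : E => f (z + t *: v) : R) \o shift y) (h *: u)
      - f (y + t *: v))) =
    (fun h => h^-1 *: ((f \o shift (y + t *: v)) (h *: u) - f (y + t *: v))).
    by apply/funext => h /=; rewrite addrA.
  by split; rewrite /derivable /derive e.
have dg (y : E) : derivable f (y + t *: v) u -> derivable f y u ->
   is_derive y u g ('D_u f (y + t *: v) - 'D_u f y).
  move=> d1 d2; apply: is_deriveB; first exact: shift_der.
  exact: derivableP.
have l1 s : `|s| <= `|t| -> derivable g (x + s *: u) u /\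
    'D_u g (x + s *: u) = 'D_u f (x + s *: u + t *: v) - 'D_u f (x + s *: u).
  rewrite nt => st; have [|d1 _] := H s t st; first by rewrite nt.
  have [|d2 _] := H s 0 st; first by rewrite normr0 ltW.
  rewrite scale0r addr0 in d2.
  by have [? ?] := dg _ d1 d2.
have [a at1 Ha] := @mvt_line _ _ g x u t (fun s st => (l1 s st).1).
rewrite nt in at1.
have [|b bt Hb] := @mvt_line _ _ (fun z => 'D_u f z) (x + a *: u) v t.
  by move=> b; rewrite nt => bt; have [] := H a b at1 bt.
exists a, b; split=> //; first by rewrite -nt.
transitivity (g (x + t *: u) - g x) => //.
by rewrite Ha (l1 _ _).2 ?nt // Hb mulrA.
Qed.

Lemma continuous_near_le (g : E -> R) (x : E) (e : R) : 0 < e ->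
  {for x, continuous g} -> \forall z \near x, `|g z - g x| <= e.
Proof.
move=> e0 /cvgrPdist_le/(_ _ e0).
by apply: filterS => z; rewrite distrC.
Qed.

(** The second difference divided by t^2 equals each mixed derivative at some point near [x]; the
    two points may differ, and continuity at [x] of both derivatives closes the gap. *)
Lemma derive_swap (O : set E) (f : E -> R) (u v x : E) : open O -> O x ->
  (forall y, O y -> [/\ derivable f y u, derivable f y v,
     derivable (fun z => 'D_u f z) y v & derivable (fun z => 'D_v f z) y u]) ->
  {for x, continuous (fun y => 'D_v (fun z => 'D_u f z) y)} ->
  {for x, continuous (fun y => 'D_u (fun z => 'D_v f z) y)} ->
  'D_v (fun z => 'D_u f z) x = 'D_u (fun z => 'D_v f z) x.
Proof.
move=> oO Ox H c1 c2; apply/eqP; rewrite -subr_eq0 -normr_le0.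
apply/ler_addgt0Pr => e e0; rewrite add0r.
have e20 : 0 < e / 2 by rewrite divr_gt0.
pose g1 y : R := 'D_v (fun z => 'D_u f z) y.
pose g2 y : R := 'D_u (fun z => 'D_v f z) y.
rewrite -/(g1 x) -/(g2 x).
have nb : \forall z \near x, [/\ O z, `|g1 z - g1 x| <= e / 2 & `|g2 z - g2 x| <= e / 2].
  have n1 := continuous_near_le e20 (c1 : {for x, continuous g1}).
  have n2 := continuous_near_le e20 (c2 : {for x, continuous g2}).
  have n0 : \forall z \near x, O z by exact: open_nbhs_nbhs.
  by move: n0 n1 n2; apply: filterS3 => z; split.
have /nbhs_ballP[r /= r0 Hr] := nb.
(* The size [t] keeps all points [x + a *: u + b *: v] with [a], [b] bounded by [t] inside the ball
   of radius [r]; the 1 in [N] covers [u = v = 0]. *)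
pose N := `|u| + `|v| + 1.
have N0 : 0 < N by rewrite ltr_wpDl // addr_ge0.
pose t := r / 2 / N.
have t0 : 0 < t by rewrite !divr_gt0.
have inb a b : `|a| <= t -> `|b| <= t -> ball x r (x + a *: u + b *: v).
  move=> at1 bt; rewrite -ball_normE /ball_ /= -addrA opprD addrA subrr sub0r normrN.
  apply: (le_lt_trans (ler_normD _ _)); rewrite !normrZ.
  apply: (@le_lt_trans _ _ (t * (`|u| + `|v|))).
    by rewrite mulrDr lerD // ler_wpM2r.
  apply: (@le_lt_trans _ _ (t * N)).
    by rewrite ler_wpM2l // ?(ltW t0) // lerDl.
  rewrite /t divfK ?gt_eqF // ltr_pdivrMr // ltr_pMr // ltr1n //.
have [|a [b [at1 bt E1]]] := @second_difference f x u v t t0.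
  move=> a b at1 bt /=; have [Oy _ _] := Hr _ (inb _ _ at1 bt).
  by have [d1 _ d3 _] := H _ Oy; split; [exact: d1|exact: d3].
have [|b' [a' [bt' at' E2]]] := @second_difference f x v u t t0.
  move=> a' b' at' bt' /=; rewrite addrAC.
  have [Oy _ _] := Hr _ (inb _ _ bt' at').
  by have [_ d2 _ d4] := H _ Oy; split; [exact: d2|exact: d4].
have [_ B1 _] := Hr _ (inb _ _ at1 bt).
have := inb _ _ at' bt'; rewrite addrAC => /Hr[_ _ B2].
have : t * t * g1 (x + a *: u + b *: v) = t * t * g2 (x + b' *: v + a' *: u).
  transitivity (f (x + t *: u + t *: v) - f (x + t *: u) - (f (x + t *: v) - f x)).
    exact/esym/E1.
  apply: etrans E2; rewrite [x + t *: v + t *: u]addrAC.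
  by clear; ring.
have tn : t != 0 by rewrite gt_eqF.
move=> /(mulfI (mulf_neq0 tn tn)) E12.
rewrite E12 distrC in B1.
rewrite -(subrKA (g2 (x + b' *: v + a' *: u))).
apply: (le_trans (ler_normD _ _)); rewrite [leRHS]splitr; exact: lerD B1 B2.
Qed.

End Schwarz.

(* Unification may unfold [derive] down to the definition of limits, which makes
   rewriting extremely slow; [dd] is a copy that does not reduce. *)
Fact dd_key : {d : forall (R : realType) (V W : normedModType R),
    V -> (V -> W) -> V -> W | d = fun _ _ _ v f x => 'D_v f x}.
Proof. by exists (fun _ _ _ v f x => 'D_v f x). Qed.

Definition dd {R : realType} {V W : normedModType R} (v : V) (f : V -> W) (x : V) : W :=
  sval dd_key R V W v f x.

Lemma ddE (R : realType) (V W : normedModType R) (v : V) (f : V -> W) x :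
  dd v f x = 'D_v f x.
Proof. by rewrite /dd (svalP dd_key). Qed.

Lemma continuous_near_eq (R : realType) (V : normedModType R) (f g : V -> R) x :
  (\near x, f x = g x) -> {for x, continuous f} -> {for x, continuous g}.
Proof.
move=> fg /cvgrPdist_le cf; apply/cvgrPdist_le => e e0.
rewrite -(nbhs_singleton fg); near=> y.
rewrite -(_ : f y = g y); first by near: y; exact: cf.
by near: y; exact: fg.
Unshelve. all: by end_near. Qed.

(** * Smooth scalar functions *)

Section SmoothScalar.
Context {R : realType} {m : nat}.
Notation E := 'rV[R]_m.
Implicit Types (O : set E) (f g : E -> R).

(* [k] times differentiable in the sense of Frechet; [sm] is C^infinity.  Unlike
   [smooth_on], which only mentions directional derivatives, this is visibly stable
   under composition. *)
Fixpoint Dk (k : nat) O f : Prop :=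
  if k is k'.+1 then
    (forall x, O x -> differentiable f x) /\ forall v, Dk k' O (dd v f)
  else True.

Definition sm O f := forall k, Dk k O f.

Lemma near_open O x : open O -> O x -> \forall y \near x, O y.
Proof. by move=> oO Ox; exact: open_nbhs_nbhs. Qed.

Lemma near_eq_on O f g x : open O -> O x -> {in O, f =1 g} -> \near x, f x = g x.
Proof. by move=> oO Ox fg; near=> y; apply: fg; rewrite inE; near: y; exact: near_open.
Unshelve. all: by end_near. Qed.

Lemma differentiable_near f g x : (\near x, f x = g x) ->
  differentiable f x -> differentiable g x.
Proof.
move=> fg df.
have fgx : f x = g x by exact: nbhs_singleton fg.
have H : g \o shift x = cst (g x) + 'd f x +o_ (0 : E) id.
  have := diff_locally df => /eqaddoP Hf; apply/eqaddoP => e e0.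
  have fg0 : \forall h \near (0 : E), f (h + x) = g (h + x).
    have : (fun h : E => h + x) @ (0 : E) --> x.
      rewrite -[X in _ --> X]add0r; apply: (@cvgD _ _ _ (nbhs (0 : E))); first exact: cvg_id.
      exact: cvg_cst.
    by move/(_ _ fg).
  move: (Hf e e0); apply: filter_app; near=> h => /=.
  rewrite -[X in `|X|]/(f (h + x) - (f x + 'd f x h)).
  rewrite -[X in _ -> `|X| <= _]/(g (h + x) - (g x + 'd f x h)).
  by rewrite -fgx (_ : g (h + x) = f (h + x)) //; apply/esym; near: h.
have cf : continuous ('d f x) by exact: diff_continuous.
have dE := diff_unique cf H.
by apply/diff_locallyP; rewrite dE; split.
Unshelve. all: by end_near. Qed.

Lemma derive_eq_on O f g v x : open O -> O x -> {in O, f =1 g} ->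
  dd v f x = dd v g x.
Proof. by move=> oO Ox fg; rewrite !ddE; apply: near_eq_derive; exact: near_eq_on fg. Qed.

Lemma continuous_eq_on O f g x : open O -> O x -> {in O, f =1 g} ->
  {for x, continuous f} -> {for x, continuous g}.
Proof.
move=> oO Ox fg; exact: continuous_near_eq (near_eq_on oO Ox fg).
Qed.

Lemma Dk_eq k O f g : open O -> {in O, f =1 g} -> Dk k O f -> Dk k O g.
Proof.
move=> oO; elim: k f g => //= k IHk f g fg [df Df]; split=> [x Ox|v].
  by apply: differentiable_near (df x Ox); exact: near_eq_on fg.
apply: IHk (Df v) => x; rewrite inE => Ox.
exact: derive_eq_on fg.
Qed.

Lemma sm_eq O f g : open O -> {in O, f =1 g} -> sm O f -> sm O g.
Proof. by move=> oO fg sf k; exact: Dk_eq fg (sf k). Qed.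

Lemma sm_diff O f x : sm O f -> O x -> differentiable f x.
Proof. by move=> /(_ 1%N)[+ _]; exact. Qed.

Lemma sm_derivable O f x v : sm O f -> O x -> derivable f x v.
Proof. by move=> sf Ox; apply: diff_derivable; exact: sm_diff Ox. Qed.

Lemma sm_continuous O f x : sm O f -> O x -> {for x, continuous f}.
Proof. by move=> sf Ox; apply: differentiable_continuous; exact: sm_diff Ox. Qed.

Lemma sm_D O f v : sm O f -> sm O (dd v f).
Proof. by move=> sf k; have [_ Df] := sf k.+1; exact: Df. Qed.

Lemma Dk_sub k O O' f : O' `<=` O -> Dk k O f -> Dk k O' f.
Proof.
move=> OO; elim: k f => //= k IHk f [df Df]; split=> [x /OO|v]; first exact: df.
exact: IHk.
Qed.

Lemma sm_sub O O' f : O' `<=` O -> sm O f -> sm O' f.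
Proof. by move=> OO sf k; exact: Dk_sub (sf k). Qed.

Lemma Dk_S k O f : Dk k.+1 O f -> Dk k O f.
Proof. by elim: k f => //= k IHk f [df Df]; split=> // v; exact: IHk. Qed.

Lemma derive_add f g x v : derivable f x v -> derivable g x v ->
  dd v (fun y => f y + g y) x = dd v f x + dd v g x.
Proof. by move=> df dg; rewrite !ddE; exact: deriveD. Qed.

Lemma derive_mul f g x v : derivable f x v -> derivable g x v ->
  dd v (fun y => f y * g y) x = dd v f x * g x + f x * dd v g x.
Proof. by move=> df dg; rewrite !ddE (deriveM df dg) addrC mulrC. Qed.

Lemma sm_cst O (c : R) : sm O (fun=> c).
Proof.
move=> k; elim: k c => //= k IHk c; split=> [x _|v]; first exact: differentiable_cst.
have -> : dd v (fun _ : E => c) = (fun=> 0) :> (E -> R).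
  by apply/funext => x; rewrite ddE; exact: derive_cst.
exact: IHk.
Qed.

Lemma DkD k O f g : open O -> Dk k O f -> Dk k O g -> Dk k O (fun x => f x + g x).
Proof.
move=> oO; elim: k f g => //= k IHk f g [df Df] [dg Dg]; split=> [x Ox|v].
  by apply: differentiableD; [exact: df|exact: dg].
apply: (@Dk_eq _ _ (fun x => dd v f x + dd v g x)) => // [x|]; last exact: IHk.
rewrite inE => Ox; rewrite derive_add //; apply: diff_derivable; [exact: df|exact: dg].
Qed.

Lemma DkM k O f g : open O -> Dk k O f -> Dk k O g -> Dk k O (fun x => f x * g x).
Proof.
move=> oO; elim: k f g => //= k IHk f g Df Dg.
have [/Dk_S Dkf /Dk_S Dkg] := (Df, Dg).
case: Df => df Df; case: Dg => dg Dg; split=> [x Ox|v].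
  by apply: differentiableM; [exact: df|exact: dg].
apply: (@Dk_eq _ _ (fun x => dd v f x * g x + f x * dd v g x)) => // [x|].
  by rewrite inE => Ox; rewrite derive_mul //; apply: diff_derivable; [exact: df|exact: dg].
by apply: DkD => //; exact: IHk.
Qed.

Lemma smD O f g : open O -> sm O f -> sm O g -> sm O (fun x => f x + g x).
Proof. by move=> oO sf sg k; exact: DkD. Qed.

Lemma smM O f g : open O -> sm O f -> sm O g -> sm O (fun x => f x * g x).
Proof. by move=> oO sf sg k; exact: DkM. Qed.

Lemma smN O f : open O -> sm O f -> sm O (fun x => - f x).
Proof.
move=> oO sf; apply: (@sm_eq _ (fun x => -1 * f x)) => // [x _|]; first by rewrite mulN1r.
by apply: smM => //; exact: sm_cst.
Qed.

Lemma smB O f g : open O -> sm O f -> sm O g -> sm O (fun x => f x - g x).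
Proof. by move=> oO sf sg; apply: smD => //; exact: smN. Qed.

Lemma sm_sum O (I : Type) (r : seq I) (P : pred I) (F : I -> E -> R) : open O ->
  (forall i, P i -> sm O (F i)) -> sm O (fun x => \sum_(i <- r | P i) F i x).
Proof.
move=> oO sF; elim: r => [|i r IHr].
  apply: (@sm_eq _ (fun=> 0)) => // [x _|]; by [rewrite big_nil|exact: sm_cst].
have [Pi|nPi] := boolP (P i).
  apply: (@sm_eq _ (fun x => F i x + \sum_(i <- r | P i) F i x)) => // [x _|].
    by rewrite big_cons Pi.
  by apply: smD => //; exact: sF.
by apply: sm_eq IHr => // x _; rewrite big_cons (negbTE nPi).
Qed.

Lemma sm_prod O (I : Type) (r : seq I) (P : pred I) (F : I -> E -> R) : open O ->
  (forall i, P i -> sm O (F i)) -> sm O (fun x => \prod_(i <- r | P i) F i x).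
Proof.
move=> oO sF; elim: r => [|i r IHr].
  apply: (@sm_eq _ (fun=> 1)) => // [x _|]; by [rewrite big_nil|exact: sm_cst].
have [Pi|nPi] := boolP (P i).
  apply: (@sm_eq _ (fun x => F i x * \prod_(i <- r | P i) F i x)) => // [x _|].
    by rewrite big_cons Pi.
  by apply: smM => //; exact: sF.
by apply: sm_eq IHr => // x _; rewrite big_cons (negbTE nPi).
Qed.

Lemma smV O f : open O -> (forall x, O x -> f x != 0) -> sm O f ->
  sm O (fun x => (f x)^-1).
Proof.
move=> oO fn0 sf k; elim: k => //= k IHk; split=> [x Ox|v].
  by apply: differentiableV; [exact: sm_diff Ox|exact: fn0].
apply: (@Dk_eq _ _ (fun x => (f x)^-1 * (f x)^-1 * - dd v f x)) => // [x|].
  rewrite inE => Ox; rewrite !ddE (deriveV (fn0 x Ox) (sm_derivable sf Ox)).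
  by rewrite /GRing.scale /= expr2 invfM mulrN mulNr.
by apply: DkM => //; [exact: DkM|apply: smN => //; exact: sm_D].
Qed.

Lemma derive_sumf O (I : Type) (r : seq I) (P : pred I) (F : I -> E -> R) v x :
  open O -> O x -> (forall i, P i -> sm O (F i)) ->
  dd v (fun y => \sum_(i <- r | P i) F i y) x = \sum_(i <- r | P i) dd v (F i) x.
Proof.
move=> oO Ox sF; elim: r => [|i r IHr].
  rewrite big_nil -[RHS](derive_cst (0 : R) x v) -ddE; apply: (@derive_eq_on O) => // y _.
  by rewrite big_nil.
rewrite big_cons -IHr; case: ifP => Pi.
  rewrite -derive_add; first by apply: (@derive_eq_on O) => // y _; rewrite big_cons Pi.
    by apply: (@sm_derivable O) => //; exact: sF.
  by apply: (@sm_derivable O) => //; exact: sm_sum.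
by apply: (@derive_eq_on O) => // y _; rewrite big_cons Pi.
Qed.

Lemma derive_dirD f x u v : differentiable f x ->
  dd (u + v) f x = dd u f x + dd v f x.
Proof. by move=> df; rewrite !ddE !(deriveE _ df) linearD. Qed.

Lemma derive_dirZ f x a v : differentiable f x -> dd (a *: v) f x = a * dd v f x.
Proof. by move=> df; rewrite !ddE !(deriveE _ df) linearZ. Qed.

Lemma derive_dir f x v : differentiable f x ->
  dd v f x = \sum_k v 0 k * dd (basis_vec k) f x.
Proof.
move=> df; rewrite [in LHS](row_sum_delta v) ddE (deriveE _ df) linear_sum.
by apply: eq_bigr => k _; rewrite linearZ /= ddE deriveE.
Qed.

Lemma sm_derive_swap O f u v x : open O -> sm O f -> O x ->
  dd u (dd v f) x = dd v (dd u f) x.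
Proof.
move=> oO sf Ox.
have e w : dd w f = 'D_w f by apply/funext => y; exact: ddE.
have s1 w := sm_D w sf; have s2 w w' := sm_D w (s1 w').
have e2 w w' : dd w (dd w' f) = 'D_w ('D_w' f) by apply/funext => y; rewrite ddE e.
rewrite !e2; apply: (@derive_swap _ _ O _ _ _ _ oO Ox) => [y Oy||].
- split; first exact: sm_derivable sf Oy. exact: sm_derivable sf Oy.
    by have := sm_derivable (v:=u) (s1 v) Oy; rewrite e.
  by have := sm_derivable (v:=v) (s1 u) Oy; rewrite e.
- by have := sm_continuous (s2 u v) Ox; rewrite e2.
- by have := sm_continuous (s2 v u) Ox; rewrite e2.
Qed.

End SmoothScalar.

(** * Smooth matrix-valued functions *)

Section SmoothMatrix.
Context {R : realType} {m : nat}.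
Notation E := 'rV[R]_m.
Implicit Types (O : set E).

Definition smx O {p q} (A : E -> 'M[R]_(p, q)) := forall i j, sm O (fun x => A x i j).

Lemma smx_derivable O p q (A : E -> 'M[R]_(p, q)) x v :
  smx O A -> O x -> derivable A x v.
Proof. by move=> sA Ox; apply/derivable_mxP => i j; exact: sm_derivable Ox. Qed.

Lemma smx_derive O p q (A : E -> 'M[R]_(p, q)) x v i j :
  smx O A -> O x -> dd v A x i j = dd v (fun y => A y i j) x.
Proof.
move=> sA Ox; rewrite !ddE.
apply: etrans (congr1 (fun B : 'M[R]_(p, q) => B i j) (derive_mx (smx_derivable (v:=v) sA Ox))) _.
by rewrite mxE.
Qed.

Lemma smx_eq O p q (A B : E -> 'M[R]_(p, q)) : open O -> {in O, A =1 B} ->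
  smx O A -> smx O B.
Proof. by move=> oO AB sA i j; apply: sm_eq (sA i j) => // x Ox; rewrite AB. Qed.

Lemma smx_D O p q (A : E -> 'M[R]_(p, q)) v : open O -> smx O A -> smx O (dd v A).
Proof.
move=> oO sA i j; apply: (@sm_eq _ _ _ (fun x => dd v (fun y => A y i j) x)) => //.
  by move=> x; rewrite inE => Ox; rewrite (smx_derive _ _ _ sA).
exact: sm_D.
Qed.

Lemma smxD O p q (A B : E -> 'M[R]_(p, q)) : open O -> smx O A -> smx O B ->
  smx O (fun x => A x + B x).
Proof.
move=> oO sA sB i j; apply: (@sm_eq _ _ _ (fun x => A x i j + B x i j)) => //.
  by move=> x _; rewrite mxE.
exact: smD.
Qed.

Lemma smxN O p q (A : E -> 'M[R]_(p, q)) : open O -> smx O A -> smx O (fun x => - A x).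
Proof.
move=> oO sA i j; apply: (@sm_eq _ _ _ (fun x => - A x i j)) => //.
  by move=> x _; rewrite mxE.
exact: smN.
Qed.

Lemma smxM O p q r (A : E -> 'M[R]_(p, q)) (B : E -> 'M[R]_(q, r)) : open O ->
  smx O A -> smx O B -> smx O (fun x => A x *m B x).
Proof.
move=> oO sA sB i j.
apply: (@sm_eq _ _ _ (fun x => \sum_k A x i k * B x k j)) => //.
  by move=> x _; rewrite mxE.
by apply: sm_sum => // k _; exact: smM.
Qed.

Lemma smxZ O p q (a : E -> R) (A : E -> 'M[R]_(p, q)) : open O ->
  sm O a -> smx O A -> smx O (fun x => a x *: A x).
Proof.
move=> oO sa sA i j; apply: (@sm_eq _ _ _ (fun x => a x * A x i j)) => //.
  by move=> x _; rewrite mxE.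
exact: smM.
Qed.

Lemma smx_sum O (I : Type) (r : seq I) (P : pred I) p q (F : I -> E -> 'M[R]_(p, q)) :
  open O -> (forall i, P i -> smx O (F i)) ->
  smx O (fun x => \sum_(i <- r | P i) F i x).
Proof.
move=> oO sF i j.
apply: (@sm_eq _ _ _ (fun x => \sum_(k <- r | P k) F k x i j)) => //.
  by move=> x _; rewrite summxE.
by apply: sm_sum => // k Pk; exact: sF.
Qed.

Lemma smx_cst O p q (A : 'M[R]_(p, q)) : smx O (fun=> A).
Proof. by move=> i j; exact: sm_cst. Qed.

Lemma smx_tr O p q (A : E -> 'M[R]_(p, q)) : open O -> smx O A -> smx O (fun x => (A x)^T).
Proof.
move=> oO sA i j; apply: (@sm_eq _ _ _ (fun x => A x j i)) => // x _.
by rewrite mxE.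
Qed.

Lemma sm_det O p (A : E -> 'M[R]_p) : open O -> smx O A -> sm O (fun x => \det (A x)).
Proof.
move=> oO sA; rewrite /determinant; apply: sm_sum => // s _.
by apply: smM => //; [exact: sm_cst|apply: sm_prod => // i _; exact: sA].
Qed.

Lemma smx_inv O p (A : E -> 'M[R]_p) : open O -> (forall x, O x -> A x \in unitmx) ->
  smx O A -> smx O (fun x => invmx (A x)).
Proof.
move=> oO uA sA.
apply: (@smx_eq _ _ _ (fun x => (\det (A x))^-1 *: \adj (A x))) => // [x|].
  by rewrite inE => Ox; rewrite /invmx uA.
apply: smxZ => // [|i j].
  apply: smV => // [x Ox|]; last exact: sm_det.
  by rewrite -unitfE -unitmxE; exact: uA.
apply: (@sm_eq _ _ _ (fun x => (-1) ^+ (j + i) * \det (row' j (col' i (A x))))) => //.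
  by move=> x _; rewrite mxE.
apply: smM => //; first exact: sm_cst.
apply: sm_det => // k l; apply: (@sm_eq _ _ _ (fun x => A x (lift j k) (lift i l))) => //.
by move=> x _; rewrite !mxE.
Qed.

Lemma derivex_eq_on O p q (A B : E -> 'M[R]_(p, q)) x v : open O -> O x ->
  {in O, A =1 B} -> dd v A x = dd v B x.
Proof.
move=> oO Ox AB; rewrite !ddE; apply: near_eq_derive; near=> y; apply: AB; rewrite inE.
near: y; exact: near_open.
Unshelve. all: by end_near. Qed.

Lemma derivexD O p q (A B : E -> 'M[R]_(p, q)) x v : O x -> smx O A -> smx O B ->
  dd v (fun y => A y + B y) x = dd v A x + dd v B x.
Proof. by move=> Ox sA sB; rewrite !ddE; apply: deriveD; exact: smx_derivable Ox. Qed.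

Lemma derivexM O p q r (A : E -> 'M[R]_(p, q)) (B : E -> 'M[R]_(q, r)) x v :
  open O -> O x -> smx O A -> smx O B ->
  dd v (fun y => A y *m B y) x = dd v A x *m B x + A x *m dd v B x.
Proof.
move=> oO Ox sA sB; apply/matrixP => i j.
rewrite (smx_derive _ _ _ (smxM oO sA sB)) //.
have -> : dd v (fun y => (A y *m B y) i j) x =
          dd v (fun y => \sum_k A y i k * B y k j) x.
  by apply: (derive_eq_on _ oO Ox) => y _; rewrite mxE.
rewrite (derive_sumf _ _ oO Ox); last by move=> k _; exact: smM.
rewrite !mxE -big_split /=; apply: eq_bigr => k _.
by rewrite derive_mul ?(smx_derive _ _ _ sA) ?(smx_derive _ _ _ sB) //;
  exact: sm_derivable Ox.
Qed.

Lemma derivexZ O p q (a : E -> R) (A : E -> 'M[R]_(p, q)) x v :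
  open O -> O x -> sm O a -> smx O A ->
  dd v (fun y => a y *: A y) x = dd v a x *: A x + a x *: dd v A x.
Proof.
move=> oO Ox sa sA; apply/matrixP => i j.
rewrite (smx_derive _ _ _ (smxZ oO sa sA)) // !mxE (smx_derive _ _ _ sA) //.
have -> : dd v (fun y => (a y *: A y) i j) x = dd v (fun y => a y * A y i j) x.
  by apply: (derive_eq_on _ oO Ox) => y _; rewrite mxE.
by rewrite derive_mul //; exact: sm_derivable Ox.
Qed.

Lemma derivex_sum O (I : Type) (r : seq I) (P : pred I) p q (F : I -> E -> 'M[R]_(p, q)) x v :
  open O -> O x -> (forall i, P i -> smx O (F i)) ->
  dd v (fun x => \sum_(i <- r | P i) F i x) x = \sum_(i <- r | P i) dd v (F i) x.
Proof.
move=> oO Ox sF; apply/matrixP => i j.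
rewrite (smx_derive _ _ _ (smx_sum _ oO sF)) // summxE.
have -> : dd v (fun y => (\sum_(k <- r | P k) F k y) i j) x =
          dd v (fun y => \sum_(k <- r | P k) F k y i j) x.
  by apply: (derive_eq_on _ oO Ox) => y _; rewrite summxE.
rewrite (derive_sumf _ _ oO Ox); last by move=> k Pk; exact: sF.
by apply: eq_bigr => k Pk; rewrite (smx_derive _ _ _ (sF k Pk)).
Qed.

Lemma derivex_dirD O p q (A : E -> 'M[R]_(p, q)) x u v : O x -> smx O A ->
  dd (u + v) A x = dd u A x + dd v A x.
Proof.
move=> Ox sA; apply/matrixP => i j.
rewrite mxE !(fun w => smx_derive w i j sA Ox) derive_dirD //.
exact: sm_diff (sA i j) Ox.
Qed.

Lemma derivex_dirZ O p q (A : E -> 'M[R]_(p, q)) x a v : O x -> smx O A ->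
  dd (a *: v) A x = a *: dd v A x.
Proof.
move=> Ox sA; apply/matrixP => i j.
rewrite mxE !(fun w => smx_derive w i j sA Ox) derive_dirZ //.
exact: sm_diff (sA i j) Ox.
Qed.

Lemma derivex_dir O p q (A : E -> 'M[R]_(p, q)) x v : O x -> smx O A ->
  dd v A x = \sum_k v 0 k *: dd (basis_vec k) A x.
Proof.
move=> Ox sA; apply/matrixP => i j; rewrite summxE (smx_derive _ _ _ sA) //.
rewrite derive_dir; last exact: sm_diff Ox.
by apply: eq_bigr => k _; rewrite mxE (smx_derive _ _ _ sA).
Qed.

Lemma smx_derive_swap O p q (A : E -> 'M[R]_(p, q)) u v x : open O -> smx O A -> O x ->
  dd u (dd v A) x = dd v (dd u A) x.
Proof.
move=> oO sA Ox; apply/matrixP => i j.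
have e w z : dd w (dd z A) x i j = dd w (dd z (fun y => A y i j)) x.
  rewrite (smx_derive w i j (smx_D z oO sA) Ox).
  by apply: (derive_eq_on _ oO Ox) => y; rewrite inE => Oy; rewrite (smx_derive z i j sA Oy).
by rewrite (e u v) (e v u); exact: sm_derive_swap (sA i j) Ox.
Qed.

Lemma smx_dX O p q (A : E -> 'M[R]_(p, q)) (X : E -> E) : open O -> smx O A -> smx O X ->
  smx O (fun x => dd (X x) A x).
Proof.
move=> oO sA sX.
apply: (@smx_eq _ _ _ (fun x => \sum_k X x 0 k *: dd (basis_vec k) A x)) => // [x|].
  by rewrite inE => Ox; rewrite [RHS](derivex_dir _ Ox).
by apply: smx_sum => // k _; apply: smxZ => //; exact: smx_D.
Qed.

End SmoothMatrix.

(** * Chain rule *)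

Section Chain.
Context {R : realType} {m k : nat}.
Variables (O : set 'rV[R]_m) (U : set 'rV[R]_k) (F : 'rV[R]_m -> 'rV[R]_k).
Hypotheses (oO : open O) (sF : smx O F) (FU : forall x, O x -> U (F x)).

Lemma smx_row_differentiable x : O x -> differentiable F x.
Proof.
move=> Ox.
have -> : F = \sum_(i < k) (fun y => F y 0 i *: basis_vec i).
  by apply/funext => y; rewrite fct_sumE {1}(row_sum_delta (F y)).
apply: differentiable_sum => i; apply: differentiableZl.
exact: sm_diff (sF 0 i) Ox.
Qed.

Lemma derive_chain (g : 'rV[R]_k -> R) x v : sm U g -> O x ->
  dd v (fun y => g (F y)) x = dd (dd v F x) g (F x).
Proof.
move=> sg Ox.
have dF := smx_row_differentiable Ox.
have dg := sm_diff sg (FU Ox).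
have dgF : differentiable (g \o F) x by exact: differentiable_comp.
by rewrite !ddE (deriveE v dgF) (deriveE _ dg) (deriveE v dF) diff_comp.
Qed.

(** Induction on the order, for all [g] at once: a derivative of the composite is a sum of products
    of derivatives of [F] with composites of partial derivatives of [g], which are again smooth. *)
Lemma sm_comp (g : 'rV[R]_k -> R) : sm U g -> sm O (fun y => g (F y)).
Proof.
move=> + n; elim: n g => //= n IHn g sg; split=> [x Ox|v].
  apply: (@differentiable_comp _ _ _ _ F g); first exact: smx_row_differentiable.
  by apply: (sm_diff sg); exact: FU.
apply: (@Dk_eq _ _ _ _ (fun x => \sum_l dd v (fun y => F y 0 l) x * dd (basis_vec l) g (F x))) => //.
  move=> x; rewrite inE => Ox; rewrite [RHS]derive_chain // [RHS]derive_dir.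
    by apply: eq_bigr => l _; rewrite (smx_derive _ _ _ sF).
  by apply: (sm_diff sg); exact: FU.
(* Only order [n] is available here, while [sm_sum] speaks of all orders; the sum is therefore
   treated term by term. *)
elim: (index_enum _) => [|l r IHr].
  apply: (@Dk_eq _ _ _ _ (fun=> 0)) => // [x _|]; by [rewrite big_nil|exact: sm_cst].
apply: (@Dk_eq _ _ _ _ (fun x => dd v (fun y => F y 0 l) x * dd (basis_vec l) g (F x) +
   \sum_(l <- r) dd v (fun y => F y 0 l) x * dd (basis_vec l) g (F x))) => // [x _|].
  by rewrite big_cons.
apply: DkD => //; apply: DkM => //; first exact: (sm_D _ (sF 0 l)).
by apply: IHn; exact: sm_D.
Qed.

Lemma smx_comp p q (G : 'rV[R]_k -> 'M[R]_(p, q)) : smx U G -> smx O (fun y => G (F y)).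
Proof. by move=> sG i j; exact: (sm_comp (sG i j)). Qed.

Lemma derivex_chain p q (G : 'rV[R]_k -> 'M[R]_(p, q)) x v : smx U G -> O x ->
  dd v (fun y => G (F y)) x = dd (dd v F x) G (F x).
Proof.
move=> sG Ox; apply/matrixP => i j.
rewrite (smx_derive v i j (smx_comp sG) Ox) (smx_derive _ i j sG (FU Ox)).
exact: derive_chain.
Qed.

End Chain.

(** * Comparison of the two notions of smoothness *)

Section FromSmoothOn.
Context {R : realType} {m : nat}.
Notation E := 'rV[R]_m.

Lemma smooth_on_sm (O : set E) (f : E -> R) : open O -> smooth_on O f -> sm O f.
Proof.
move=> oO sf k; elim: k f sf => //= k IHk f sf; split=> [|v].
  apply: C1_differentiable => // [x Ox v|v x Ox].
    by have [_] := sf [::] x Ox.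
  by have [] := sf [:: v] x Ox.
rewrite (_ : dd v f = 'D_v f); last by apply/funext => x; exact: ddE.
(* [iterD] applies the head of the list last, so a direction appended at the end differentiates
   first. *)
apply: IHk => s x Ox; have := sf (rcons s v) x Ox.
suff -> : Defs.iterD (rcons s v) f = Defs.iterD s ('D_v f) by [].
by elim: s => //= w s ->.
Qed.

Lemma smooth_on_smx (O : set E) p q (A : E -> 'M[R]_(p, q)) : open O ->
  smooth_on O A -> smx O A.
Proof.
move=> oO sA i j; apply: smooth_on_sm => //.
have e s : {in O, (fun x => Defs.iterD s A x i j) =1 Defs.iterD s (fun x => A x i j)}.
  elim: s => [|v s IHs] //= x; rewrite inE => Ox.
  rewrite derive_mx ?mxE; last by have [_] := sA s x Ox.
  by rewrite -!ddE; exact: derive_eq_on IHs.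
move=> s x Ox; have [c d] := sA s x Ox; split=> [|v].
  apply: (continuous_eq_on oO Ox (e s)).
  exact: (continuous_comp c (@coord_continuous _ _ _ i j _)).
have /derivable_mxP/(_ i j) dij := d v.
by apply: near_eq_derivable dij; exact: (near_eq_on oO Ox (e s)).
Qed.

End FromSmoothOn.

(** * The Levi-Civita connection in a chart *)

Section InnerProduct.
Context {R : realType} {k : nat}.
Implicit Types (A : 'M[R]_k) (u v w : 'rV[R]_k).

Lemma ipDl A u v w : ip A (u + v) w = ip A u w + ip A v w.
Proof. by rewrite /ip !mulmxDl mxE. Qed.

Lemma ipDr A u v w : ip A u (v + w) = ip A u v + ip A u w.
Proof. by rewrite /ip linearD mulmxDr mxE. Qed.

Lemma ipZl A a u v : ip A (a *: u) v = a * ip A u v.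
Proof. by rewrite /ip -!scalemxAl mxE. Qed.

Lemma ipZr A a u v : ip A u (a *: v) = a * ip A u v.
Proof. by rewrite /ip linearZ -scalemxAr mxE. Qed.

Lemma ipNl A u v : ip A (- u) v = - ip A u v.
Proof. by rewrite -scaleN1r ipZl mulN1r. Qed.

Lemma ip0l A u : ip A 0 u = 0.
Proof. by rewrite -(scale0r 0) ipZl mul0r. Qed.

Lemma ip0r A u : ip A u 0 = 0.
Proof. by rewrite -(scale0r 0) ipZr mul0r. Qed.

Lemma ip_suml A I (r : seq I) (P : pred I) (F : I -> 'rV[R]_k) v :
  ip A (\sum_(i <- r | P i) F i) v = \sum_(i <- r | P i) ip A (F i) v.
Proof.
by elim/big_rec2: _ => [|i x y _ <-]; [rewrite ip0l|rewrite ipDl].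
Qed.

Lemma ip_sumr A I (r : seq I) (P : pred I) (F : I -> 'rV[R]_k) v :
  ip A v (\sum_(i <- r | P i) F i) = \sum_(i <- r | P i) ip A v (F i).
Proof.
by elim/big_rec2: _ => [|i x y _ <-]; [rewrite ip0r|rewrite ipDr].
Qed.

Lemma ipMZ A a u v : ip (a *: A) u v = a * ip A u v.
Proof. by rewrite /ip -scalemxAr -scalemxAl mxE. Qed.

Lemma ipMD A B u v : ip (A + B) u v = ip A u v + ip B u v.
Proof. by rewrite /ip mulmxDr mulmxDl mxE. Qed.

Lemma ipM_sum I (r : seq I) (P : pred I) (F : I -> 'M[R]_k) u v :
  ip (\sum_(i <- r | P i) F i) u v = \sum_(i <- r | P i) ip (F i) u v.
Proof.
elim/big_rec2: _ => [|i x y _ <-]; last by rewrite ipMD.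
by rewrite /ip mulmx0 mul0mx mxE.
Qed.

Lemma ip_sym A u v : A^T = A -> ip A u v = ip A v u.
Proof.
move=> sA; rewrite /ip; have <- : (u *m A *m v^T)^T = v *m A *m u^T.
  by rewrite !trmx_mul trmxK sA mulmxA.
by rewrite [RHS]mxE.
Qed.

Lemma ip_basis A u v : ip A u v = \sum_l ip A u (basis_vec l) * v 0 l.
Proof.
rewrite {1}(row_sum_delta v) ip_sumr; apply: eq_bigr => l _.
by rewrite ipZr mulrC.
Qed.

Lemma pos_unitmx A : (forall v, v != 0 -> 0 < ip A v v) -> A \in unitmx.
Proof.
move=> pA; rewrite -row_free_unit; apply: inj_row_free => v vA.
apply/eqP; apply: contraT => /pA.
by rewrite /ip vA mul0mx mxE ltxx.
Qed.

Lemma ip_inj A u v : A \in unitmx -> (forall z, ip A u z = ip A v z) -> u = v.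
Proof.
move=> uA H; suff : u *m A = v *m A by move/(can_inj (mulmxK uA)).
apply/rowP => l; have := H (basis_vec l).
rewrite /ip /basis_vec trmx_delta.
have e (w : 'rV[R]_k) : (w *m (delta_mx l 0 : 'cV_k)) 0 0 = w 0 l.
  rewrite mxE (bigD1 l) //= mxE !eqxx mulr1 big1 ?addr0 // => j jl.
  by rewrite mxE (negbTE jl) mulr0.
by rewrite !e.
Qed.

End InnerProduct.

(** A sealed copy of [christoffel], made for the same reason as [dd]. *)
Fact Chr_key : {c : forall (R : realType) m, ('rV[R]_m -> 'M[R]_m) ->
    'rV[R]_m -> 'rV[R]_m -> 'rV[R]_m -> 'rV[R]_m | c = fun R m => @christoffel R m}.
Proof. by exists (fun R m => @christoffel R m). Qed.

Definition Chr {R : realType} {m} G x u v : 'rV[R]_m := sval Chr_key R m G x u v.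

Lemma ChrE (R : realType) m (G : 'rV[R]_m -> 'M[R]_m) : Chr G = christoffel G.
Proof.
by apply/funext => x; apply/funext => u; apply/funext => v; rewrite /Chr (svalP Chr_key).
Qed.

Record metric_on (R : realType) (k : nat) (U : set 'rV[R]_k)
    (G : 'rV[R]_k -> 'M[R]_k) : Prop := MetricOn {
  met_open : open U ;
  met_smx : smx U G ;
  met_sym : forall y, U y -> (G y)^T = G y ;
  met_pos : forall y v, U y -> v != 0 -> 0 < ip (G y) v v }.

Section Connection.
Context {R : realType} {k : nat}.
Variables (U : set 'rV[R]_k) (G : 'rV[R]_k -> 'M[R]_k).
Hypothesis mG : metric_on U G.
Let oU := met_open mG.
Let sG := met_smx mG.
Let symG := met_sym mG.
Let posG := met_pos mG.

Lemma unitG y : U y -> G y \in unitmx.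
Proof. by move=> Uy; apply: pos_unitmx => v; exact: posG. Qed.

Lemma symDG u y : U y -> (dd u G y)^T = dd u G y.
Proof.
move=> Uy; apply/matrixP => i j; rewrite mxE !(fun i j => smx_derive u i j sG Uy).
apply: (derive_eq_on _ oU Uy) => z; rewrite inE => Uz.
by rewrite -[in LHS](symG Uz) mxE.
Qed.

Lemma christoffelE y u v : Chr G y u v =
  (\row_l (2^-1 * (ip (dd u G y) v (basis_vec l) + ip (dd v G y) u (basis_vec l)
                   - ip (dd (basis_vec l) G y) u v))) *m invmx (G y).
Proof. by rewrite ChrE; congr (_ *m _); apply/rowP => l; rewrite !mxE !ddE. Qed.

(** [christoffel] prescribes the pairings with basis vectors only; both sides are linear in [z]. As
    the metric is nondegenerate, the algebraic properties of [Chr] are all read off from these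
    pairings. *)
Lemma koszul y u v z : U y -> ip (G y) (Chr G y u v) z =
  2^-1 * (ip (dd u G y) v z + ip (dd v G y) u z - ip (dd z G y) u v).
Proof.
move=> Uy; rewrite christoffelE; set r := \row_l _.
rewrite {1}/ip mulmxKV ?unitG // mxE.
transitivity (\sum_j 2^-1 * (ip (dd u G y) v (basis_vec j) * z 0 j +
    ip (dd v G y) u (basis_vec j) * z 0 j - z 0 j * ip (dd (basis_vec j) G y) u v)).
  apply: eq_bigr => j _; rewrite [z^T j 0]mxE.
  by rewrite /r [(\row_l _) 0 j]mxE; ring.
rewrite -mulr_sumr; congr (_ * _); rewrite big_split big_split /= sumrN -!ip_basis.
congr (_ - _); rewrite (derivex_dir z Uy sG) ipM_sum.
by apply: eq_bigr => j _; rewrite ipMZ.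
Qed.

Lemma christoffel_inj y w w' : U y ->
  (forall z, ip (G y) w z = ip (G y) w' z) -> w = w'.
Proof. by move=> Uy; apply: ip_inj; exact: unitG. Qed.

Lemma christoffelC y u v : U y -> Chr G y u v = Chr G y v u.
Proof.
move=> Uy; apply: (christoffel_inj Uy) => z; rewrite !koszul //.
by rewrite (ip_sym u v) ?symDG // [X in X - _]addrC.
Qed.

Lemma christoffelDr y u v w : U y ->
  Chr G y u (v + w) = Chr G y u v + Chr G y u w.
Proof.
move=> Uy; apply: (christoffel_inj Uy) => z; rewrite ipDl !koszul //.
by rewrite (derivex_dirD v w Uy sG) ipMD ipDl ipDr; ring.
Qed.

Lemma christoffelZr y a u v : U y ->
  Chr G y u (a *: v) = a *: Chr G y u v.
Proof.
move=> Uy; apply: (christoffel_inj Uy) => z; rewrite ipZl !koszul //.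
by rewrite (derivex_dirZ a v Uy sG) ipMZ ipZl ipZr; ring.
Qed.

Lemma christoffelDl y u v w : U y ->
  Chr G y (u + v) w = Chr G y u w + Chr G y v w.
Proof. by move=> Uy; rewrite !(christoffelC _ w) // christoffelDr. Qed.

Lemma christoffelZl y a u v : U y ->
  Chr G y (a *: u) v = a *: Chr G y u v.
Proof. by move=> Uy; rewrite !(christoffelC _ v) // christoffelZr. Qed.

Lemma christoffel_compat y u v w : U y ->
  ip (G y) (Chr G y u v) w + ip (G y) v (Chr G y u w) = ip (dd u G y) v w.
Proof.
move=> Uy; rewrite (ip_sym v) ?symG // !koszul //.
rewrite (ip_sym w v) ?symDG // (ip_sym u v) ?symDG // (ip_sym u w) ?symDG //.
by field.
Qed.

Lemma smx_christoffel u v : smx U (fun y => Chr G y u v).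
Proof.
apply: (@smx_eq _ _ _ _ _ (fun y => (\row_l (2^-1 * (ip (dd u G y) v (basis_vec l) +
   ip (dd v G y) u (basis_vec l) - ip (dd (basis_vec l) G y) u v))) *m invmx (G y))) => //.
  by move=> y _; rewrite christoffelE.
apply: smxM => //; last by apply: smx_inv => // y Uy; exact: unitG.
have sip a b c : sm U (fun y => ip (dd a G y) b c).
  have : smx U (fun y => b *m dd a G y *m c^T).
    apply: smxM => //; last exact: smx_cst.
    by apply: smxM => //; [exact: smx_cst|exact: smx_D].
  exact.
move=> i j; apply: (@sm_eq _ _ _ (fun y => 2^-1 * (ip (dd u G y) v (basis_vec j) +
   ip (dd v G y) u (basis_vec j) - ip (dd (basis_vec j) G y) u v))) => //.
  by move=> y _; rewrite mxE.
apply: smM => //; first exact: sm_cst.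
by apply: smB => //; apply: smD.
Qed.

(* The connection matrix: v *m conn_mx u y is the covariant derivative of the constant
   field v in the direction u. *)
Definition conn_mx (u y : 'rV[R]_k) : 'M[R]_k :=
  \matrix_(a, b) Chr G y u (basis_vec a) 0 b.

Lemma smx_conn_mx u : smx U (conn_mx u).
Proof.
move=> a b; apply: (@sm_eq _ _ _ (fun y => Chr G y u (basis_vec a) 0 b)) => //.
  by move=> y _; rewrite [RHS]mxE.
exact: smx_christoffel.
Qed.

Lemma christoffel_sumr y u I (r : seq I) (P : pred I) (F : I -> 'rV[R]_k) : U y ->
  Chr G y u (\sum_(i <- r | P i) F i) = \sum_(i <- r | P i) Chr G y u (F i).
Proof.
move=> Uy; elim/big_rec2: _ => [|i a b _ <-]; last exact: christoffelDr.
by have := christoffelZr 0 u 0 Uy; rewrite !scale0r.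
Qed.

Lemma christoffel_conn_mx y u v : U y -> Chr G y u v = v *m conn_mx u y.
Proof.
move=> Uy; rewrite [in LHS](row_sum_delta v) christoffel_sumr //.
apply/rowP => b; rewrite summxE mxE; apply: eq_bigr => a _.
by rewrite christoffelZr // mxE [conn_mx u y a b]mxE.
Qed.

Lemma conn_mx_dir y u : U y -> conn_mx u y = \sum_l u 0 l *: conn_mx (basis_vec l) y.
Proof.
move=> Uy; apply/row_matrixP => a; rewrite !rowE -christoffel_conn_mx // christoffelC //.
rewrite {1}(row_sum_delta u) christoffel_sumr // mulmx_sumr; apply: eq_bigr => l _.
by rewrite christoffelZr // -scalemxAr christoffelC // christoffel_conn_mx.
Qed.

End Connection.

(** * Covariant derivatives along a map *)

Section Bracket.
Context {R : realType} {m : nat}.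
Notation E := 'rV[R]_m.
Variables (O : set E) (p q : nat) (F : E -> 'M[R]_(p, q)).
Hypotheses (oO : open O) (sF : smx O F).

(** The double sum is the Hessian of [F] applied to [A] and [B]. It is symmetric, so only the first
    term survives in a commutator. *)
Lemma derivex_field (A B : E -> E) x : O x -> smx O A -> smx O B ->
  dd (A x) (fun y => dd (B y) F y) x =
  dd (dd (A x) B x) F x + \sum_l \sum_j (A x 0 j * B x 0 l) *:
    dd (basis_vec j) (dd (basis_vec l) F) x.
Proof.
move=> Ox sA sB.
have sDF l := smx_D (basis_vec l) oO sF.
transitivity (dd (A x) (fun y => \sum_l B y 0 l *: dd (basis_vec l) F y) x).
  by apply: (derivex_eq_on _ oO Ox) => y; rewrite inE => Oy; rewrite (derivex_dir _ Oy sF).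
rewrite (derivex_sum (index_enum _) (A x) (P:=xpredT) (F:=fun l y => B y 0 l *: dd (basis_vec l) F y) oO Ox); last first.
  by move=> l _; apply: smxZ => //; exact: sB.
rewrite (derivex_dir (dd (A x) B x) Ox sF) -big_split; apply: eq_bigr => l _ /=.
rewrite (derivexZ (A x) oO Ox (sB 0 l) (sDF l)) (smx_derive _ _ _ sB Ox); congr (_ + _).
rewrite (derivex_dir (A x) Ox (sDF l)) scaler_sumr; apply: eq_bigr => j _.
by rewrite scalerA mulrC.
Qed.

Lemma derivex_bracket (X Y : E -> E) x : O x -> smx O X -> smx O Y ->
  dd (X x) (fun y => dd (Y y) F y) x - dd (Y x) (fun y => dd (X y) F y) x =
  dd (dd (X x) Y x - dd (Y x) X x) F x.
Proof.
move=> Ox sX sY.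
rewrite !derivex_field // -[- dd (Y x) X x]scaleN1r.
rewrite (derivex_dirD _ _ Ox sF) (derivex_dirZ _ _ Ox sF) scaleN1r.
rewrite opprD addrACA [X in _ + X](_ : _ = 0) ?addr0 //.
apply/eqP; rewrite subr_eq0 exchange_big; apply/eqP.
apply: eq_bigr => j _; apply: eq_bigr => l _ /=.
by rewrite mulrC (smx_derive_swap _ _ oO sF Ox).
Qed.

End Bracket.

Section Along.
Context {R : realType} {m k : nat}.
Notation E := 'rV[R]_m.
Variables (U : set 'rV[R]_k) (G : 'rV[R]_k -> 'M[R]_k).
Hypothesis mG : metric_on U G.
Let sG := met_smx mG.
Variables (O : set E) (F : E -> 'rV[R]_k).
Hypotheses (oO : open O) (sF : smx O F) (FU : forall x, O x -> U (F x)).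

Definition covd (v : E) (V : E -> 'rV[R]_k) (x : E) : 'rV[R]_k :=
  dd v V x + Chr G (F x) (dd v F x) (V x).

Lemma cov_alongE X V : cov_along G F X V = fun x => covd (X x) V x.
Proof. by apply/funext => x; rewrite /covd !ddE ChrE. Qed.

(** The connection matrix in the direction dF(X), expanded over constant directions of the target so
    that it can be differentiated along the source. *)
Definition pull_conn (X : E -> E) (x : E) : 'M[R]_k :=
  \sum_l dd (X x) F x 0 l *: conn_mx G (basis_vec l) (F x).

Lemma covdE X V x : O x -> covd (X x) V x = dd (X x) V x + V x *m pull_conn X x.
Proof.
move=> Ox; congr (_ + _).
rewrite (christoffel_conn_mx mG _ _ (FU Ox)).
by rewrite (conn_mx_dir mG _ (FU Ox)).
Qed.

Lemma smx_pull_conn X : smx O X -> smx O (pull_conn X).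
Proof.
move=> sX; apply: smx_sum => // l _; apply: smxZ => //; first exact: (smx_dX oO sF sX).
by apply: (smx_comp oO sF FU); exact: (smx_conn_mx mG).
Qed.

Lemma smx_covd X V : smx O X -> smx O V -> smx O (fun x => covd (X x) V x).
Proof.
move=> sX sV; apply: (@smx_eq _ _ _ _ _ (fun x => dd (X x) V x + V x *m pull_conn X x)) => //.
  by move=> x; rewrite inE => Ox; rewrite covdE.
by apply: smxD => //; [exact: smx_dX|apply: smxM => //; exact: smx_pull_conn].
Qed.

Lemma covd_eq v V W x : O x -> {in O, V =1 W} -> covd v V x = covd v W x.
Proof.
by move=> Ox VW; rewrite /covd (derivex_eq_on v oO Ox VW) VW ?inE.
Qed.

Lemma covdD v V W x : O x -> smx O V -> smx O W ->
  covd v (fun y => V y + W y) x = covd v V x + covd v W x.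
Proof.
move=> Ox sV sW; rewrite /covd (derivexD v Ox sV sW).
by rewrite (christoffelDr mG _ _ _ (FU Ox)) addrACA.
Qed.

Lemma covdZ v a V x : O x -> sm O a -> smx O V ->
  covd v (fun y => a y *: V y) x = dd v a x *: V x + a x *: covd v V x.
Proof.
move=> Ox sa sV; rewrite /covd (derivexZ v oO Ox sa sV).
by rewrite (christoffelZr mG _ _ _ (FU Ox)) scalerDr addrA.
Qed.

Lemma covd_sum v I (r : seq I) (P : pred I) (V : I -> E -> 'rV[R]_k) x : O x ->
  (forall i, P i -> smx O (V i)) ->
  covd v (fun y => \sum_(i <- r | P i) V i y) x = \sum_(i <- r | P i) covd v (V i) x.
Proof.
move=> Ox sV; rewrite /covd (derivex_sum r v oO Ox sV).
by rewrite (christoffel_sumr mG _ _ _ _ (FU Ox)) big_split.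
Qed.

Lemma covd_dirD u v V x : O x -> smx O V -> covd (u + v) V x = covd u V x + covd v V x.
Proof.
move=> Ox sV; rewrite /covd (derivex_dirD u v Ox sV) (derivex_dirD u v Ox sF).
by rewrite (christoffelDl mG _ _ _ (FU Ox)) addrACA.
Qed.

Lemma covd_dirZ a v V x : O x -> smx O V -> covd (a *: v) V x = a *: covd v V x.
Proof.
move=> Ox sV; rewrite /covd (derivex_dirZ a v Ox sV) (derivex_dirZ a v Ox sF).
by rewrite (christoffelZl mG _ _ _ (FU Ox)) scalerDr.
Qed.

Lemma covd_dir_sum I (r : seq I) (P : pred I) (u : I -> E) V x : O x -> smx O V ->
  covd (\sum_(i <- r | P i) u i) V x = \sum_(i <- r | P i) covd (u i) V x.
Proof.
move=> Ox sV; elim/big_rec2: _ => [|i a b _ <-]; last exact: covd_dirD.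
by have := covd_dirZ 0 0 Ox sV; rewrite !scale0r.
Qed.

Lemma sm_ip V W : smx O V -> smx O W -> sm O (fun y => ip (G (F y)) (V y) (W y)).
Proof.
move=> sV sW; have : smx O (fun y => V y *m G (F y) *m (W y)^T).
  apply: smxM => //; last exact: smx_tr.
  by apply: smxM => //; exact: (smx_comp oO sF FU).
exact.
Qed.

Lemma covd_compat v V W x : O x -> smx O V -> smx O W ->
  dd v (fun y => ip (G (F y)) (V y) (W y)) x =
  ip (G (F x)) (covd v V x) (W x) + ip (G (F x)) (V x) (covd v W x).
Proof.
move=> Ox sV sW.
have sGF := smx_comp oO sF FU sG.
have sVG := smxM oO sV sGF.
have sWT := smx_tr oO sW.
have -> : dd v (fun y => ip (G (F y)) (V y) (W y)) x =
   dd v (fun y => V y *m G (F y) *m (W y)^T) x 0 0.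
  by rewrite (smx_derive v 0 0 (smxM oO sVG sWT) Ox).
rewrite (derivexM v oO Ox sVG sWT) (derivexM v oO Ox sV sGF).
rewrite (derivex_chain oO sF FU v sG Ox).
have -> : dd v (fun y => (W y)^T) x = (dd v W x)^T.
  apply/matrixP => i j; rewrite (smx_derive v i j sWT Ox) [RHS]mxE (smx_derive v j i sW Ox).
  by apply: (derive_eq_on _ oO Ox) => y _; rewrite mxE.
rewrite /covd ipDl ipDr.
rewrite [RHS](_ : _ = ip (G (F x)) (dd v V x) (W x) + ip (G (F x)) (V x) (dd v W x) +
  (ip (G (F x)) (Chr G (F x) (dd v F x) (V x)) (W x) +
   ip (G (F x)) (V x) (Chr G (F x) (dd v F x) (W x)))); last by ring.
rewrite (christoffel_compat mG _ _ _ (FU Ox)) /ip mulmxDl !mxE.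
by ring.
Qed.

Lemma covd_torsion X Y x : O x -> smx O X -> smx O Y ->
  covd (X x) (fun y => dd (Y y) F y) x - covd (Y x) (fun y => dd (X y) F y) x =
  dd (dd (X x) Y x - dd (Y x) X x) F x.
Proof.
move=> Ox sX sY.
rewrite /covd (christoffelC mG _ _ (FU Ox)) opprD addrACA subrr addr0.
by apply: (derivex_bracket oO sF).
Qed.

(* With F = id this is the curvature tensor itself, see [covd_curvature]. *)
Lemma covd_curvature_aux X Y V x : O x -> smx O X -> smx O Y -> smx O V ->
  let a := dd (X x) F x in let b := dd (Y x) F x in
  covd (X x) (fun y => covd (Y y) V y) x - covd (Y x) (fun y => covd (X y) V y) x
    - covd (dd (X x) Y x - dd (Y x) X x) V x =
  V x *m (\sum_l (b 0 l *: dd a (conn_mx G (basis_vec l)) (F x)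
                  - a 0 l *: dd b (conn_mx G (basis_vec l)) (F x))
          + conn_mx G b (F x) *m conn_mx G a (F x) - conn_mx G a (F x) *m conn_mx G b (F x)).
Proof.
move=> Ox sX sY sV a b.
have sO l := smx_conn_mx mG (basis_vec l).
have sOF l := smx_comp oO sF FU (sO l).
have dP (Z W : E -> E) : smx O Z -> smx O W ->
    dd (Z x) (pull_conn W) x = \sum_l (dd (Z x) (fun y => dd (W y) F y) x 0 l *: conn_mx G (basis_vec l) (F x)
      + dd (W x) F x 0 l *: dd (dd (Z x) F x) (conn_mx G (basis_vec l)) (F x)).
  move=> sZ sW; have sWF := smx_dX oO sF sW.
  rewrite (derivex_sum (index_enum _) (Z x) (P:=xpredT)
    (F:=fun l y => dd (W y) F y 0 l *: conn_mx G (basis_vec l) (F y)) oO Ox); last first.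
    by move=> l _; apply: smxZ => //; exact: sWF.
  apply: eq_bigr => l _; rewrite (derivexZ (Z x) oO Ox (sWF 0 l) (sOF l)).
  by rewrite (smx_derive _ _ _ sWF Ox) (derivex_chain oO sF FU _ (sO l) Ox).
have CC (Z W : E -> E) : smx O Z -> smx O W ->
    covd (Z x) (fun y => covd (W y) V y) x = dd (Z x) (fun y => dd (W y) V y) x
     + dd (Z x) V x *m pull_conn W x + V x *m dd (Z x) (pull_conn W) x
     + (dd (W x) V x *m pull_conn Z x + V x *m pull_conn W x *m pull_conn Z x).
  move=> sZ sW; rewrite covdE // covdE // mulmxDl; congr (_ + _).
  have sWV := smx_dX oO sV sW; have sP := smx_pull_conn sW.
  transitivity (dd (Z x) (fun y => dd (W y) V y + V y *m pull_conn W y) x).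
    by apply: (derivex_eq_on _ oO Ox) => y; rewrite inE => Oy; rewrite covdE.
  by rewrite (derivexD _ Ox sWV (smxM oO sV sP)) (derivexM _ oO Ox sV sP) addrA.
have sBr : smx O (fun y => dd (X y) Y y - dd (Y y) X y).
  by apply: smxD => //; [exact: smx_dX|apply: smxN => //; exact: smx_dX].
rewrite !CC // [covd (_ - _) V x](covdE (fun y => dd (X y) Y y - dd (Y y) X y) V Ox).
rewrite -(derivex_bracket oO sV Ox sX sY).
have PO W : pull_conn W x = conn_mx G (dd (W x) F x) (F x).
  by rewrite (conn_mx_dir mG _ (FU Ox)).
rewrite -!PO.
have -> : pull_conn (fun y => dd (X y) Y y - dd (Y y) X y) x =
   dd (X x) (pull_conn Y) x - dd (Y x) (pull_conn X) x -
   (\sum_l (b 0 l *: dd a (conn_mx G (basis_vec l)) (F x)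
           - a 0 l *: dd b (conn_mx G (basis_vec l)) (F x))).
  rewrite !dP // /pull_conn -(derivex_bracket oO sF Ox sX sY) -!sumrB; apply: eq_bigr => l _.
  rewrite !mxE scalerBl -/a -/b; set s1 := _ *: _; set s2 := _ *: _.
  set t1 := _ *: _; set t2 := _ *: _.
  by apply/matrixP => i j; rewrite !mxE; ring.
set S := \sum_l _.
rewrite !mulmxDr !mulmxN !mulmxA.
set d1 := dd (X x) (fun y => _) x; set d2 := dd (Y x) (fun y => _) x.
set p1 := dd (X x) V x *m _; set p2 := V x *m dd (X x) _ x.
set p3 := dd (Y x) V x *m _; set p4 := V x *m dd (Y x) _ x.
set p5 := V x *m pull_conn Y x *m _; set p6 := V x *m pull_conn X x *m _; set p7 := V x *m S.
by apply/rowP => j; rewrite !mxE; ring.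
Qed.

End Along.

(** * Curvature of the pulled back connection *)

Section CurvatureAlong.
Context {R : realType} {m k : nat}.
Variables (U : set 'rV[R]_k) (G : 'rV[R]_k -> 'M[R]_k) (mG : metric_on U G).
Variables (O : set 'rV[R]_m) (F : 'rV[R]_m -> 'rV[R]_k).
Hypotheses (oO : open O) (sF : smx O F) (FU : forall x, O x -> U (F x)).

Lemma smx_id (W : set 'rV[R]_k) : open W -> smx W id.
Proof.
move=> oW i j.
have h (y : 'rV[R]_k) : differentiable (fun x : 'rV[R]_k => x i j) y.
  exact: differentiable_coord.
case=> // n; split=> // v; apply: (@Dk_eq _ _ _ _ (fun=> v i j)) => // [y _|]; last first.
  exact: (sm_cst W (v i j) n).
have dfy := h y.
rewrite ddE deriveE //.
have cc : continuous (fun x : 'rV[R]_k => x i j) by exact: coord_continuous.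
have lin : linear (fun x : 'rV[R]_k => x i j : R) by move=> a u w; rewrite !mxE.
pose L : {linear 'rV[R]_k -> R} := HB.pack (fun x : 'rV[R]_k => x i j : R)
  (GRing.isLinear.Build _ _ _ _ _ lin).
by rewrite (@diff_lin _ _ _ L y).
Qed.

Lemma dd_id (u y : 'rV[R]_k) : dd u id y = u.
Proof. by rewrite ddE derive_id. Qed.

Lemma curvatureE y u v w : U y -> curvature G y u v w =
  w *m (\sum_l (v 0 l *: dd u (conn_mx G (basis_vec l)) y - u 0 l *: dd v (conn_mx G (basis_vec l)) y)
          + conn_mx G v y *m conn_mx G u y - conn_mx G u y *m conn_mx G v y).
Proof.
move=> Uy; have oU := met_open mG.
have := @covd_curvature_aux R k k U G mG U id oU (smx_id oU) (fun _ h => h)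
  (cst u) (cst v) (cst w) y Uy (smx_cst U u) (smx_cst U v) (smx_cst U w).
rewrite /= !dd_id => <-.
have eb : lie_bracket (cst u) (cst v) = fun z => dd u (cst v) z - dd v (cst u) z.
  by apply/funext => z; rewrite !ddE.
by rewrite /curvature /curvature_op /levi_civita eb !cov_alongE.
Qed.

(** The commutator is an expression in the connection matrices at [F x] that depends on the fields
    only through their values dF(X), dF(Y) and V at [x]. Constant fields and F = id give the same
    expression, and there it is the curvature of the target. *)
Lemma covd_curvature X Y V x : O x -> smx O X -> smx O Y -> smx O V ->
  covd G F (X x) (fun y => covd G F (Y y) V y) x - covd G F (Y x) (fun y => covd G F (X y) V y) x
    - covd G F (dd (X x) Y x - dd (Y x) X x) V x =
  curvature G (F x) (dd (X x) F x) (dd (Y x) F x) (V x).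
Proof.
move=> Ox sX sY sV; rewrite (curvatureE _ _ _ (FU Ox)).
exact: (covd_curvature_aux mG oO sF FU Ox sX sY sV).
Qed.

(** The product rule separates the variation of [V] from that of [J]; the latter is the parallelism
    hypothesis for the constant field with value [V x]. *)
Lemma covd_parallel (J : 'rV[R]_k -> 'M[R]_k) v V x : smx U J ->
  (forall y u w, U y -> levi_civita G (cst u) (fun z => w *m J z) y =
     levi_civita G (cst u) (cst w) y *m J y) ->
  O x -> smx O V ->
  covd G F v (fun y => V y *m J (F y)) x = covd G F v V x *m J (F x).
Proof.
move=> sJ parJ Ox sV.
have sJF := smx_comp oO sF FU sJ.
have oU := met_open mG; have Uy := FU Ox.
rewrite /covd (derivexM v oO Ox sV sJF) (derivex_chain oO sF FU v sJ Ox) mulmxDl -addrA.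
congr (_ + _).
have := parJ _ (dd v F x) (V x) Uy; rewrite /levi_civita !cov_alongE /covd !dd_id.
rewrite (derivexM _ oU Uy (smx_cst U (V x)) sJ).
have -> : dd (dd v F x) (cst (V x)) (F x) = 0 by rewrite ddE derive_cst.
by rewrite mul0mx !add0r.
Qed.

Lemma second_formE n (g : 'rV[R]_n -> 'M[R]_n) (G' : 'rV[R]_k -> 'M[R]_k)
    (F' : 'rV[R]_n -> 'rV[R]_k) X Y x :
  second_form g G' F' X Y x =
  covd G' F' (X x) (fun y => dd (Y y) F' y) x - dd (covd g id (X x) Y x) F' x.
Proof.
rewrite /second_form /levi_civita !cov_alongE /push ddE; congr (covd _ _ _ _ _ - _).
by apply/funext => y; rewrite ddE.
Qed.

End CurvatureAlong.

(** * Structure equations in an adapted frame *)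

(* Components in a frame [X_a], [J X_a] of the covariant derivative along [X_a] of
   the section with components [p], [q]. *)
Definition cov_e {R : realType} {n} (X : 'I_n -> 'rV[R]_n -> 'rV[R]_n)
    (Gam C : 'I_n -> 'I_n -> 'I_n -> 'rV[R]_n -> R) a (p q : 'I_n -> 'rV[R]_n -> R) d x : R :=
  dd (X a x) (p d) x + \sum_s (p s x * Gam a s d x - q s x * C a s d x).
Definition cov_f {R : realType} {n} (X : 'I_n -> 'rV[R]_n -> 'rV[R]_n)
    (Gam C : 'I_n -> 'I_n -> 'I_n -> 'rV[R]_n -> R) a (p q : 'I_n -> 'rV[R]_n -> R) d x : R :=
  dd (X a x) (q d) x + \sum_s (q s x * Gam a s d x + p s x * C a s d x).

Definition trC {R : realType} {n} (C : 'I_n -> 'I_n -> 'I_n -> 'rV[R]_n -> R) c x : R :=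
  \sum_a C a a c x.

Definition cst0 {R : realType} {n} : 'I_n -> 'rV[R]_n -> R := fun _ _ => 0.

Section Frame.
Context {R : realType} {n k : nat}.
Notation E := 'rV[R]_n.
Variables (U : set 'rV[R]_k) (G J : 'rV[R]_k -> 'M[R]_k).
Variables (O : set E) (g : E -> 'M[R]_n) (F : E -> 'rV[R]_k).
Hypotheses (mG : metric_on U G) (mg : metric_on O g).
Hypotheses (sF : smx O F) (FU : forall x, O x -> U (F x)).
Hypotheses (sJ : smx U J) (JJ : forall y, U y -> J y *m J y = - 1%:M).
Hypothesis hermJ : forall y u v, U y -> ip (G y) (u *m J y) (v *m J y) = ip (G y) u v.
Hypothesis parJ : forall y u w, U y -> levi_civita G (cst u) (fun z => w *m J z) y =
     levi_civita G (cst u) (cst w) y *m J y.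
Hypothesis iso : forall x u v, O x ->
  ip (G (F x)) (dd u F x) (dd v F x) = ip (g x) u v.
Hypothesis lag : forall x u v, O x ->
  ip (G (F x)) (dd u F x *m J (F x)) (dd v F x) = 0.
Variables (X : 'I_n -> E -> E).
Hypothesis sX : forall a, smx O (X a).
Hypothesis onX : forall a b x, O x -> ip (g x) (X a x) (X b x) = (a == b)%:R.

Let oO := met_open mg.

(* [fe a] and [ff a = J (fe a)] form an orthonormal frame of the pulled back tangent
   bundle, tangent and normal to the immersion respectively. *)
Definition fe a x : 'rV[R]_k := dd (X a x) F x.
Definition ff a x : 'rV[R]_k := fe a x *m J (F x).

Definition Gam a b c x : R := ip (g x) (covd g id (X a x) (X b) x) (X c x).

Definition sff a b x : 'rV[R]_k := second_form g G F (X a) (X b) x.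

Variable C : 'I_n -> 'I_n -> 'I_n -> E -> R.
Hypothesis sC : forall a b c, sm O (C a b c).
Hypothesis hC : forall a b x, O x -> sff a b x = \sum_c C a b c x *: ff c x.

Lemma sfe a : smx O (fe a).
Proof. exact: (smx_dX oO sF). Qed.

Lemma smff a : smx O (ff a).
Proof. by apply: smxM => //; [exact: sfe|exact: (smx_comp oO sF FU)]. Qed.

Lemma sGam a b c : sm O (Gam a b c).
Proof.
apply: (sm_ip mg oO (smx_id oO) (fun _ h => h)) => //.
exact: (smx_covd mg oO (smx_id oO) (fun _ h => h)).
Qed.

Lemma fe_on a b x : O x -> ip (G (F x)) (fe a x) (fe b x) = (a == b)%:R.
Proof. by move=> Ox; rewrite iso // onX. Qed.

Lemma ff_on a b x : O x -> ip (G (F x)) (ff a x) (ff b x) = (a == b)%:R.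
Proof. by move=> Ox; rewrite hermJ ?fe_on //; exact: FU. Qed.

Lemma ff_fe a b x : O x -> ip (G (F x)) (ff a x) (fe b x) = 0.
Proof. by move=> Ox; rewrite lag. Qed.

Lemma fe_ff a b x : O x -> ip (G (F x)) (fe a x) (ff b x) = 0.
Proof. by move=> Ox; rewrite ip_sym ?ff_fe // (met_sym mG) //; exact: FU. Qed.

Lemma ffJ a x : O x -> ff a x *m J (F x) = - fe a x.
Proof. by move=> Ox; rewrite -mulmxA JJ ?mulmxN ?mulmx1 //; exact: FU. Qed.

Lemma frame_mx x : O x -> let A := \matrix_(a, j) X a x 0 j in
  A *m g x *m A^T = 1%:M.
Proof.
move=> Ox A; apply/matrixP => a b; rewrite [RHS]mxE -(onX a b Ox).
rewrite /ip mxE [RHS]mxE; apply: eq_bigr => j _; congr (_ * _); last by rewrite !mxE.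
by rewrite mxE [RHS]mxE; apply: eq_bigr => l _; rewrite mxE.
Qed.

(** Converts a trace taken with the inverse Gram matrix into a sum over the orthonormal frame. *)
Lemma invg x : O x -> let A := \matrix_(a, j) X a x 0 j in
  invmx (g x) = A^T *m A.
Proof.
move=> Ox A; have AgA := frame_mx Ox.
have ug : g x \in unitmx by apply: pos_unitmx => v; exact: (met_pos mg).
have : A^T *m (A *m g x) = 1%:M by apply: mulmx1C.
rewrite mulmxA => h.
by rewrite -[LHS]mul1mx -h mulmxK.
Qed.

Lemma frame_exp x (w : E) : O x -> w = \sum_c ip (g x) w (X c x) *: X c x.
Proof.
move=> Ox; have AgA := frame_mx Ox; have iv := invg Ox.
have ug : g x \in unitmx by apply: pos_unitmx => v; exact: (met_pos mg).
rewrite -{1}(mulmxK ug w) iv mulmxA.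
set A := \matrix_(a, j) X a x 0 j.
rewrite mulmx_sum_row; apply: eq_bigr => c _; congr (_ *: _).
  rewrite /ip [LHS]mxE [RHS]mxE; apply: eq_bigr => j _.
  by rewrite !mxE.
by apply/rowP => j; rewrite !mxE.
Qed.

Lemma Gam_anti a b c x : O x -> Gam a b c x = - Gam a c b x.
Proof.
move=> Ox; apply/eqP; rewrite -addr_eq0; apply/eqP.
rewrite /Gam [X in _ + X]ip_sym ?(met_sym mg) //.
have := covd_compat mg oO (smx_id oO) (fun _ h => h) (X a x) Ox (sX b) (sX c).
move=> <-.
transitivity (dd (X a x) (fun=> (b == c)%:R : R) x).
  by apply: (derive_eq_on _ oO Ox) => y; rewrite inE => Oy; rewrite onX.
by rewrite ddE derive_cst.
Qed.

Lemma covd_X a b x : O x -> covd g id (X a x) (X b) x = \sum_c Gam a b c x *: X c x.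
Proof. by move=> Ox; exact: frame_exp. Qed.

Lemma dd_sum_dir p q (W : E -> 'M[R]_(p, q)) (c : 'I_n -> R) x : O x -> smx O W ->
  dd (\sum_a c a *: X a x) W x = \sum_a c a *: dd (X a x) W x.
Proof.
move=> Ox sW; apply/matrixP => i j.
rewrite (smx_derive _ _ _ sW Ox) summxE ddE deriveE; last exact: sm_diff (sW i j) Ox.
rewrite linear_sum; apply: eq_bigr => a _; rewrite linearZ mxE (smx_derive _ _ _ sW Ox).
by rewrite ddE deriveE //; exact: sm_diff (sW i j) Ox.
Qed.

Lemma covd_fe a b x : O x -> covd G F (X a x) (fe b) x =
  \sum_c Gam a b c x *: fe c x + \sum_c C a b c x *: ff c x.
Proof.
move=> Ox; rewrite -(hC a b Ox) /sff second_formE (covd_X a b Ox).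
by rewrite (dd_sum_dir _ Ox sF) addrC subrK.
Qed.

(** [J] is parallel, so this is [J] applied to the Gauss formula; J^2 = -1 gives the sign, and the
    same coefficients [C] describe the shape operators. *)
Lemma covd_ff a b x : O x -> covd G F (X a x) (ff b) x =
  \sum_c Gam a b c x *: ff c x - \sum_c C a b c x *: fe c x.
Proof.
move=> Ox.
rewrite (covd_parallel mG oO sF FU (X a x) sJ parJ Ox (sfe b)) covd_fe // mulmxDl.
rewrite !mulmx_suml; congr (_ + _).
  by apply: eq_bigr => c _; rewrite -scalemxAl.
rewrite -sumrN; apply: eq_bigr => c _.
by rewrite -scalemxAl ffJ // scalerN.
Qed.

Definition comb (p q : 'I_n -> E -> R) (x : E) : 'rV[R]_k :=
  \sum_c p c x *: fe c x + \sum_c q c x *: ff c x.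

Local Notation dp := (cov_e X Gam C).
Local Notation dq := (cov_f X Gam C).

Lemma scale_sum2 (p : 'I_n -> R) (A : 'I_n -> 'I_n -> R) (v : 'I_n -> 'rV[R]_k) :
  \sum_c p c *: (\sum_d A c d *: v d) = \sum_d (\sum_c p c * A c d) *: v d.
Proof.
transitivity (\sum_c \sum_d (p c * A c d) *: v d).
  by apply: eq_bigr => c _; rewrite scaler_sumr; apply: eq_bigr => d _; rewrite scalerA.
by rewrite exchange_big; apply: eq_bigr => d _; rewrite scaler_suml.
Qed.

Lemma smx_comb p q : (forall c, sm O (p c)) -> (forall c, sm O (q c)) -> smx O (comb p q).
Proof.
move=> sp sq; apply: smxD => //; apply: smx_sum => // c _; apply: smxZ => //.
  exact: sfe.
exact: smff.
Qed.

Lemma covd_comb a p q x : O x -> (forall c, sm O (p c)) -> (forall c, sm O (q c)) ->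
  covd G F (X a x) (comb p q) x = comb (dp a p q) (dq a p q) x.
Proof.
move=> Ox sp sq.
have spe c : smx O (fun y => p c y *: fe c y) by apply: smxZ => //; exact: sfe.
have sqf c : smx O (fun y => q c y *: ff c y) by apply: smxZ => //; exact: smff.
rewrite (covdD mG FU (X a x) Ox (smx_sum _ oO (fun c _ => spe c)) (smx_sum _ oO (fun c _ => sqf c))).
rewrite (covd_sum mG oO FU _ _ Ox (fun c _ => spe c)) (covd_sum mG oO FU _ _ Ox (fun c _ => sqf c)).
have -> : \sum_c covd G F (X a x) (fun y => p c y *: fe c y) x =
   \sum_c dd (X a x) (p c) x *: fe c x + (\sum_d (\sum_c p c x * Gam a c d x) *: fe d x
     + \sum_d (\sum_c p c x * C a c d x) *: ff d x).
  rewrite -!scale_sum2 -!big_split; apply: eq_bigr => c _ /=.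
  by rewrite (covdZ mG oO FU _ Ox (sp c) (sfe c)) covd_fe // scalerDr.
have -> : \sum_c covd G F (X a x) (fun y => q c y *: ff c y) x =
   \sum_c dd (X a x) (q c) x *: ff c x + (\sum_d (\sum_c q c x * Gam a c d x) *: ff d x
     - \sum_d (\sum_c q c x * C a c d x) *: fe d x).
  rewrite -!scale_sum2 -sumrB -!big_split; apply: eq_bigr => c _ /=.
  by rewrite (covdZ mG oO FU _ Ox (sq c) (smff c)) covd_ff // scalerBr.
have split1 (A B D : 'I_n -> R) (v : 'I_n -> 'rV[R]_k) :
    \sum_d (A d + (B d + D d)) *: v d = \sum_d A d *: v d + (\sum_d B d *: v d + \sum_d D d *: v d).
  by rewrite -!big_split; apply: eq_bigr => d _; rewrite !scalerDl.
rewrite /comb.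
have -> : \sum_d dp a p q d x *: fe d x = \sum_d dd (X a x) (p d) x *: fe d x +
    (\sum_d (\sum_c p c x * Gam a c d x) *: fe d x - \sum_d (\sum_c q c x * C a c d x) *: fe d x).
  rewrite -sumrN.
  transitivity (\sum_d dd (X a x) (p d) x *: fe d x +
    (\sum_d (\sum_c p c x * Gam a c d x) *: fe d x + \sum_d (- (\sum_c q c x * C a c d x)) *: fe d x)).
    by rewrite -split1; apply: eq_bigr => d _; rewrite /cov_e sumrB.
  by congr (_ + (_ + _)); apply: eq_bigr => d _; rewrite scaleNr.
have -> : \sum_d dq a p q d x *: ff d x = \sum_d dd (X a x) (q d) x *: ff d x +
    (\sum_d (\sum_c q c x * Gam a c d x) *: ff d x + \sum_d (\sum_c p c x * C a c d x) *: ff d x).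
  by rewrite -split1; apply: eq_bigr => d _; rewrite /cov_f big_split.
set s1 := \sum_c _; set s2 := \sum_d _; set s3 := \sum_d _; set s4 := \sum_c _.
set s5 := \sum_d _; set s6 := \sum_d _.
by apply/rowP => i; rewrite !mxE; ring.
Qed.

Lemma comb_fe p q d x : O x -> ip (G (F x)) (comb p q x) (fe d x) = p d x.
Proof.
move=> Ox; rewrite ipDl !ip_suml (bigD1 d) //= ipZl fe_on // eqxx mulr1.
rewrite big1 ?addr0 => [|c cd]; last by rewrite ipZl fe_on // (negbTE cd) mulr0.
by rewrite big1 ?addr0 // => c _; rewrite ipZl ff_fe // mulr0.
Qed.

Lemma comb_ff p q d x : O x -> ip (G (F x)) (comb p q x) (ff d x) = q d x.
Proof.
move=> Ox; rewrite ipDl !ip_suml addrC (bigD1 d) //= ipZl ff_on // eqxx mulr1.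
rewrite big1 ?addr0 => [|c cd]; last by rewrite ipZl ff_on // (negbTE cd) mulr0.
by rewrite big1 ?addr0 // => c _; rewrite ipZl fe_ff // mulr0.
Qed.

Lemma sm_dX (f : E -> R) a : sm O f -> sm O (fun x => dd (X a x) f x).
Proof.
move=> sf; apply: (@sm_eq _ _ _ (fun x => \sum_l X a x 0 l * dd (basis_vec l) f x)) => //.
  by move=> x; rewrite inE => Ox; rewrite [RHS]derive_dir //; exact: sm_diff sf Ox.
by apply: sm_sum => // l _; apply: smM => //; [exact: sX|exact: sm_D].
Qed.

Lemma sm_dp a p q d : (forall c, sm O (p c)) -> (forall c, sm O (q c)) -> sm O (dp a p q d).
Proof.
move=> sp sq; apply: smD => //; first exact: sm_dX.
by apply: sm_sum => // s _; apply: smB => //; apply: smM => //; exact: sGam.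
Qed.

Lemma sm_dq a p q d : (forall c, sm O (p c)) -> (forall c, sm O (q c)) -> sm O (dq a p q d).
Proof.
move=> sp sq; apply: smD => //; first exact: sm_dX.
by apply: sm_sum => // s _; apply: smD => //; apply: smM => //; exact: sGam.
Qed.

Lemma bracket_X a b x : O x -> dd (X a x) (X b) x - dd (X b x) (X a) x =
  \sum_s (Gam a b s x - Gam b a s x) *: X s x.
Proof.
move=> Ox; transitivity (covd g id (X a x) (X b) x - covd g id (X b x) (X a) x).
  rewrite /covd !dd_id (christoffelC mg (X b x) (X a x) Ox).
  by rewrite opprD addrACA subrr addr0.
rewrite !covd_X // -sumrB; apply: eq_bigr => s _; by rewrite scalerBl.
Qed.

(** The derivative of [fe c] along [X b] has components [Gam b c] and [C b c], so a second
    derivative is [cov_e], [cov_f] of these families. The last sum is the bracket term. Tangential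
    and normal parts will be the Gauss and Codazzi equations. *)
Lemma curvature_frame a b c x : O x ->
  comb (dp a (Gam b c) (C b c)) (dq a (Gam b c) (C b c)) x
  - comb (dp b (Gam a c) (C a c)) (dq b (Gam a c) (C a c)) x
  - \sum_s (Gam a b s x - Gam b a s x) *: comb (Gam s c) (C s c) x =
  curvature G (F x) (fe a x) (fe b x) (fe c x).
Proof.
move=> Ox; rewrite -(covd_curvature mG oO sF FU Ox (sX a) (sX b) (sfe c)).
have e i : {in O, (fun y => covd G F (X i y) (fe c) y) =1 comb (Gam i c) (C i c)}.
  by move=> y; rewrite inE => Oy; rewrite covd_fe.
rewrite (covd_eq G F oO _ Ox (e a)) (covd_eq G F oO _ Ox (e b)).
rewrite !(fun a p q => covd_comb a (p:=p) (q:=q) Ox) //; try exact: sGam.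
congr (_ - _); rewrite (bracket_X a b Ox) (covd_dir_sum mG sF FU _ _ _ Ox (sfe c)).
apply: eq_bigr => s _; rewrite (covd_dirZ mG sF FU _ _ Ox (sfe c)); congr (_ *: _).
by rewrite covd_fe.
Qed.

Variable eps : R.
Hypothesis curvG : forall y u v w, U y -> curvature G y u v w =
  eps *: (ip (G y) v w *: u - ip (G y) u w *: v
          + ip (G y) (v *m J y) w *: (u *m J y) - ip (G y) (u *m J y) w *: (v *m J y)
          + (2 * ip (G y) u (v *m J y)) *: (w *m J y)).

(** On a Lagrangian tangent space every product of a tangent vector with the [J] of another
    vanishes, so all terms with [J] drop out. The result is tangent, hence the Codazzi equation is
    homogeneous. *)
Lemma curvature_fe a b c x : O x ->
  curvature G (F x) (fe a x) (fe b x) (fe c x) =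
  eps *: ((b == c)%:R *: fe a x - (a == c)%:R *: fe b x).
Proof.
move=> Ox; rewrite curvG; last exact: FU.
rewrite -!/(ff _ _) !fe_on // !ff_fe // fe_ff //.
by rewrite mulr0 !scale0r addr0 subr0 addr0.
Qed.

Lemma ipBB A (u v w z : 'rV[R]_k) : ip A (u - v - w) z = ip A u z - ip A v z - ip A w z.
Proof. by rewrite !ipDl !ipNl. Qed.

Lemma codazzi a b c d x : O x ->
  dq a (Gam b c) (C b c) d x - dq b (Gam a c) (C a c) d x
  - \sum_s (Gam a b s x - Gam b a s x) * C s c d x = 0.
Proof.
move=> Ox.
have := congr1 (fun v => ip (G (F x)) v (ff d x)) (curvature_frame a b c Ox).
rewrite /= curvature_fe // ipBB !comb_ff //.
have -> : ip (G (F x)) (eps *: ((b == c)%:R *: fe a x - (a == c)%:R *: fe b x)) (ff d x) = 0.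
  by rewrite ipZl ipDl ipNl !ipZl !fe_ff // !mulr0 subrr mulr0.
move=> h; apply: etrans h; congr (_ - _); rewrite ip_suml; apply: eq_bigr => s _.
by rewrite ipZl comb_ff.
Qed.

Lemma gauss a b c d x : O x ->
  dp a (Gam b c) (C b c) d x - dp b (Gam a c) (C a c) d x
  - \sum_s (Gam a b s x - Gam b a s x) * Gam s c d x =
  eps * ((b == c)%:R * (a == d)%:R - (a == c)%:R * (b == d)%:R).
Proof.
move=> Ox.
have := congr1 (fun v => ip (G (F x)) v (fe d x)) (curvature_frame a b c Ox).
rewrite /= curvature_fe // ipBB !comb_fe //.
have -> : ip (G (F x)) (eps *: ((b == c)%:R *: fe a x - (a == c)%:R *: fe b x)) (fe d x) =
    eps * ((b == c)%:R * (a == d)%:R - (a == c)%:R * (b == d)%:R).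
  by rewrite ipZl ipDl ipNl !ipZl !fe_on.
move=> h; apply: etrans h; congr (_ - _); rewrite ip_suml; apply: eq_bigr => s _.
by rewrite ipZl comb_fe.
Qed.

Lemma dd_dir_sum p q (W : E -> 'M[R]_(p, q)) I (r : seq I) (v : I -> E) x : O x -> smx O W ->
  dd (\sum_(i <- r) v i) W x = \sum_(i <- r) dd (v i) W x.
Proof.
move=> Ox sW; elim/big_rec2: _ => [|i a b _ <-]; last exact: (derivex_dirD _ _ Ox sW).
by have := derivex_dirZ 0 0 Ox sW; rewrite !scale0r.
Qed.

(** Derivatives of the coefficients of [Z] enter both the ambient and the intrinsic term and cancel.
    This links the frame to [tension], which is defined with constant fields. *)
Lemma second_form_tensor Y Z x : O x -> smx O Z -> second_form g G F Y Z x =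
  \sum_i \sum_j (Y x 0 i * Z x 0 j) *:
     second_form g G F (cst (basis_vec i)) (cst (basis_vec j)) x.
Proof.
move=> Ox sZ.
have sDF j := smx_D (basis_vec j) oO sF.
transitivity (\sum_j Z x 0 j *: second_form g G F Y (cst (basis_vec j)) x).
  rewrite second_formE.
  have e1 : {in O, (fun y => dd (Z y) F y) =1
      (fun y => \sum_j Z y 0 j *: dd (basis_vec j) F y)}.
    by move=> y; rewrite inE => Oy; rewrite (derivex_dir _ Oy sF).
  have e2 : {in O, Z =1 (fun y => \sum_j Z y 0 j *: cst (basis_vec j) y)}.
    by move=> y _; rewrite {1}(row_sum_delta (Z y)).
  rewrite (covd_eq G F oO _ Ox e1) (covd_eq g id oO _ Ox e2).
  have s1 j : smx O (fun y => Z y 0 j *: dd (basis_vec j) F y).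
    by apply: smxZ => //; exact: sZ.
  have s2 j : smx O (fun y => Z y 0 j *: cst (basis_vec j : E) y).
    exact: (smxZ oO (sZ 0 j) (smx_cst O (basis_vec j : E))).
  rewrite (covd_sum mG oO FU _ _ Ox (fun j _ => s1 j)).
  rewrite (covd_sum mg oO (fun _ h => h) _ _ Ox (fun j _ => s2 j)).
  rewrite (dd_dir_sum _ _ Ox sF) -sumrB; apply: eq_bigr => j _.
  rewrite (covdZ mG oO FU _ Ox (sZ 0 j) (sDF j)).
  rewrite (covdZ mg oO (fun _ h => h) _ Ox (sZ 0 j) (smx_cst O (basis_vec j : E))).
  rewrite (derivex_dirD _ _ Ox sF) !(fun a => derivex_dirZ a _ Ox sF) /=.
  rewrite second_formE scalerBr opprD addrACA subrr add0r.
  by [].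
rewrite exchange_big; apply: eq_bigr => j _ /=.
transitivity (Z x 0 j *: (\sum_i Y x 0 i *:
  second_form g G F (cst (basis_vec i)) (cst (basis_vec j)) x)); last first.
  by rewrite scaler_sumr; apply: eq_bigr => i _; rewrite scalerA mulrC.
congr (_ *: _); rewrite second_formE [in LHS](row_sum_delta (Y x)).
rewrite (covd_dir_sum mG sF FU _ _ _ Ox (sDF j)).
rewrite (covd_dir_sum mg (smx_id oO) (fun _ h => h) _ _ _ Ox (smx_cst O (basis_vec j : E))).
rewrite (dd_dir_sum _ _ Ox sF) -sumrB; apply: eq_bigr => i _.
rewrite second_formE (covd_dirZ mG sF FU _ _ Ox (sDF j)).
rewrite (covd_dirZ mg (smx_id oO) (fun _ h => h) _ _ Ox (smx_cst O (basis_vec j : E))).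
by rewrite (derivex_dirZ _ _ Ox sF) scalerBr.
Qed.

Local Notation trH := (trC C).

Lemma sm_trH c : sm O (trH c).
Proof. by apply: sm_sum => // a _; exact: sC. Qed.

Lemma sm_cst0 c : sm O (cst0 c : E -> R).
Proof. exact: sm_cst. Qed.

Lemma tensionE x : O x -> tension g G F x = comb cst0 trH x.
Proof.
move=> Ox.
transitivity (\sum_a sff a a x).
  transitivity (\sum_a \sum_i \sum_j (X a x 0 i * X a x 0 j) *:
     second_form g G F (cst (basis_vec i)) (cst (basis_vec j)) x); last first.
    by apply: eq_bigr => a _; rewrite [RHS](second_form_tensor _ Ox (sX a)).
  rewrite exchange_big; apply: eq_bigr => i _; rewrite exchange_big; apply: eq_bigr => j _ /=.
  rewrite -scaler_suml; congr (_ *: _); rewrite invg // mxE.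
  by apply: eq_bigr => a _; rewrite !mxE.
rewrite /comb [X in _ = X + _]big1 ?add0r => [|c _]; last by rewrite /cst0 scale0r.
transitivity (\sum_a \sum_c C a a c x *: ff c x).
  by apply: eq_bigr => a _; rewrite hC.
by rewrite exchange_big; apply: eq_bigr => c _; rewrite scaler_suml.
Qed.

Local Notation Pt a := (dp a cst0 trH).
Local Notation Qt a := (dq a cst0 trH).

(** For the normal field tau, R(tau, e_a)e_a is eps times tau + 3 <tau, J e_a> J e_a: the 3 is 1
    from the antisymmetric pair of [J] terms plus 2 from the last term. Summing over [a] gives (n +
    3) eps tau, which is where m + 4 comes from. *)
Lemma bitension_frame x : O x -> bitension g G F X x =
  \sum_a (comb (dp a (Pt a) (Qt a)) (dq a (Pt a) (Qt a)) x
    - \sum_s Gam a a s x *: comb (Pt s) (Qt s) x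
    + eps *: (comb cst0 trH x + (3 * trH a x) *: ff a x)).
Proof.
move=> Ox; rewrite /bitension; apply: eq_bigr => a _.
rewrite /levi_civita !cov_alongE.
have eT : {in O, tension g G F =1 comb cst0 trH}.
  by move=> y; rewrite inE => Oy; rewrite tensionE.
have eCT s : {in O, (fun y => covd G F (X s y) (tension g G F) y) =1 comb (Pt s) (Qt s)}.
  move=> y; rewrite inE => Oy; rewrite (covd_eq G F oO _ Oy eT).
  by rewrite (covd_comb s Oy sm_cst0 sm_trH).
have sP s c : sm O (Pt s c) by exact: (sm_dp _ _ sm_cst0 sm_trH).
have sQ s c : sm O (Qt s c) by exact: (sm_dq _ _ sm_cst0 sm_trH).
congr (_ - _ + _).
- by rewrite (covd_eq G F oO _ Ox (eCT a)) (covd_comb a Ox (sP a) (sQ a)).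
- rewrite (covd_X a a Ox) (covd_eq G F oO _ Ox eT).
  have sT := smx_comb sm_cst0 sm_trH.
  rewrite (covd_dir_sum mG sF FU _ _ _ Ox sT); apply: eq_bigr => s _.
  by rewrite (covd_dirZ mG sF FU _ _ Ox sT) (covd_comb s Ox sm_cst0 sm_trH).
have -> : push F (X a) x = fe a x by rewrite /fe ddE.
rewrite tensionE // curvG; last exact: FU.
have eJ : comb cst0 trH x *m J (F x) = comb (fun c y => - trH c y) cst0 x.
  rewrite /comb mulmxDl !mulmx_suml addrC; congr (_ + _); apply: eq_bigr => c _.
    by rewrite -scalemxAl ffJ // scalerN scaleNr.
  by rewrite /cst0 !scale0r mul0mx.
rewrite eJ -!/(ff _ _) fe_on // eqxx ff_fe // !comb_fe // comb_ff //.
rewrite /cst0 !scale0r scale1r subr0 addr0 scaleNr opprK -addrA -scalerDl.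
by congr (_ *: (_ + _ *: _)); ring.
Qed.

Lemma bitension_fe d x : O x -> bitension g G F X x = 0 ->
  \sum_a (dp a (Pt a) (Qt a) d x - \sum_s Gam a a s x * Pt s d x) = 0.
Proof.
move=> Ox; rewrite bitension_frame // => /(congr1 (fun v => ip (G (F x)) v (fe d x))).
rewrite /= ip0l ip_suml => h; apply: etrans h; apply: eq_bigr => a _.
rewrite ipDl ipDl ipNl ipZl ipDl ipZl ip_suml !comb_fe // ff_fe // mulr0 addr0 mulr0 addr0.
by congr (_ - _); apply: eq_bigr => s _; rewrite ipZl comb_fe.
Qed.

Lemma bitension_ff d x : O x -> bitension g G F X x = 0 ->
  \sum_a (dq a (Pt a) (Qt a) d x - \sum_s Gam a a s x * Qt s d x)
  + eps * ((n%:R + 3) * trH d x) = 0.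
Proof.
move=> Ox; rewrite bitension_frame // => /(congr1 (fun v => ip (G (F x)) v (ff d x))).
rewrite /= ip0l ip_suml => h; apply: etrans h.
have -> : eps * ((n%:R + 3) * trH d x) =
    \sum_a (eps * (trH d x + 3 * trH a x * (a == d)%:R)).
  rewrite -mulr_sumr big_split /= sumr_const card_ord; congr (_ * _).
  rewrite (bigD1 d) //= eqxx big1 ?addr0 => [|c /negbTE ->]; last by rewrite mulr0.
  by rewrite -[trH d x *+ n]mulr_natl mulrDl mulr1.
rewrite -big_split; apply: eq_bigr => a _ /=.
rewrite ipDl ipDl ipNl ipZl ipDl ipZl ip_suml !comb_ff // ff_on //.
by congr (_ - _ + _); apply: eq_bigr => s _; rewrite ipZl comb_ff.
Qed.

End Frame.

(** * The H-umbilical case *)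

Section ScalarRules.
Context {R : realType} {n : nat}.
Variables (O : set 'rV[R]_n) (oO : open O).
Implicit Types (f h : 'rV[R]_n -> R).

Lemma ddM f h v x : O x -> sm O f -> sm O h ->
  dd v (fun y => f y * h y) x = dd v f x * h x + f x * dd v h x.
Proof. by move=> Ox sf sh; rewrite derive_mul //; exact: sm_derivable Ox. Qed.

Lemma ddD f h v x : O x -> sm O f -> sm O h ->
  dd v (fun y => f y + h y) x = dd v f x + dd v h x.
Proof. by move=> Ox sf sh; rewrite derive_add //; exact: sm_derivable Ox. Qed.

Lemma dd_cst (k : R) (v x : 'rV[R]_n) : dd v (fun=> k) x = 0.
Proof. by rewrite ddE derive_cst. Qed.

Lemma ddZ (k : R) f v x : O x -> sm O f -> dd v (fun y => k * f y) x = k * dd v f x.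
Proof. by move=> Ox sf; rewrite (ddM v Ox (sm_cst O k) sf) dd_cst mul0r add0r. Qed.

Lemma ddB f h v x : O x -> sm O f -> sm O h ->
  dd v (fun y => f y - h y) x = dd v f x - dd v h x.
Proof.
move=> Ox sf sh; rewrite (ddD v Ox sf (smN oO sh)); congr (_ + _).
transitivity (dd v (fun y => -1 * h y) x); last by rewrite ddZ // mulN1r.
by apply: (derive_eq_on v oO Ox) => y _; rewrite mulN1r.
Qed.

Lemma dd_eq f h v x : O x -> {in O, f =1 h} -> dd v f x = dd v h x.
Proof. by move=> Ox fh; exact: (derive_eq_on v oO Ox fh). Qed.

(** Derives an equation from a known vanishing expression [l], leaving a polynomial identity to
    [ring]. *)
Lemma eq0_sub (a b l : R) : l = 0 -> a - b = l -> a = b.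
Proof. by move=> -> /eqP; rewrite subr_eq0 => /eqP. Qed.

End ScalarRules.

Section Umbilical.
Context {R : realType} {n : nat}.
Notation E := 'rV[R]_n.
Variables (O : set E) (oO : open O) (X : 'I_n -> E -> E).
Variables (Gam : 'I_n -> 'I_n -> 'I_n -> E -> R) (lam mu : E -> R) (z : 'I_n) (eps : R).
Hypotheses (sl : sm O lam) (sm_mu : sm O mu).
Hypothesis sX : forall a, smx O (X a).
Hypothesis sG : forall a b c, sm O (Gam a b c).
Hypothesis Ganti : forall a b c x, O x -> Gam a b c x = - Gam a c b x.

Local Notation dl a b := ((a == b)%:R : R).

(** [K1] symmetrizes the product of the metric with the coordinate along the distinguished vector,
    and [K2] is the cube of that coordinate. As [K1 z z z = 3], the coefficient of [K2] in [Cu] must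
    be [lam - 3 mu]. *)
Definition K1 (a b c : 'I_n) : R :=
  dl a z * dl b c + dl b z * dl a c + dl c z * dl a b.
Definition K2 (a b c : 'I_n) : R := dl a z * dl b z * dl c z.

(* The second fundamental form of an H-umbilical immersion as a totally
   symmetric trilinear form, the vector of index z being the distinguished one. *)
Definition Cu a b c x : R := mu x * K1 a b c + (lam x - 3 * mu x) * K2 a b c.

Lemma sm_lm : sm O (fun x => lam x - 3 * mu x).
Proof. by apply: smB => //; apply: smM => //; exact: sm_cst. Qed.

Lemma sm_Cu a b c : sm O (Cu a b c).
Proof.
by apply: smD => //; apply: smM => //; [exact: sm_cst|exact: sm_lm|exact: sm_cst].
Qed.

Lemma dd_Cu a b c v x : O x ->
  dd v (Cu a b c) x = dd v mu x * K1 a b c + (dd v lam x - 3 * dd v mu x) * K2 a b c.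
Proof.
move=> Ox.
have sK (k : R) : sm O (fun=> k) by exact: sm_cst.
rewrite (ddD v Ox (smM oO sm_mu (sK _)) (smM oO sm_lm (sK _))).
rewrite (ddM v Ox sm_mu (sK _)) (ddM v Ox sm_lm (sK _)) !dd_cst !mulr0 !addr0.
by rewrite (ddB oO v Ox sl (smM oO (sK 3) sm_mu)) (ddZ 3 v Ox sm_mu).
Qed.

Lemma Cu23 a b c x : Cu a b c x = Cu a c b x.
Proof.
rewrite /Cu; congr (_ * _ + _ * _); rewrite /K1 /K2; last by ring.
by rewrite (eq_sym b c); ring.
Qed.

Lemma Cu12 a b c x : Cu a b c x = Cu b a c x.
Proof.
rewrite /Cu; congr (_ * _ + _ * _); rewrite /K1 /K2; last by ring.
by rewrite (eq_sym a b); ring.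
Qed.

Lemma sum_dl (t : 'I_n -> R) d : \sum_s t s * dl s d = t d.
Proof.
rewrite (bigD1 d) //= eqxx mulr1 big1 ?addr0 // => s /negbTE ->.
by rewrite mulr0.
Qed.

Lemma sum_Cu (t : 'I_n -> R) a d x : \sum_s t s * Cu a s d x =
  mu x * (dl a z * t d + dl a d * t z + dl d z * t a)
  + (lam x - 3 * mu x) * (dl a z * dl d z * t z).
Proof.
transitivity (mu x * dl a z * (\sum_s t s * dl s d) + mu x * dl a d * (\sum_s t s * dl s z)
   + mu x * dl d z * (\sum_s t s * dl s a)
   + (lam x - 3 * mu x) * dl a z * dl d z * (\sum_s t s * dl s z)).
  rewrite !mulr_sumr -!big_split; apply: eq_bigr => s _ /=.
  by rewrite /Cu /K1 /K2 (eq_sym a s); ring.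
by rewrite !sum_dl; ring.
Qed.

Lemma cov_f_Cu a b c d x : O x ->
  cov_f X Gam Cu a (Gam b c) (Cu b c) d x =
  dd (X a x) mu x * K1 b c d + (dd (X a x) lam x - 3 * dd (X a x) mu x) * K2 b c d
  + (mu x * (dl b z * Gam a c d x + dl b c * Gam a z d x + dl c z * Gam a b d x)
     + (lam x - 3 * mu x) * (dl b z * dl c z * Gam a z d x))
  + (mu x * (dl a z * Gam b c d x + dl a d * Gam b c z x + dl d z * Gam b c a x)
     + (lam x - 3 * mu x) * (dl a z * dl d z * Gam b c z x)).
Proof.
move=> Ox; rewrite /cov_f dd_Cu // big_split /= addrA; congr (_ + _ + _).
  rewrite -(sum_Cu (fun s => Gam a s d x)); apply: eq_bigr => s _.
  by rewrite Cu23 mulrC.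
exact: (sum_Cu (fun s => Gam b c s x)).
Qed.

Hypothesis Hcod : forall a b c d x, O x ->
  cov_f X Gam Cu a (Gam b c) (Cu b c) d x - cov_f X Gam Cu b (Gam a c) (Cu a c) d x
  - \sum_s (Gam a b s x - Gam b a s x) * Cu s c d x = 0.

Lemma codazzi_Cu a b c d x : O x ->
  (cov_f X Gam Cu a (Gam b c) (Cu b c) d x - cov_f X Gam Cu b (Gam a c) (Cu a c) d x)
  - (mu x * (dl c z * (Gam a b d x - Gam b a d x) + dl c d * (Gam a b z x - Gam b a z x)
       + dl d z * (Gam a b c x - Gam b a c x))
  + (lam x - 3 * mu x) * (dl c z * dl d z * (Gam a b z x - Gam b a z x))) = 0.
Proof.
move=> Ox; rewrite -(sum_Cu (fun s => Gam a b s x - Gam b a s x)).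
rewrite -[RHS](Hcod a b c d Ox); congr (_ - _); apply: eq_bigr => s _.
by rewrite Cu12.
Qed.

Lemma Gam_diag a b x : O x -> Gam a b b x = 0.
Proof. by move=> Ox; have := Ganti a b b Ox; lra. Qed.

Lemma codazzi_lam k x : O x -> k != z ->
  dd (X k x) lam x = (lam x - 2 * mu x) * Gam z z k x.
Proof.
move=> Ox kz; have := codazzi_Cu k z z z Ox; rewrite !cov_f_Cu // /K1 /K2.
rewrite eqxx (negbTE kz) /= !(Gam_diag _ _ Ox) (Ganti z k z Ox) => h.
by apply: (eq0_sub h); ring.
Qed.

Lemma codazzi_Gam k j x : O x -> k != z -> j != z ->
  (lam x - 2 * mu x) * Gam k z j x = dl k j * dd (X z x) mu x.
Proof.
move=> Ox kz jz; have := codazzi_Cu k z z j Ox; rewrite !cov_f_Cu // /K1 /K2.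
have zj : (z == j) = false by rewrite eq_sym (negbTE jz).
rewrite !eqxx (negbTE kz) (negbTE jz) ?zj /= !(Gam_diag _ _ Ox) => h.
by apply: (eq0_sub h); ring.
Qed.

(** Kept for all [j] on purpose: the left-hand side does not involve [j], so comparing j = l with a
    third index forces [mu * Gam z z l = 0]. *)
Lemma codazzi_mu l j x : O x -> l != z -> j != z ->
  dd (X l x) mu x = mu x * Gam z z l x * (1 + 2 * dl j l).
Proof.
move=> Ox lz jz; have := codazzi_Cu l z j j Ox; rewrite !cov_f_Cu // /K1 /K2.
have zj : (z == j) = false by rewrite eq_sym (negbTE jz).
rewrite !eqxx (negbTE lz) (negbTE jz) ?zj /= [l == j]eq_sym !(Gam_diag _ _ Ox).
rewrite (Ganti z l z Ox) (Ganti z j z Ox).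
have [->|jl] := eqVneq j l => h; apply: (eq0_sub h); rewrite /=; ring.
Qed.

Hypothesis Hgauss : forall a b c d x, O x ->
  cov_e X Gam Cu a (Gam b c) (Cu b c) d x - cov_e X Gam Cu b (Gam a c) (Cu a c) d x
  - \sum_s (Gam a b s x - Gam b a s x) * Gam s c d x =
  eps * (dl b c * dl a d - dl a c * dl b d).

(** The Gauss equation for the plane of [X k] and [X z], the source of the Riccati equation for
    kap. *)
Lemma gauss_Cu k x : O x -> k != z ->
  dd (X k x) (Gam z z k) x + \sum_s Gam z z s x * Gam k s k x - lam x * mu x
  - dd (X z x) (Gam k z k) x - \sum_s Gam k z s x * Gam z s k x + mu x * mu x
  - \sum_s (Gam k z s x - Gam z k s x) * Gam s z k x = eps.
Proof.
move=> Ox kz; have := Hgauss k z z k Ox; rewrite /cov_e !sumrB !sum_Cu /Cu /K1 /K2.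
have zk : (z == k) = false by rewrite eq_sym (negbTE kz).
rewrite !eqxx (negbTE kz) ?zk /= => h.
(* The right-hand side is expanded to [eps * (1 * 1 - 0 * 0)], the shape it has in [h]. *)
rewrite -[RHS]mulr1 -[X in _ = eps * X]subr0 -[X in _ = eps * (X - _)]mulr1.
rewrite -[X in _ = eps * (_ - X)](mul0r 0).
by rewrite -h; ring.
Qed.

Definition al x : R := lam x + (n%:R - 1) * mu x.

Lemma sm_al : sm O al.
Proof. by apply: smD => //; apply: smM => //; exact: sm_cst. Qed.

Lemma trC_Cu c x : trC Cu c x = al x * dl c z.
Proof.
rewrite /trC.
transitivity (\sum_a (2 * mu x * dl c z * dl a c + mu x * dl c z
    + (lam x - 3 * mu x) * dl c z * dl a z)).
  apply: eq_bigr => a _; rewrite /Cu /K1 /K2 eqxx /=.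
  have [->|ac] := eqVneq a c; last first.
    by case: (a == z); rewrite /=; ring.
  by case: (c == z); rewrite /=; ring.
rewrite !big_split -!mulr_sumr /= sumr_const card_ord -[_ *+ n]mulr_natl.
have sd (d : 'I_n) : \sum_a dl a d = 1.
  by rewrite -[RHS](sum_dl (fun=> 1) d); apply: eq_bigr => a _; rewrite mul1r.
by rewrite !sd /al; ring.
Qed.

Lemma Cu_z a d x : Cu a z d x = mu x * dl a d + (lam x - mu x) * (dl a z * dl d z).
Proof.
rewrite /Cu /K1 /K2 eqxx /= [z == d]eq_sym.
by case: (a == z); case: (d == z); rewrite /=; ring.
Qed.

Local Notation Pt a := (cov_e X Gam Cu a cst0 (trC Cu)).
Local Notation Qt a := (cov_f X Gam Cu a cst0 (trC Cu)).

(** The tension field is [al] times J X_z, and its derivative splits into minus a shape operator,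
    found here, and a normal part, found in [QtE]. *)
Lemma PtE a d x : O x -> Pt a d x = - (al x * Cu a z d x).
Proof.
move=> Ox; rewrite /cov_e dd_cst add0r.
transitivity (- \sum_s (al x * Cu a s d x) * dl s z).
  rewrite -sumrN; apply: eq_bigr => s _; rewrite trC_Cu /cst0; ring.
by rewrite sum_dl.
Qed.

Lemma QtE a d x : O x -> Qt a d x = dl d z * dd (X a x) al x + al x * Gam a z d x.
Proof.
move=> Ox; rewrite /cov_f; congr (_ + _).
  transitivity (dd (X a x) (fun y => dl d z * al y) x).
    by apply: (dd_eq oO _ Ox) => y _; rewrite trC_Cu mulrC.
  by rewrite (ddZ _ _ Ox sm_al).
transitivity (\sum_s (al x * Gam a s d x) * dl s z); last by rewrite sum_dl.
by apply: eq_bigr => s _; rewrite trC_Cu /cst0; ring.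
Qed.

Lemma dd_Pt a d x : O x -> dd (X a x) (Pt a d) x =
  - (dd (X a x) al x * Cu a z d x + al x * (dd (X a x) mu x * dl a d
     + (dd (X a x) lam x - dd (X a x) mu x) * (dl a z * dl d z))).
Proof.
move=> Ox; set v := X a x.
transitivity (dd v (fun y => -1 * (al y * Cu a z d y)) x).
  by apply: (dd_eq oO _ Ox) => y; rewrite inE => Oy; rewrite PtE // mulN1r.
rewrite (ddZ _ _ Ox (smM oO sm_al (sm_Cu _ _ _))) (ddM _ Ox sm_al (sm_Cu _ _ _)) mulN1r.
congr (- (_ + _ * _)); rewrite dd_Cu // /K1 /K2 eqxx /= [z == d]eq_sym.
by case: (a == z); case: (d == z); rewrite /=; ring.
Qed.

Hypothesis Hbit_e : forall d x, O x ->
  \sum_a (cov_e X Gam Cu a (Pt a) (Qt a) d x - \sum_s Gam a a s x * Pt s d x) = 0.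
Hypothesis Hbit_f : forall d x, O x ->
  \sum_a (cov_f X Gam Cu a (Pt a) (Qt a) d x - \sum_s Gam a a s x * Qt s d x)
  + eps * ((n%:R + 3) * trC Cu d x) = 0.

Lemma sum_Cu_z (t : 'I_n -> R) d x : \sum_s t s * Cu s z d x =
  mu x * t d + (lam x - mu x) * dl d z * t z.
Proof.
transitivity (mu x * (\sum_s t s * dl s d) + (lam x - mu x) * dl d z * (\sum_s t s * dl s z)).
  rewrite !mulr_sumr -big_split; apply: eq_bigr => s _ /=.
  by rewrite Cu_z; ring.
by rewrite !sum_dl.
Qed.

(** The derivative of [al] counts twice: once by differentiating the tangential part of the first
    derivative, once by turning its normal part back through the second fundamental form. *)
Lemma bitension_e d x : O x ->
  2 * (mu x * dd (X d x) al x + (lam x - mu x) * dl d z * dd (X z x) al x)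
  + al x * (dd (X d x) mu x + (dd (X z x) lam x - dd (X z x) mu x) * dl d z)
  + al x * lam x * Gam z z d x + al x * lam x * dl d z * (\sum_a Gam a z a x) = 0.
Proof.
move=> Ox; apply/eqP; rewrite -oppr_eq0; apply/eqP; rewrite -[RHS](Hbit_e d Ox).
transitivity (\sum_a (-2 * mu x * (dd (X a x) al x * dl a d)
  - (2 * (lam x - mu x) * dl d z) * (dd (X a x) al x * dl a z)
  - al x * (dd (X a x) mu x * dl a d) - al x * dl d z * ((dd (X a x) lam x - dd (X a x) mu x) * dl a z)
  - al x * lam x * (Gam a z d x * dl a z) - al x * lam x * dl d z * Gam a z a x)).
  rewrite !sumrB -!mulr_sumr !(fun t => sum_dl t).
  by ring.
apply: eq_bigr => a _; rewrite {1}/cov_e dd_Pt //.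
have -> : \sum_s (Pt a s x * Gam a s d x - Qt a s x * Cu a s d x) =
   - al x * (\sum_s Gam a s d x * Cu s z a x) - dd (X a x) al x * (\sum_s Cu a s d x * dl s z)
   - al x * (\sum_s Gam a z s x * Cu a s d x).
  rewrite !mulr_sumr -!sumrB; apply: eq_bigr => s _.
  by rewrite PtE // QtE // [Cu s z a x]Cu12 [Cu z s a x]Cu23 [Cu z a s x]Cu12; ring.
have -> : \sum_s Gam a a s x * Pt s d x = - al x * \sum_s Gam a a s x * Cu s z d x.
  by rewrite mulr_sumr; apply: eq_bigr => s _; rewrite PtE //; ring.
rewrite sum_dl !sum_Cu_z sum_Cu Cu_z (Gam_diag _ _ Ox) (Ganti a a z Ox).
by ring.
Qed.

(** The factors of [al] are the squared norm of the covariant derivative of [X z] and the squared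
    norm of the shape operator in the direction J X_z; the derivative terms make up the Laplacian of
    [al]. *)
Lemma bitension_f x : O x ->
  \sum_a dd (X a x) (fun y => dd (X a y) al y) x
  - al x * \sum_a \sum_s Gam a z s x ^+ 2
  - al x * (lam x ^+ 2 + (n%:R - 1) * mu x ^+ 2)
  - \sum_a \sum_s Gam a a s x * dd (X s x) al x + (n%:R + 3) * eps * al x = 0.
Proof.
move=> Ox; rewrite -[RHS](Hbit_f z Ox) trC_Cu eqxx /= mulr1.
have -> : eps * ((n%:R + 3) * al x) = (n%:R + 3) * eps * al x by ring.
congr (_ + _).
transitivity (\sum_a (dd (X a x) (fun y => dd (X a y) al y) x
   - al x * (\sum_s Gam a z s x ^+ 2) - al x * (mu x ^+ 2 + (lam x ^+ 2 - mu x ^+ 2) * dl a z)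
   - \sum_s Gam a a s x * dd (X s x) al x)).
  rewrite !sumrB -!mulr_sumr; congr (_ - _ - _ * _ - _).
  rewrite big_split /= sumr_const card_ord -[_ *+ n]mulr_natl.
  rewrite (sum_dl (fun=> lam x ^+ 2 - mu x ^+ 2)).
  by ring.
apply: eq_bigr => a _; rewrite {1}/cov_f.
have -> : dd (X a x) (Qt a z) x = dd (X a x) (fun y => dd (X a y) al y) x.
  apply: (dd_eq oO _ Ox) => y; rewrite inE => Oy.
  by rewrite QtE // eqxx /= mul1r (Gam_diag _ _ Oy) mulr0 addr0.
have -> : \sum_s (Qt a s x * Gam a s z x + Pt a s x * Cu a s z x) =
   dd (X a x) al x * (\sum_s Gam a s z x * dl s z) - al x * (\sum_s Gam a z s x ^+ 2)
   - al x * (\sum_s Cu a z s x * Cu a s z x).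
  rewrite !mulr_sumr -!sumrB; apply: eq_bigr => s _.
  by rewrite PtE // QtE // (Ganti a s z Ox); ring.
have -> : \sum_s Gam a a s x * Qt s z x = \sum_s Gam a a s x * dd (X s x) al x.
  apply: eq_bigr => s _; rewrite QtE // eqxx /= mul1r.
  by rewrite (Gam_diag _ _ Ox) mulr0 addr0.
rewrite sum_dl (sum_Cu (fun s => Cu a z s x)) (Gam_diag _ _ Ox) !Cu_z !eqxx /=.
by case: (a == z); rewrite /=; ring.
Qed.

End Umbilical.

(** * The system along the distinguished direction *)

Lemma near_ne0 (R : realType) (V : normedModType R) (f : V -> R) x :
  {for x, continuous f} -> f x != 0 -> \forall y \near x, f y != 0.
Proof.
move=> /cvgrPdist_lt cf fx; near=> y; apply: contraT; rewrite negbK => /eqP fy.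
suff : `|f x - f y| < `|f x| by rewrite fy subr0 ltxx.
by near: y; apply: cf; rewrite normr_gt0.
Unshelve. all: by end_near. Qed.

(** * Polynomials in a smooth function *)

Section PolynomialRelation.
Context {R : realType} {n : nat}.
Notation E := 'rV[R]_n.
Implicit Types (O : set E) (f : E -> R) (p : {poly R}).

Lemma sm_horner O f p : open O -> sm O f -> sm O (fun y => p.[f y]).
Proof.
move=> oO sf; elim/poly_ind: p => [|p c IHp].
  by apply: (@sm_eq _ _ _ (fun=> 0)) => // [y _|]; [rewrite horner0|exact: sm_cst].
apply: (@sm_eq _ _ _ (fun y => p.[f y] * f y + c)) => // [y _|].
  by rewrite hornerMXaddC.
by apply: smD => //; [exact: smM|exact: sm_cst].
Qed.

Lemma dd_horner O f p v x : open O -> sm O f -> O x ->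
  dd v (fun y => p.[f y]) x = p^`().[f x] * dd v f x.
Proof.
move=> oO sf Ox; elim/poly_ind: p => [|p c IHp].
  rewrite deriv0 horner0 mul0r; transitivity (dd v (fun=> 0 : R) x); last exact: dd_cst.
  by apply: (dd_eq oO v Ox) => y _; rewrite horner0.
transitivity (dd v (fun y => p.[f y] * f y + c) x).
  by apply: (dd_eq oO v Ox) => y _; rewrite hornerMXaddC.
have sp := sm_horner p oO sf.
rewrite (ddD v Ox (smM oO sp sf) (sm_cst O c)) dd_cst addr0 (ddM v Ox sp sf) IHp.
rewrite derivMXaddC hornerD hornerM hornerX.
by ring.
Qed.

Lemma open_ne0 O f : open O -> sm O f -> open (O `&` [set x | f x != 0]).
Proof.
move=> oO sf; rewrite openE => x [Ox fx]; apply: filterI; first exact: near_open.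
have cf := sm_continuous sf Ox.
exact: near_ne0 cf fx.
Qed.

(* Where the derivative is nonzero, [p^`()] annihilates the function too. *)
Lemma poly_root_const O f (X : E -> E) p x : open O -> sm O f -> smx O X ->
  (forall y, O y -> p.[f y] = 0) -> p != 0 -> O x -> dd (X x) f x = 0.
Proof.
move=> oO sf sX; have [k] := ubnP (size p).
elim: k p O oO sf sX x => // k IHk p O oO sf sX x sp pf p0 Ox.
apply/eqP; apply: contraT => fx.
have sdf : sm O (fun y => dd (X y) f y).
  apply: (@sm_eq _ _ _ (fun y => \sum_l X y 0 l * dd (basis_vec l) f y)) => //.
    by move=> y; rewrite inE => Oy; rewrite [RHS]derive_dir //; exact: sm_diff sf Oy.
  by apply: sm_sum => // l _; exact: (smM oO (sX 0 l) (sm_D _ sf)).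
pose O' := O `&` [set y | dd (X y) f y != 0].
have oO' : open O' by exact: open_ne0.
have O'O : O' `<=` O by move=> y [].
(* In characteristic 0 a zero derivative leaves a nonzero constant, which has no root. *)
have [p'0|p'0] := eqVneq p^`() 0.
  have /size_poly1P[c c0 pc] : size p == 1%N.
    rewrite eqn_leq size_poly_gt0 p0 andbT.
    apply/leq_sizeP => -[|i] // _; apply/eqP.
    have /eqP := congr1 (fun q : {poly R} => q`_i) p'0.
    by rewrite coef_deriv coef0 mulrn_eq0.
  by have := pf x Ox; rewrite pc hornerC => /eqP; rewrite (negbTE c0).
suff h : dd (X x) f x = 0 by rewrite h eqxx in fx.
apply: (IHk p^`() O' oO' (sm_sub O'O sf) (fun i j => sm_sub O'O (sX i j)) x _ _ p'0
  (conj Ox fx)) => [|y [Oy fy]].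
  exact: leq_trans (lt_size_deriv p0) sp.
have : p^`().[f y] * dd (X y) f y = 0.
  rewrite -(dd_horner _ _ oO sf Oy) -(dd_cst 0 (X y) y).
  by apply: (dd_eq oO _ Oy) => w; rewrite inE => Ow; rewrite pf.
by move/eqP; rewrite mulf_eq0 (negbTE fy) orbF => /eqP.
Qed.

End PolynomialRelation.

(** * The elimination polynomials and their determinant *)

Section Determinant.
Context {R : realType}.
Implicit Types (psi s q A B C : {poly R}) (T : {poly R} * {poly R} * {poly R}).

(* The linear relation K A(phi) + c2 B(phi) + eps C(phi) = 0 is encoded by (A, B, C);
   [lie] is its derivative when phi' = psi(phi), K' = 2 (- K - eps + q(phi) c2) and
   c2' = - 2 s(phi) c2, up to a common factor. *)
Definition lie psi s q T : {poly R} * {poly R} * {poly R} :=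
  let: (A, B, C) := T in
  (psi * A^`() - 2%:P * A, psi * B^`() - 2%:P * s * B + 2%:P * q * A,
   psi * C^`() - 2%:P * A).

Lemma lie_horner psi s q A B C x :
  [/\ (lie psi s q (A, B, C)).1.1.[x] = psi.[x] * A^`().[x] - 2 * A.[x],
      (lie psi s q (A, B, C)).1.2.[x] =
        psi.[x] * B^`().[x] - 2 * s.[x] * B.[x] + 2 * q.[x] * A.[x] &
      (lie psi s q (A, B, C)).2.[x] = psi.[x] * C^`().[x] - 2 * A.[x]].
Proof. by rewrite /= !(hornerD, hornerN, hornerM, hornerC). Qed.

Definition det3 T0 T1 T2 : {poly R} :=
  let: (A0, B0, C0) := T0 in let: (A1, B1, C1) := T1 in let: (A2, B2, C2) := T2 in
  A0 * (B1 * C2 - B2 * C1) - B0 * (A1 * C2 - A2 * C1) + C0 * (A1 * B2 - A2 * B1).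

(** At a root of [psi] the derivative terms of [lie] vanish, so [lie] acts on values alone and no
    derivative of a coefficient has to be computed. *)
Lemma det3_root psi s q A B C x : psi.[x] = 0 ->
  (det3 (A, B, C) (lie psi s q (A, B, C)) (lie psi s q (lie psi s q (A, B, C)))).[x] =
  - 8 * A.[x] * (A.[x] - C.[x]) * s.[x] * ((1 - s.[x]) * B.[x] + q.[x] * A.[x]).
Proof.
move=> psi0; rewrite /det3 /lie.
set A' := A^`(); set B' := B^`(); set C' := C^`().
set A1 := psi * A' - _; set B1 := _ + 2%:P * q * A; set C1 := psi * C' - _.
have eA1 : A1.[x] = - 2 * A.[x] by rewrite hornerD hornerN !hornerM hornerC psi0; ring.
have eB1 : B1.[x] = - 2 * s.[x] * B.[x] + 2 * q.[x] * A.[x].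
  by rewrite !hornerD hornerN !hornerM hornerC psi0; ring.
have eC1 : C1.[x] = - 2 * A.[x] by rewrite hornerD hornerN !hornerM hornerC psi0; ring.
move: A1 B1 C1 eA1 eB1 eC1 => A1 B1 C1 eA1 eB1 eC1.
set A2 := psi * A1^`() - _; set B2 := _ + 2%:P * q * A1; set C2 := psi * C1^`() - _.
have eA2 : A2.[x] = - 2 * A1.[x] by rewrite hornerD hornerN !hornerM hornerC psi0; ring.
have eB2 : B2.[x] = - 2 * s.[x] * B1.[x] + 2 * q.[x] * A1.[x].
  by rewrite !hornerD hornerN !hornerM hornerC psi0; ring.
have eC2 : C2.[x] = - 2 * A1.[x] by rewrite hornerD hornerN !hornerM hornerC psi0; ring.
move: A2 B2 C2 eA2 eB2 eC2 => A2 B2 C2 eA2 eB2 eC2.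
rewrite !(hornerD, hornerN, hornerM) eA2 eB2 eC2 eA1 eB1 eC1.
by ring.
Qed.

Variable m : R.

(** With mu = 3 phi c, al = 2 m (phi - 1) c and lam = - m (phi + 2) c, these polynomials are given
    by phi' = kap psi, c' = - kap pS c and mu^2 - lam mu = pq c^2. Dividing the equation for al'' by
    al leaves [pA], [pB], [pC] as the coefficients of kap^2, c^2 and eps. *)
Definition psi : {poly R} := (3^-1)%:P * ('X - 1) * ('X + 2%:P) * (3%:P * 'X + m%:P).
Definition pS : {poly R} := 'X * 'X + (1 + m / 3)%:P * 'X + (2 * m / 3)%:P.
Definition pq : {poly R} := 3%:P * 'X * ((m + 3)%:P * 'X + (2 * m)%:P).
Definition pA : {poly R} := ('X - 1) * ('X * 'X + (m / 3 + 3)%:P * 'X + (5 * m / 3)%:P).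
Definition pB : {poly R} := 3%:P * 'X * 'X * ((m + 3)%:P * 'X + (2 * m)%:P)
   - m%:P * (m%:P * ('X + 2%:P) * ('X + 2%:P) + 9%:P * 'X * 'X).
Definition pC : {poly R} := - 'X + (m + 4)%:P.

Definition detP : {poly R} :=
  let T := (pA, pB, pC) in
  det3 T (lie psi pS pq T) (lie psi pS pq (lie psi pS pq T)).

Lemma psiE x : psi.[x] = 3^-1 * (x - 1) * (x + 2) * (3 * x + m).
Proof. by rewrite /psi !(hornerD, hornerN, hornerM, hornerC, hornerX). Qed.
Lemma pSE x : pS.[x] = x * x + (1 + m / 3) * x + 2 * m / 3.
Proof. by rewrite /pS !(hornerD, hornerN, hornerM, hornerC, hornerX). Qed.
Lemma pqE x : pq.[x] = 3 * x * ((m + 3) * x + 2 * m).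
Proof. by rewrite /pq !(hornerD, hornerN, hornerM, hornerC, hornerX). Qed.
Lemma pAE x : pA.[x] = (x - 1) * (x * x + (m / 3 + 3) * x + 5 * m / 3).
Proof. by rewrite /pA !(hornerD, hornerN, hornerM, hornerC, hornerX). Qed.
Lemma pBE x : pB.[x] = 3 * x * x * ((m + 3) * x + 2 * m)
  - m * (m * (x + 2) * (x + 2) + 9 * x * x).
Proof. by rewrite /pB !(hornerD, hornerN, hornerM, hornerC, hornerX). Qed.
Lemma pCE x : pC.[x] = - x + (m + 4).
Proof. by rewrite /pC !(hornerD, hornerN, hornerM, hornerC, hornerX). Qed.

Lemma detP1 : detP.[- (m / 3)] =
  8 * (2 * m * (m + 3) / 9) * (2 * m * (m + 3) / 9 + (m + 4 + m / 3)) * (m / 3) *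
    (4 / 9 * m * m * (m - 3) * (m - 3)).
Proof.
rewrite /detP det3_root; last by rewrite psiE; field.
by rewrite pAE pBE pCE pSE pqE; field.
Qed.

Lemma detP2 : detP.[- 2] = 13824 * m * (2 - m) * (4 - m).
Proof.
rewrite /detP det3_root; last by rewrite psiE; field.
by rewrite pAE pBE pCE pSE pqE; field.
Qed.

(** At [- (m / 3)] every factor is positive except a square that vanishes only for m = 3; the value
    at [- 2] settles that case. *)
Lemma detP_neq0 : 1 <= m -> detP != 0.
Proof.
move=> m1; have m0 : 0 < m by lra.
have [m3|m3] := eqVneq m 3.
    by apply/eqP => P0; have := detP2; rewrite P0 horner0 m3; lra.
have m30 : 0 < (m - 3) * (m - 3) by rewrite -expr2 exprn_even_gt0 //= subr_eq0.
have a0 : 0 < m * (m + 3) by rewrite mulr_gt0 //; lra.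
have b0 : 0 < m * m * ((m - 3) * (m - 3)) by rewrite mulr_gt0 // mulr_gt0.
suff : 0 < detP.[- (m / 3)] by move=> h; apply/eqP => P0; move: h; rewrite P0 horner0 ltxx.
rewrite detP1 (_ : 4 / 9 * m * m * (m - 3) * (m - 3) =
  4 / 9 * (m * m * ((m - 3) * (m - 3)))); last by ring.
have c0 : 0 < 2 * m * (m + 3) / 9 by lra.
have d0 : 0 < m + 4 + m / 3 by lra.
by apply: mulr_gt0; [apply: mulr_gt0; [apply: mulr_gt0|]|]; [lra|lra|lra|lra].
Qed.

End Determinant.

(** * Contradiction along the distinguished direction *)

Section FlowContradiction.
Context {R : realType} {n : nat}.
Notation E := 'rV[R]_n.
Variables (O : set E) (X : E -> E) (lam mu kap : E -> R) (m eps : R).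
Hypotheses (oO : open O) (sX : smx O X) (sl : sm O lam) (su : sm O mu) (sk : sm O kap).
Hypotheses (m12 : m = 1 \/ 2 <= m) (eps0 : eps <= 0).

Local Notation D f x := (dd (X x) f x).
Local Notation al := (fun y => lam y + m * mu y).

Hypothesis hmu : forall x, O x -> D mu x = (lam x - 2 * mu x) * kap x.
Hypothesis hbit : forall x, O x ->
  2 * lam x * D al x + al x * D lam x + m * al x * lam x * kap x = 0.
Hypothesis hkap : forall x, O x ->
  D kap x = - kap x * kap x - eps - lam x * mu x + mu x * mu x.
Hypothesis hlap : forall x, O x -> D (fun y => D al y) x + m * kap x * D al x =
  al x * (m * kap x * kap x + lam x * lam x + m * mu x * mu x - (m + 4) * eps).
Hypotheses (al0 : forall x, O x -> al x != 0) (dal0 : forall x, O x -> D al x != 0).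
Hypothesis kap0 : forall x, O x -> kap x != 0.

Let m0 : 0 < m.
Proof. by case: m12 => [->|]; lra. Qed.

Let mn0 : m != 0.
Proof. by rewrite gt_eqF. Qed.

Let sal : sm O al.
Proof. by apply: smD => //; apply: smM => //; exact: sm_cst. Qed.

Let sD f : sm O f -> sm O (fun x => D f x).
Proof.
move=> sf; apply: (@sm_eq _ _ _ (fun y => \sum_l X y 0 l * dd (basis_vec l) f y)) => //.
  by move=> y; rewrite inE => Oy; rewrite [RHS]derive_dir //; exact: sm_diff sf Oy.
by apply: sm_sum => // l _; exact: (smM oO (sX 0 l) (sm_D _ sf)).
Qed.

(* Up to the scale [cc], everything is a polynomial in phi = al' / (al kap):
   mu = 3 phi cc, al = 2 m (phi - 1) cc, lam = - m (phi + 2) cc. *)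
Definition phi x : R := D al x / (al x * kap x).
Definition cc x : R := mu x / (3 * phi x).

Lemma phi_eq x : O x -> D al x = phi x * al x * kap x.
Proof.
by move=> Ox; rewrite /phi; have := al0 Ox; have := kap0 Ox => ? ?; field; apply/andP.
Qed.

Lemma phi_neq0 x : O x -> phi x != 0.
Proof. by move=> Ox; apply: contraNneq (dal0 Ox) => p0; rewrite phi_eq // p0 !mul0r. Qed.

Lemma dal_lam x : O x -> D al x = D lam x + m * D mu x.
Proof. by move=> Ox; rewrite (ddD _ Ox sl (smM oO (sm_cst O m) su)) (ddZ _ _ Ox su). Qed.

Lemma phi_mu x : O x -> (3 * al x - 2 * m * mu x) * phi x = - 2 * m * mu x.
Proof.
move=> Ox; apply: (mulfI (mulf_neq0 (al0 Ox) (kap0 Ox))).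
have h := hbit Ox; have e := dal_lam Ox; rewrite hmu // in e.
have dl : D lam x = D al x - m * ((lam x - 2 * mu x) * kap x) by rewrite e; ring.
rewrite dl phi_eq // in h.
by apply: (eq0_sub h); ring.
Qed.

Lemma mu_cc x : O x -> mu x = 3 * (phi x * cc x).
Proof. by move=> Ox; rewrite /cc; have := phi_neq0 Ox => ?; field. Qed.

Lemma al_cc x : O x -> al x = 2 * m * ((phi x - 1) * cc x).
Proof.
move=> Ox; apply: (mulfI (phi_neq0 Ox)); have h := phi_mu Ox; have u := mu_cc Ox.
have h3 : 3 * (phi x * al x) = 2 * m * mu x * (phi x - 1).
  by apply: (eq0_sub (l := (3 * al x - 2 * m * mu x) * phi x - (- 2 * m * mu x)));
    [rewrite h subrr|ring].
have : 3 * (phi x * al x) = 3 * (phi x * (2 * m * ((phi x - 1) * cc x))).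
  by rewrite h3 u; ring.
by lra.
Qed.

Lemma lam_cc x : O x -> lam x = - m * (phi x + 2) * cc x.
Proof.
move=> Ox; have a := al_cc Ox; have u := mu_cc Ox.
have -> : lam x = al x - m * mu x by rewrite addrK.
by rewrite a u; ring.
Qed.

Lemma cc_neq0 x : O x -> cc x != 0.
Proof.
by move=> Ox; apply: contraNneq (al0 Ox) => c0; rewrite al_cc // c0 !mulr0.
Qed.

Lemma phi_neq1 x : O x -> phi x != 1.
Proof.
by move=> Ox; apply: contraNneq (al0 Ox) => c0; rewrite al_cc // c0 subrr mul0r mulr0.
Qed.

Lemma sphi : sm O phi.
Proof.
apply: smM => //; first exact: sD.
apply: smV => //; last exact: smM.
by move=> x Ox; rewrite mulf_neq0 ?al0 ?kap0.
Qed.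

Lemma scc : sm O cc.
Proof.
apply: smM => //; apply: smV => //; last by apply: smM => //; [exact: sm_cst|exact: sphi].
by move=> x Ox; rewrite mulf_neq0 ?phi_neq0 // pnatr_eq0.
Qed.

Lemma dmu_cc x : O x -> D mu x = 3 * (D phi x * cc x + phi x * D cc x).
Proof.
move=> Ox; rewrite -(ddM _ Ox sphi scc) -(ddZ _ _ Ox (smM oO sphi scc)).
by apply: (dd_eq oO _ Ox) => y; rewrite inE => Oy; exact: mu_cc.
Qed.

Lemma dal_cc x : O x -> D al x = 2 * m * (D phi x * cc x + (phi x - 1) * D cc x).
Proof.
move=> Ox; have s1 := smB oO sphi (sm_cst O 1).
have e : D (fun y => phi y - 1) x = D phi x.
  by rewrite (ddB oO _ Ox sphi (sm_cst O 1)) dd_cst subr0.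
rewrite -e -(ddM _ Ox s1 scc) -(ddZ _ _ Ox (smM oO s1 scc)).
by apply: (dd_eq oO _ Ox) => y; rewrite inE => Oy; exact: al_cc.
Qed.

(** Differentiating the formulas for mu and al in terms of phi and [cc] gives two linear equations
    for phi' and cc'. Eliminating cc' leaves 6 m cc phi', with a nonzero coefficient. *)
Lemma dphi x : O x -> D phi x = kap x * (psi m).[phi x].
Proof.
move=> Ox; have h1 := dmu_cc Ox; have h2 := dal_cc Ox.
rewrite hmu // (lam_cc Ox) (mu_cc Ox) in h1; rewrite phi_eq // (al_cc Ox) in h2.
have c0 := cc_neq0 Ox; rewrite psiE.
move: h1 h2 c0; move: (D phi x) (D cc x) (phi x) (cc x) (kap x) => p d f c k h1 h2 c0.
apply: (mulfI (mulf_neq0 mn0 c0)).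
have e : 6 * (m * c * p) = 6 * (m * c * (k * (3^-1 * (f - 1) * (f + 2) * (3 * f + m)))).
  have l1 := congr1 (fun t => 2 * m * (f - 1) * t) h1.
  have l2 := congr1 (fun t => 3 * f * t) h2; cbv beta in l1, l2.
  transitivity (3 * f * (2 * m * (p * c + (f - 1) * d)) - 2 * m * (f - 1) * (3 * (p * c + f * d))).
    by ring.
  by rewrite -l1 -l2; field.
by lra.
Qed.

Lemma dcc x : O x -> D cc x = - kap x * (pS m).[phi x] * cc x.
Proof.
move=> Ox; have h1 := dmu_cc Ox; rewrite hmu // (lam_cc Ox) (mu_cc Ox) dphi // psiE in h1.
have f0 := phi_neq0 Ox; rewrite pSE.
move: h1 f0; move: (D cc x) (phi x) (cc x) (kap x) => d f c k h1 f0.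
apply: (mulfI f0).
have e : f * d = 3^-1 * (3 * (k * (3^-1 * (f - 1) * (f + 2) * (3 * f + m)) * c + f * d))
   - k * (3^-1 * (f - 1) * (f + 2) * (3 * f + m)) * c by field.
by rewrite e -h1; field.
Qed.

Lemma dkap x : O x ->
  D kap x = - (kap x * kap x) - eps + (pq m).[phi x] * (cc x * cc x).
Proof. by move=> Ox; rewrite hkap // (lam_cc Ox) (mu_cc Ox) pqE; ring. Qed.

Definition rel (T : {poly R} * {poly R} * {poly R}) : Prop := forall x, O x ->
  kap x * kap x * T.1.1.[phi x] + cc x * cc x * T.1.2.[phi x] + eps * T.2.[phi x] = 0.

Lemma rel0 : rel (pA m, pB m, pC m).
Proof.
move=> x Ox /=; have h := hlap Ox.
have e : D (fun y => D al y) x = D phi x * (al x * kap x) +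
    phi x * (D al x * kap x + al x * D kap x).
  rewrite -(ddM _ Ox sal sk) -(ddM _ Ox sphi (smM oO sal sk)).
  by apply: (dd_eq oO _ Ox) => y; rewrite inE => Oy; rewrite phi_eq // mulrA.
rewrite e phi_eq // dphi // dkap // psiE pqE (lam_cc Ox) (mu_cc Ox) in h.
rewrite pAE pBE pCE; have a0 := al0 Ox; rewrite (al_cc Ox) in a0.
move: h a0; move: (phi x) (cc x) (kap x) => f c k h a0.
move/eqP: h; rewrite -subr_eq0 => /eqP h.
by apply: (mulfI a0); rewrite mulr0; apply: (eq0_sub h); field.
Qed.

Lemma rel_lie T : rel T -> rel (lie (psi m) (pS m) (pq m) T).
Proof.
case: T => [[A B] C] h x Ox.
have [-> -> ->] := lie_horner (psi m) (pS m) (pq m) A B C (phi x).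
have sA p : sm O (fun y => p.[phi y]) by exact: (sm_horner p oO sphi).
have skk := smM oO sk sk; have sc2 := smM oO scc scc.
have dA p : D (fun y => p.[phi y]) x = p^`().[phi x] * (kap x * (psi m).[phi x]).
  by rewrite (dd_horner _ _ oO sphi Ox) dphi.
have : D (fun y => kap y * kap y * A.[phi y] + cc y * cc y * B.[phi y]
    + eps * C.[phi y]) x = 0.
  rewrite -(dd_cst 0 (X x) x); apply: (dd_eq oO _ Ox) => y; rewrite inE => Oy.
  exact: h.
rewrite (ddD _ Ox (smD oO (smM oO skk (sA A)) (smM oO sc2 (sA B))) (smM oO (sm_cst O eps) (sA C))).
rewrite (ddD _ Ox (smM oO skk (sA A)) (smM oO sc2 (sA B))) (ddZ _ _ Ox (sA C)).
rewrite (ddM _ Ox skk (sA A)) (ddM _ Ox sc2 (sA B)) (ddM _ Ox sk sk) (ddM _ Ox scc scc).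
(* Each derivative carries one factor [kap], which is cancelled here. *)
rewrite !dA dkap // dcc // => e; apply: (mulfI (kap0 Ox)); rewrite mulr0.
by apply: (eq0_sub e); ring.
Qed.

Lemma detP_phi x : O x -> (detP m).[phi x] = 0.
Proof.
move=> Ox.
have r0 := rel0 Ox; have r1 := rel_lie rel0 Ox; have r2 := rel_lie (rel_lie rel0) Ox.
have c0 := cc_neq0 Ox; apply: (mulfI (mulf_neq0 c0 c0)); rewrite mulr0 /detP.
move: r0 r1 r2; set T0 := (pA m, pB m, pC m); set T1 := lie _ _ _ T0; set T2 := lie _ _ _ T1.
move: T0 T1 T2 => [[A0 B0] C0] [[A1 B1] C1] [[A2 B2] C2] /=.
rewrite !(hornerD, hornerN, hornerM).
move: A0.[phi x] A1.[phi x] A2.[phi x] => A0' A1' A2'.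
move: B0.[phi x] B1.[phi x] B2.[phi x] => B0' B1' B2'.
move: C0.[phi x] C1.[phi x] C2.[phi x] => C0' C1' C2' r0 r1 r2.
move: (kap x * kap x) (cc x * cc x) r0 r1 r2 => K c2 r0 r1 r2.
(* Cramer's rule: the cofactors of the middle column eliminate [K] and [eps] and leave [c2] times
   the determinant. *)
apply: (eq0_sub (l := - (A1' * C2' - A2' * C1') * (K * A0' + c2 * B0' + eps * C0')
  + (A0' * C2' - A2' * C0') * (K * A1' + c2 * B1' + eps * C1')
  - (A0' * C1' - A1' * C0') * (K * A2' + c2 * B2' + eps * C2'))); last by ring.
by rewrite r0 r1 r2 !mulr0 addr0 subr0.
Qed.

Lemma flow_empty x : O x -> False.
Proof.
move=> Ox; have m1 : 1 <= m by case: m12 => [->|]; lra.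
have p0 := poly_root_const oO sphi sX detP_phi (detP_neq0 m1) Ox.
have := dphi Ox; rewrite p0 => /esym/eqP; rewrite mulf_eq0 (negbTE (kap0 Ox)) /= psiE.
have f1 := phi_neq1 Ox; have r0 := rel0 Ox; have dP := detP_phi Ox.
rewrite /= pAE pBE pCE in r0.
have k0 : 0 < kap x * kap x by rewrite -expr2 exprn_even_gt0 //= kap0.
have c0 : 0 < cc x * cc x by rewrite -expr2 exprn_even_gt0 //= cc_neq0.
rewrite !mulf_eq0 invr_eq0 pnatr_eq0 subr_eq0 (negbTE f1) /= => /orP[/eqP f2|/eqP f3].
  have fE : phi x = - 2 by lra.
  (* The coefficient of kap^2 at this root is - 3 (m - 2), of the wrong sign for m = 1; there the
     determinant, nonzero at -2, gives the contradiction instead. *)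
  case: m12 => [m1'|m2].
    by move: dP; rewrite fE detP2 m1'; lra.
  move: r0; rewrite fE => r0.
  have h1 : kap x * kap x * (3 * (m - 2)) >= 0 by rewrite mulr_ge0 ?(ltW k0) //; lra.
  have h2 : cc x * cc x * (72 + 36 * m) > 0 by rewrite mulr_gt0 //; lra.
  have h3 : eps * (m + 6) <= 0 by rewrite mulr_le0_ge0 //; lra.
  by lra.
have fE : phi x = - (m / 3) by lra.
move: r0; rewrite fE => r0.
have h1 : kap x * kap x * (2 * m * (m + 3) / 9) > 0.
  rewrite mulr_gt0 //; have : 0 < m * (m + 3) by rewrite mulr_gt0 //; lra.
  by lra.
(* The quadratic factor has negative discriminant. *)
have h2 : cc x * cc x * (m * m * (2 * m * m / 9 - 2 * m / 3 + 4)) > 0.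
  rewrite mulr_gt0 // mulr_gt0 ?mulr_gt0 //; nra.
have h3 : eps * (m / 3 + m + 4) <= 0 by rewrite mulr_le0_ge0 //; lra.
suff : - (kap x * kap x * (2 * m * (m + 3) / 9))
  - cc x * cc x * (m * m * (2 * m * m / 9 - 2 * m / 3 + 4)) + eps * (m / 3 + m + 4) = 0 by lra.
by rewrite -[RHS]r0; field.
Qed.

End FlowContradiction.

(** * Reduction to the generic open set *)

Section System.
Context {R : realType} {n : nat}.
Notation E := 'rV[R]_n.
Variables (X : 'I_n -> E -> E) (Gam : 'I_n -> 'I_n -> 'I_n -> E -> R).
Variables (lam mu : E -> R) (z : 'I_n) (eps : R).
Hypotheses (n2 : (2 <= n)%N) (eps0 : eps <= 0).

Local Notation dl a b := ((a == b)%:R : R).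
Local Notation D a f x := (dd (X a x) f x).
Local Notation alp := (al lam mu).
Local Notation m := (n%:R - 1 : R).

(* [us_bit_e] collects the tangential components of the bitension field and [us_bit_f]
   its component along J X_z. *)
Record usys (O : set E) : Prop := Usys {
  us_open : open O ;
  us_lam : sm O lam ;
  us_mu : sm O mu ;
  us_X : forall a, smx O (X a) ;
  us_Gam : forall a b c, sm O (Gam a b c) ;
  us_anti : forall a b c x, O x -> Gam a b c x = - Gam a c b x ;
  us_cod_lam : forall k x, O x -> k != z ->
    D k lam x = (lam x - 2 * mu x) * Gam z z k x ;
  us_cod_Gam : forall k j x, O x -> k != z -> j != z ->
    (lam x - 2 * mu x) * Gam k z j x = dl k j * D z mu x ;
  us_cod_mu : forall l j x, O x -> l != z -> j != z ->
    D l mu x = mu x * Gam z z l x * (1 + 2 * dl j l) ;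
  us_gauss : forall k x, O x -> k != z ->
    D k (Gam z z k) x + \sum_s Gam z z s x * Gam k s k x - lam x * mu x
    - D z (Gam k z k) x - \sum_s Gam k z s x * Gam z s k x + mu x * mu x
    - \sum_s (Gam k z s x - Gam z k s x) * Gam s z k x = eps ;
  us_bit_e : forall d x, O x ->
    2 * (mu x * D d alp x + (lam x - mu x) * dl d z * D z alp x)
    + alp x * (D d mu x + (D z lam x - D z mu x) * dl d z)
    + alp x * lam x * Gam z z d x + alp x * lam x * dl d z * (\sum_a Gam a z a x) = 0 ;
  us_bit_f : forall x, O x ->
    \sum_a D a (fun y => D a alp y) x
    - alp x * \sum_a \sum_s Gam a z s x ^+ 2
    - alp x * (lam x ^+ 2 + m * mu x ^+ 2)
    - \sum_a \sum_s Gam a a s x * D s alp x + (n%:R + 3) * eps * alp x = 0 }.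

Lemma usys_sub (O O' : set E) : open O' -> O' `<=` O -> usys O -> usys O'.
Proof.
move=> oO' OO [] oO sl su sX sG an cl cG cu ga be bf; split=> //.
- exact: sm_sub sl.
- exact: sm_sub su.
- by move=> a i j; exact: sm_sub (sX a i j).
- by move=> a b c; exact: sm_sub (sG a b c).
- by move=> a b c x /OO; exact: an.
- by move=> k x /OO; exact: cl.
- by move=> k j x /OO; exact: cG.
- by move=> l j x /OO; exact: cu.
- by move=> k x /OO; exact: ga.
- by move=> d x /OO; exact: be.
- by move=> x /OO; exact: bf.
Qed.

Section OnOpen.
Variable O : set E.
Hypothesis uO : usys O.
Let oO := us_open uO.

Lemma us_al : sm O alp.
Proof. exact: (sm_al oO (us_lam uO) (us_mu uO)). Qed.

Lemma us_dal a x : O x -> D a alp x = D a lam x + m * D a mu x.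
Proof.
move=> Ox; rewrite (ddD _ Ox (us_lam uO) (smM oO (sm_cst O m) (us_mu uO))).
by rewrite (ddZ _ _ Ox (us_mu uO)).
Qed.

Lemma us_sD a (f : E -> R) : sm O f -> sm O (fun x => D a f x).
Proof.
move=> sf; apply: (@sm_eq _ _ _ (fun y => \sum_l X a y 0 l * dd (basis_vec l) f y)) => //.
  by move=> y; rewrite inE => Oy; rewrite [RHS]derive_dir //; exact: sm_diff sf Oy.
by apply: sm_sum => // l _; exact: (smM oO (us_X uO a 0 l) (sm_D _ sf)).
Qed.

Lemma us_diag a b x : O x -> Gam a b b x = 0.
Proof. by move=> Ox; have := us_anti uO a b b Ox; lra. Qed.

Lemma dd_zero a (f : E -> R) x : O x -> (forall y, O y -> f y = 0) -> D a f x = 0.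
Proof.
move=> Ox f0; rewrite -(dd_cst 0 (X a x) x).
by apply: (dd_eq oO _ Ox) => y; rewrite inE => /f0.
Qed.

Lemma m_ge1 : 1 <= m.
Proof. by have : 2%:R <= n%:R :> R; [rewrite ler_nat|lra]. Qed.

Lemma m_cases : m = 1 \/ 2 <= m.
Proof.
have [->|n2'] := eqVneq n 2%N; first by left; lra.
right; have : 3%:R <= n%:R :> R by rewrite ler_nat ltn_neqAle eq_sym n2' n2.
lra.
Qed.

Lemma exists_other : exists l : 'I_n, l != z.
Proof.
pose o0 : 'I_n := Ordinal (ltnW n2); pose o1 : 'I_n := Ordinal n2.
have [z0|z0] := eqVneq z o0; last by exists o0; rewrite eq_sym.
by exists o1; rewrite z0.
Qed.

End OnOpen.

(* For n >= 3 this follows pointwise from the Codazzi and bitension equations; for n = 2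
   one differentiates lam + 5 mu = 0, which holds wherever the conclusion fails. *)
Lemma us_geodesic (O : set E) (uO : usys O) l x : O x -> (forall y, O y -> alp y != 0) ->
  l != z -> Gam z z l x = 0.
Proof.
move=> Ox al0 lz.
have a0 := al0 x Ox.
have bitl y : O y -> 2 * mu y * D l alp y + alp y * D l mu y + alp y * lam y * Gam z z l y = 0.
  move=> Oy; have := us_bit_e uO l Oy; rewrite (negbTE lz) /=.
  by move=> h; apply: (eq0_sub h); ring.
have cl y : O y -> D l lam y = (lam y - 2 * mu y) * Gam z z l y.
  by move=> Oy; exact: (us_cod_lam uO Oy lz).
have cm y : O y -> D l mu y = 3 * mu y * Gam z z l y.
  by move=> Oy; rewrite (us_cod_mu uO Oy lz lz) eqxx /=; ring.
have [j /andP[jz jl]|noj] := pickP (fun j => (j != z) && (j != l)).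
  have muG : mu x * Gam z z l x = 0.
    have := us_cod_mu uO Ox lz jz; rewrite (negbTE jl) cm //= => h; lra.
  have mG0 : D l mu x = 0 by rewrite cm // -mulrA muG mulr0.
  have lG : D l alp x = lam x * Gam z z l x.
    rewrite (us_dal uO) // mG0 cl // mulr0 addr0 mulrBl -mulrA muG; ring.
  have alG : alp x * Gam z z l x = lam x * Gam z z l x.
    by rewrite /al mulrDl -mulrA muG mulr0 addr0.
  have h := bitl x Ox; rewrite mG0 lG mulr0 addr0 in h.
  have e : alp x * (alp x * Gam z z l x) = 0.
    rewrite alG; apply: (eq0_sub h).
    have -> : 2 * mu x * (lam x * Gam z z l x) = 2 * lam x * (mu x * Gam z z l x) by ring.
    by rewrite muG; ring.
  by apply: (mulfI a0); rewrite mulr0; apply: (mulfI a0); rewrite mulr0.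
have n2E : m = 1.
  have : (#|'I_n| <= #|pred2 z l|)%N.
    apply: subset_leq_card; apply/fintype.subsetP => j _; rewrite inE.
    by have := noj j; rewrite /=; case: (j == z); case: (j == l).
  rewrite card2 card_ord => h; have -> : n = 2%N.
    by apply/eqP; rewrite eqn_leq n2 andbT (leq_trans h) //; case: (z != l).
  by lra.
apply/eqP; apply: contraT => G0.
pose O' := O `&` [set y | Gam z z l y != 0].
have oO' : open O' by exact: (open_ne0 (us_open uO) (us_Gam uO z z l)).
have uO' : usys O' by apply: usys_sub uO => // y [].
have alE y : O y -> alp y = lam y + mu y by move=> Oy; rewrite /al n2E mul1r.
(* For m = 1 the tangential equation factors as [alp * (lam + 5 * mu) * Gam z z l = 0]. *)
have eq5 y : O' y -> lam y + 5 * mu y = 0.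
  move=> [Oy Gy]; have h := bitl y Oy; rewrite (us_dal uO) // n2E mul1r cl // cm // in h.
  have a0' := al0 y Oy; apply: (mulfI (mulf_neq0 a0' Gy)); rewrite mulr0.
  apply: (eq0_sub h); rewrite alE //; ring.
have O'x : O' x by [].
have := dd_zero uO' l O'x eq5.
rewrite (ddD _ Ox (us_lam uO) (smM (us_open uO) (sm_cst O 5) (us_mu uO))).
rewrite (ddZ _ _ Ox (us_mu uO)) cl // cm // => h.
(* Together with [lam + 5 mu = 0] this forces lam = mu = 0, against [alp != 0]. *)
have h2 : (lam x + 13 * mu x) * Gam z z l x = 0 by apply: (eq0_sub h); ring.
move/eqP: h2; rewrite mulf_eq0 (negbTE G0) orbF => /eqP h2.
by move: a0; rewrite alE //; have h5 := eq5 x O'x; move/eqP; lra.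
Qed.

Lemma us_dal0 (O : set E) (uO : usys O) l x : O x -> (forall y, O y -> alp y != 0) ->
  l != z -> D l alp x = 0.
Proof.
move=> Ox al0 lz; have G0 := us_geodesic uO Ox al0 lz.
by rewrite (us_dal uO) // (us_cod_lam uO Ox lz) (us_cod_mu uO Ox lz lz) G0 !mulr0 !mul0r mulr0 addr0.
Qed.

(* If al were constant the normal part of the biharmonic equation would equate a sum of
   squares with a nonpositive number. *)
Lemma us_nonconst (O : set E) (uO : usys O) x : O x -> (forall y, O y -> alp y != 0) ->
  exists y, O y /\ D z alp y != 0.
Proof.
move=> Ox al0; apply: contrapT => /forallNP H.
have dal y a : O y -> D a alp y = 0.
  move=> Oy; have [->|az] := eqVneq a z; last exact: (us_dal0 uO Oy al0 az).
  by apply/eqP; apply: contraT => h; exfalso; exact: (H y).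
have h := us_bit_f uO Ox.
have s1 : \sum_a D a (fun y => D a alp y) x = 0.
  by apply: big1 => a _; apply: (dd_zero uO a Ox) => y; exact: dal.
have s2 : \sum_a \sum_s Gam a a s x * D s alp x = 0.
  by apply: big1 => a _; apply: big1 => s _; rewrite dal // mulr0.
have S0 : 0 <= \sum_a \sum_s Gam a z s x ^+ 2.
  by apply: sumr_ge0 => a _; apply: sumr_ge0 => s _; exact: sqr_ge0.
have l0 : 0 <= lam x ^+ 2 by exact: sqr_ge0.
have u0 : 0 <= mu x ^+ 2 by exact: sqr_ge0.
have m1 := m_ge1.
have mu0 : mu x ^+ 2 <= m * mu x ^+ 2 by rewrite ler_peMl.
have e0 : (n%:R + 3) * eps <= 0 by rewrite mulr_ge0_le0 //; lra.
rewrite s1 s2 in h; move: S0 h; set S := \sum_a \sum_s _ => S0 h.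
have e1 : S + lam x ^+ 2 + m * mu x ^+ 2 - (n%:R + 3) * eps = 0.
  apply: (mulfI (al0 x Ox)); rewrite mulr0; apply/eqP; rewrite -oppr_eq0; apply/eqP.
  by apply: (eq0_sub h); ring.
have /eqP lam0 : lam x ^+ 2 = 0 by lra.
have /eqP mu0' : mu x ^+ 2 = 0 by lra.
rewrite !expf_eq0 /= in lam0 mu0'.
by have := al0 x Ox; rewrite /al (eqP lam0) (eqP mu0') mulr0 addr0 eqxx.
Qed.

(** If lam = 2 mu on all of [O], the Codazzi equation gives mu' = 0, hence lam' = 0 and al' = 0. *)
Lemma us_umbilic (O : set E) (uO : usys O) x : O x ->
  (forall y, O y -> alp y != 0) -> (forall y, O y -> D z alp y != 0) ->
  exists y, O y /\ lam y - 2 * mu y != 0.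
Proof.
move=> Ox al0 dal0; apply: contrapT => /forallNP H.
have lm y : O y -> lam y - 2 * mu y = 0.
  by move=> Oy; apply/eqP; apply: contraT => h; exfalso; exact: (H y).
have [l lz] := exists_other.
have := us_cod_Gam uO Ox lz lz; rewrite lm // eqxx mul0r mul1r => dmu.
have := dd_zero uO z Ox lm.
rewrite (ddB (us_open uO) _ Ox (us_lam uO) (smM (us_open uO) (sm_cst O 2) (us_mu uO))).
rewrite (ddZ _ _ Ox (us_mu uO)) -dmu mulr0 subr0 => dlam.
by have := dal0 x Ox; rewrite (us_dal uO) // dlam -dmu mulr0 addr0 eqxx.
Qed.

Section Generic.
Variable O : set E.
Hypothesis uO : usys O.
Hypothesis al0 : forall y, O y -> alp y != 0.
Hypothesis dal0 : forall y, O y -> D z alp y != 0.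
Hypothesis lm0 : forall y, O y -> lam y - 2 * mu y != 0.
Variables (l : 'I_n) (lz : l != z).
Local Notation kap := (Gam l z l).

(** Since lam - 2 mu is invertible, the Codazzi equation makes the matrix of the derivative of [X z]
    scalar on the other directions; the value read at the fixed index [l] serves all of them. *)
Lemma gen_Gam k j x : O x -> k != z -> Gam k z j x = dl k j * kap x.
Proof.
move=> Ox kz; have [->|jz] := eqVneq j z; first by rewrite (us_diag uO) // (negbTE kz) mul0r.
apply: (mulfI (lm0 Ox)); rewrite (us_cod_Gam uO Ox kz jz) mulrCA (us_cod_Gam uO Ox lz lz).
by rewrite eqxx mul1r.
Qed.

Lemma gen_Gamz j x : O x -> Gam z z j x = 0.
Proof.
move=> Ox; have [->|jz] := eqVneq j z; first exact: (us_diag uO _ _ Ox).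
exact: (us_geodesic uO Ox al0 jz).
Qed.

Lemma gen_mu x : O x -> D z mu x = (lam x - 2 * mu x) * kap x.
Proof. by move=> Ox; rewrite (us_cod_Gam uO Ox lz lz) eqxx mul1r. Qed.

Lemma sum_not_z (c : R) : \sum_(a < n) (c - c * dl a z) = m * c.
Proof.
rewrite sumrB (sum_dl (fun=> c)) sumr_const card_ord -mulr_natl; ring.
Qed.

Lemma gen_trace x : O x -> \sum_a Gam a z a x = m * kap x.
Proof.
move=> Ox; rewrite -sum_not_z; apply: eq_bigr => a _.
have [->|az] := eqVneq a z; first by rewrite gen_Gamz // /= mulr1 subrr.
by rewrite gen_Gam // eqxx /= mul1r mulr0 subr0.
Qed.

Lemma gen_bit x : O x ->
  2 * lam x * D z alp x + alp x * D z lam x + m * alp x * lam x * kap x = 0.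
Proof.
move=> Ox; have := us_bit_e uO z Ox; rewrite eqxx /= gen_Gamz // gen_trace // => h.
by apply: (eq0_sub h); ring.
Qed.

Lemma gen_kap x : O x ->
  D z kap x = - kap x * kap x - eps - lam x * mu x + mu x * mu x.
Proof.
move=> Ox; have := us_gauss uO Ox lz.
have -> : D l (Gam z z l) x = 0 by apply: (dd_zero uO l Ox) => y; exact: gen_Gamz.
have -> : \sum_s Gam z z s x * Gam l s l x = 0.
  by apply: big1 => s _; rewrite gen_Gamz // mul0r.
have -> : \sum_s Gam l z s x * Gam z s l x = 0.
  apply: big1 => s _; rewrite gen_Gam //; have [->|ls] := eqVneq l s.
    by rewrite (us_diag uO) // mulr0.
  by rewrite mul0r mul0r.
have -> : \sum_s (Gam l z s x - Gam z l s x) * Gam s z l x = kap x * kap x.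
  rewrite (bigD1 l) //= (us_diag uO z l) // subr0 big1 ?addr0 // => s sl.
  have [->|sz] := eqVneq s z; first by rewrite gen_Gamz // mulr0.
  by rewrite [X in _ * X]gen_Gam // (negbTE sl) mul0r mulr0.
by move=> h; lra.
Qed.

Lemma gen_lap x : O x -> D z (fun y => D z alp y) x + m * kap x * D z alp x =
  alp x * (m * kap x * kap x + lam x * lam x + m * mu x * mu x - (m + 4) * eps).
Proof.
move=> Ox; have := us_bit_f uO Ox.
have -> : \sum_a D a (fun y => D a alp y) x = D z (fun y => D z alp y) x.
  rewrite (bigD1 z) //= big1 ?addr0 // => a az.
  by apply: (dd_zero uO a Ox) => y Oy; exact: (us_dal0 uO Oy al0 az).
have -> : \sum_a \sum_s Gam a z s x ^+ 2 = m * (kap x ^+ 2).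
  rewrite -sum_not_z; apply: eq_bigr => a _.
  have [->|az] := eqVneq a z.
    by rewrite /= mulr1 subrr; apply: big1 => s _; rewrite gen_Gamz // expr0n.
  rewrite /= mulr0 subr0 (bigD1 a) //= gen_Gam // eqxx mul1r.
  rewrite big1 ?addr0 // => s sa; rewrite gen_Gam // eq_sym (negbTE sa) mul0r.
  by rewrite expr0n.
have -> : \sum_a \sum_s Gam a a s x * D s alp x = - (m * kap x) * D z alp x.
  transitivity (\sum_a (- Gam a z a x) * D z alp x).
    apply: eq_bigr => a _; rewrite (bigD1 z) //= big1 ?addr0.
      by rewrite (us_anti uO a a z Ox).
    by move=> s sz; rewrite (us_dal0 uO Ox al0 sz) mulr0.
  by rewrite -mulr_suml sumrN gen_trace.
by move=> h; apply: (eq0_sub h); ring.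
Qed.

(* If kap vanished, mu would be constant and 3 lam + m mu = 0, making al constant. *)
Lemma gen_kap_neq0 x : O x -> exists y, O y /\ kap y != 0.
Proof.
move=> Ox; apply: contrapT => /forallNP H.
have k0 y : O y -> kap y = 0.
  by move=> Oy; apply/eqP; apply: contraT => h; exfalso; exact: (H y).
have dmu y : O y -> D z mu y = 0 by move=> Oy; rewrite gen_mu // k0 // mulr0.
have dl y : O y -> D z alp y = D z lam y.
  by move=> Oy; rewrite (us_dal uO) // dmu // mulr0 addr0.
have e y : O y -> 3 * lam y + m * mu y = 0.
  move=> Oy; have := gen_bit Oy; rewrite k0 // -dl // => h.
  apply: (mulfI (dal0 Oy)); rewrite mulr0; apply: (eq0_sub h); rewrite /al; ring.
have := dd_zero uO z Ox e.
have su := us_mu uO; have sl := us_lam uO; have sc c := sm_cst O (c : R).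
rewrite (ddD _ Ox (smM (us_open uO) (sc 3) sl) (smM (us_open uO) (sc m) su)).
rewrite (ddZ _ _ Ox sl) (ddZ _ _ Ox su) dmu // mulr0 addr0 -dl // => /eqP.
by rewrite mulf_eq0 pnatr_eq0 (negbTE (dal0 Ox)).
Qed.

Lemma gen_empty x : O x -> False.
Proof.
move=> Ox; have [y [Oy ky]] := gen_kap_neq0 Ox.
pose O' := O `&` [set y | kap y != 0].
have oO' : open O' by exact: (open_ne0 (us_open uO) (us_Gam uO l z l)).
have OO w : O' w -> O w by case.
have uO' : usys O' by apply: usys_sub uO.
apply: (@flow_empty R n O' (X z) lam mu kap m eps oO' (us_X uO' z) (us_lam uO') (us_mu uO')
  (us_Gam uO' l z l) m_cases eps0 _ _ _ _ _ _ _ y (conj Oy ky)).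
- by move=> w /OO; exact: gen_mu.
- by move=> w /OO; exact: gen_bit.
- by move=> w /OO; exact: gen_kap.
- by move=> w /OO; exact: gen_lap.
- by move=> w /OO; exact: al0.
- by move=> w /OO; exact: dal0.
- by move=> w [].
Qed.

End Generic.

(** Starting from a point with [alp != 0], each nonvanishing condition is met at a new point of the
    previous open set, and the last set, nonempty, contradicts [gen_empty]. *)
Lemma us_al_eq0 (O : set E) (uO : usys O) x : O x -> alp x = 0.
Proof.
move=> Ox; apply/eqP; apply: contraT => ax; exfalso.
pose O1 := O `&` [set y | alp y != 0].
have oO1 : open O1 by exact: (open_ne0 (us_open uO) (us_al uO)).
have u1 : usys O1 by apply: usys_sub uO => // y [].
have a1 y : O1 y -> alp y != 0 by case.
have [y1 [y1O d1]] := us_nonconst u1 (conj Ox ax) a1.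
pose O2 := O1 `&` [set y | D z alp y != 0].
have oO2 : open O2 by exact: (open_ne0 oO1 (us_sD u1 z (us_al u1))).
have u2 : usys O2 by apply: usys_sub u1 => // y [].
have a2 y : O2 y -> alp y != 0 by case => /a1.
have d2 y : O2 y -> D z alp y != 0 by case.
have [y2 [y2O l2]] := us_umbilic u2 (conj y1O d1) a2 d2.
pose O3 := O2 `&` [set y | lam y - 2 * mu y != 0].
have oO3 : open O3.
  apply: (open_ne0 oO2); apply: smB => //; first exact: us_lam u2.
  by apply: smM => //; [exact: sm_cst|exact: us_mu u2].
have u3 : usys O3 by apply: usys_sub u2 => // y [].
have [l lz] := exists_other.
apply: (gen_empty u3 _ _ _ lz (conj y2O l2)) => y [y2O' ?] //.
- exact: a2.
- exact: d2.
Qed.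

End System.

(** * Vanishing of the tension field in one pair of charts *)

Section LocalTheorem.
Context {R : realType} {n k : nat}.
Notation E := 'rV[R]_n.
Variables (U : set 'rV[R]_k) (G J : 'rV[R]_k -> 'M[R]_k).
Variables (O : set E) (g : E -> 'M[R]_n) (F : E -> 'rV[R]_k).
Hypotheses (mG : metric_on U G) (mg : metric_on O g).
Hypotheses (sF : smx O F) (FU : forall x, O x -> U (F x)).
Let oO := met_open mg.

(** Both connections are torsion free, so both antisymmetric parts are dF of the bracket. The
    umbilicity condition prescribes h(X_z, X_b) but not h(X_b, X_z), which is recovered from this
    symmetry. *)
Lemma second_form_sym (X Y : E -> E) x : O x -> smx O X -> smx O Y ->
  second_form g G F X Y x = second_form g G F Y X x.
Proof.
move=> Ox sX sY; apply/eqP; rewrite -subr_eq0 !second_formE; apply/eqP.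
have t1 := covd_torsion mG oO sF FU Ox sX sY.
have t2 := covd_torsion mg oO (smx_id oO) (fun _ h => h) Ox sX sY.
have e (Z : E -> E) : {in O, (fun y => dd (Z y) id y) =1 Z} by move=> y _; rewrite dd_id.
rewrite (covd_eq g id oO _ Ox (e Y)) (covd_eq g id oO _ Ox (e X)) dd_id in t2.
rewrite opprD addrACA t1 -t2 (derivex_dirD _ _ Ox sF) -scaleN1r.
rewrite (derivex_dirZ _ _ Ox sF) scaleN1r -opprD subrr.
by [].
Qed.

Hypotheses (sJ : smx U J) (JJ : forall y, U y -> J y *m J y = - 1%:M).
Hypothesis hermJ : forall y u v, U y -> ip (G y) (u *m J y) (v *m J y) = ip (G y) u v.
Hypothesis parJ : forall y u w, U y -> levi_civita G (cst u) (fun z => w *m J z) y =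
     levi_civita G (cst u) (cst w) y *m J y.
Hypothesis iso : forall x u v, O x ->
  ip (G (F x)) (dd u F x) (dd v F x) = ip (g x) u v.
Hypothesis lag : forall x u v, O x ->
  ip (G (F x)) (dd u F x *m J (F x)) (dd v F x) = 0.
Variables (X : 'I_n -> E -> E).
Hypothesis sX : forall a, smx O (X a).
Hypothesis onX : forall a b x, O x -> ip (g x) (X a x) (X b x) = (a == b)%:R.
Variable eps : R.
Hypothesis curvG : forall y u v w, U y -> curvature G y u v w =
  eps *: (ip (G y) v w *: u - ip (G y) u w *: v
          + ip (G y) (v *m J y) w *: (u *m J y) - ip (G y) (u *m J y) w *: (v *m J y)
          + (2 * ip (G y) u (v *m J y)) *: (w *m J y)).
Hypotheses (n2 : (2 <= n)%N) (eps0 : eps <= 0).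
Hypothesis bih : forall x, O x -> bitension g G F X x = 0.
Variables (lam0 mu0 : E -> R) (z : 'I_n).

Local Notation h a b x := (second_form g G F (X a) (X b) x).
Local Notation f a x := (ff J F X a x).

Hypothesis umb : forall x, O x ->
  [/\ h z z x = lam0 x *: f z x,
      forall b, b != z -> h b b x = mu0 x *: f z x,
      forall b, b != z -> h z b x = mu0 x *: f b x &
      forall b c, b != z -> c != z -> b != c -> h b c x = 0].

Lemma sm_second_form a b : smx O (fun x => h a b x).
Proof.
apply: (@smx_eq _ _ _ _ _ (fun x => covd G F (X a x) (fun y => dd (X b y) F y) x
    - dd (covd g id (X a x) (X b) x) F x)) => // [x _|]; first by rewrite second_formE.
apply: smxD => //; first by apply: (smx_covd mG) => //; exact: smx_dX.
apply: smxN => //; apply: smx_dX => //.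
exact: (smx_covd mg oO (smx_id oO) (fun _ h => h)).
Qed.

(** Agreement of [lam], [mu] with the given functions is asked at [x] only, so that smooth
    substitutes can be inserted. *)
Lemma umbilical_sum (lam mu : E -> R) a b x : O x -> lam x = lam0 x -> mu x = mu0 x ->
  h a b x = \sum_c Cu lam mu z a b c x *: f c x.
Proof.
move=> Ox el eu; have [hzz hbb hzb hbc] := umb Ox.
have -> : \sum_c Cu lam mu z a b c x *: f c x =
    (mu x * (a == z)%:R) *: f b x + (mu x * (b == z)%:R) *: f a x
    + (mu x * (a == b)%:R) *: f z x
    + ((lam x - 3 * mu x) * (a == z)%:R * (b == z)%:R) *: f z x.
  have sd (t : R) d : t *: f d x = \sum_c (t * (c == d)%:R) *: f c x.
    rewrite (bigD1 d) //= eqxx mulr1 big1 ?addr0 // => c /negbTE ->.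
    by rewrite mulr0 scale0r.
  rewrite !sd -!big_split; apply: eq_bigr => c _ /=; rewrite -!scalerDl; congr (_ *: _).
  by rewrite /Cu /K1 /K2 (eq_sym b c) (eq_sym a c); ring.
rewrite el eu; have [->|az] := eqVneq a z.
  have [->|bz] := eqVneq b z.
    by rewrite hzz; move: (f z x) => v; apply/rowP => q; rewrite !mxE /=; ring.
  by rewrite hzb // /= !(mulr1, mulr0, scale0r, addr0).
have [->|bz] := eqVneq b z.
  by rewrite second_form_sym // hzb // (negbTE az) /= !(mulr1, mulr0, mul0r, scale0r, add0r, addr0).
have [<-|ab] := eqVneq a b.
  by rewrite hbb // /= !(mulr1, mulr0, mul0r, scale0r, add0r, addr0).
by rewrite hbc // /= !(mulr1, mulr0, mul0r, scale0r, add0r, addr0).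
Qed.

Theorem local_tension_eq0 x : O x -> tension g G F x = 0.
Proof.
move=> Ox.
have [w wz] := exists_other z n2.
(* The given functions have no stated regularity; these pairings are smooth and agree with them on
   [O]. The one for mu uses a second frame index [w], available since n >= 2. *)
pose lam y : R := ip (G (F y)) (h z z y) (f z y).
pose mu y : R := ip (G (F y)) (h z w y) (f w y).
have sf a : smx O (fun y => f a y) := smff mg sF FU sJ sX a.
have slam : sm O lam by exact: (sm_ip mG oO sF FU (sm_second_form z z) (sf z)).
have smu : sm O mu by exact: (sm_ip mG oO sF FU (sm_second_form z w) (sf w)).
have on a y : O y -> ip (G (F y)) (f a y) (f a y) = 1.
  by move=> Oy; rewrite (ff_on FU hermJ iso onX a a Oy) eqxx.
have el y : O y -> lam y = lam0 y.
  by move=> Oy; have [hzz _ _ _] := umb Oy; rewrite /lam hzz ipZl on // mulr1.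
have eu y : O y -> mu y = mu0 y.
  by move=> Oy; have [_ _ hzb _] := umb Oy; rewrite /mu hzb // ipZl on // mulr1.
pose C := Cu lam mu z.
have sC a b c : sm O (C a b c) by exact: (sm_Cu oO).
have hC a b y : O y -> sff G g F X a b y = \sum_c C a b c y *: f c y.
  by move=> Oy; exact: (umbilical_sum a b Oy (el y Oy) (eu y Oy)).
pose Gm := Gam g X.
have sG a b c : sm O (Gm a b c) := sGam mg sX a b c.
have an a b c y : O y -> Gm a b c y = - Gm a c b y.
  by move=> Oy; exact: (Gam_anti mg sX onX a b c Oy).
have Hcod a b c d y (Oy : O y) :=
  codazzi mG mg sF FU sJ JJ hermJ parJ iso lag sX onX sC hC curvG a b c d Oy.
have Hgau a b c d y (Oy : O y) :=
  gauss mG mg sF FU sJ JJ parJ iso lag sX onX sC hC curvG a b c d Oy.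
have Hbe d y (Oy : O y) :=
  bitension_fe mG mg sF FU sJ JJ hermJ parJ iso lag sX onX sC hC curvG d Oy (bih Oy).
have Hbf d y (Oy : O y) :=
  bitension_ff mG mg sF FU sJ JJ hermJ parJ iso lag sX onX sC hC curvG d Oy (bih Oy).
have us : usys X Gm lam mu z eps O.
  split=> //.
  - by move=> a y Oy az; exact: (codazzi_lam oO slam smu an Hcod Oy az).
  - by move=> a b y Oy az bz; exact: (codazzi_Gam oO slam smu an Hcod Oy az bz).
  - by move=> a b y Oy az bz; exact: (codazzi_mu oO slam smu an Hcod Oy az bz).
  - by move=> a y Oy az; exact: (gauss_Cu Hgau Oy az).
  - by move=> d y Oy; exact: (bitension_e oO slam smu an Hbe d Oy).
  - by move=> y Oy; exact: (bitension_f oO slam smu an Hbf Oy).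
rewrite (tensionE mG mg sF FU sX onX hC Ox) /comb big1 ?add0r => [|c _]; last first.
  by rewrite /cst0 scale0r.
apply: big1 => c _; rewrite (trC_Cu lam mu z c x) (us_al_eq0 n2 eps0 us Ox).
by rewrite mul0r scale0r.
Qed.

End LocalTheorem.

(** * From charts to manifolds *)

Theorem corollary4p1 (R : realType) (n : nat) (eps : R)
    (M : manifold R n) (gM : riemannian M)
    (N : manifold R n.*2) (gN : riemannian N) (J : kahler gN) (f : M -> N) :
  (2 <= n)%N ->
  connected [set: M] ->
  complex_space_form J eps ->
  lagrangian_H_umbilical gM J f ->
  biharmonic gM gN f ->
  eps <= 0 ->
  minimal gM gN f.
Proof.
move=> n2 _ csf [[[[cf smf] isom] lagr] [_ umb]] [_ bih] eps0 i j x Dx.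
(* What remains is the trace, which is [tension] by definition. *)
rewrite /mean_curvature; apply/eqP; rewrite scaler_eq0; apply/orP; right; apply/eqP.
have [W [E [lam [mu [oW [Wx [[vE onE] hE]]]]]]] := umb (param i x).
(* The part of the source chart where the frame exists and whose image lies in the target chart; its
   openness rests on the continuity of [f] and of [param i]. *)
pose O : set 'rV[R]_n := expr_dom f i j `&` param i @^-1` W.
have Ox : O x by split.
have pc := @param_continuous _ _ M i.
have oO : open O.
  rewrite openE => y [[ry dy] Wy]; apply: filterI; first apply: filterI.
  - by apply: open_nbhs_nbhs; split=> //; exact: rng_open.
  - have : nbhs (f (param i y)) (dom j) 
      by apply: open_nbhs_nbhs; split=> //; exact: dom_open.
    by move/(cf (param i y)) => /(pc y ry).
  - have : nbhs (param i y) W by apply: open_nbhs_nbhs; split.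
    by move/(pc y ry).
have OD : O `<=` expr_dom f i j by move=> y [].
have Orng : O `<=` rng i by move=> y [[]].
pose F := expr f i j.
have smx_sub p q (A : 'rV[R]_n -> 'M[R]_(p, q)) (P Q : set 'rV[R]_n) :
    Q `<=` P -> smooth_on P A -> smooth_on Q A by move=> QP sA s y /QP; exact: sA.
have sF : smx O F by apply: smooth_on_smx => //; exact: (smx_sub _ _ _ _ _ OD (smf i j)).
have FU y : O y -> rng j (F y).
  by move=> [[ry dy] _]; have [] := @coordK _ _ N j _ dy.
have mG : metric_on (rng j) (gram gN j).
  split; [exact: rng_open| |exact: gram_sym|exact: gram_pos].
  by apply: smooth_on_smx; [exact: rng_open|exact: gram_smooth].
have mg : metric_on O (gram gM i).
  split=> // [|y /Orng|y v /Orng]; [|exact: gram_sym|exact: gram_pos].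
  by apply: smooth_on_smx => //; exact: (smx_sub _ _ _ _ _ Orng (@gram_smooth _ _ _ gM i)).
have sJ : smx (rng j) (cplx J j).
  by apply: smooth_on_smx; [exact: rng_open|exact: cplx_smooth].
have n0 : (0 < n)%N by exact: leq_trans n2.
pose z : 'I_n := Ordinal n0.
apply: (@local_tension_eq0 R n n.*2 (rng j) (gram gN j) (cplx J j) O (gram gM i) F mG mg sF FU
  sJ _ _ _ _ _ (fun a => E a i) _ _ eps _ n2 eps0 _ (lam \o param i) (mu \o param i) z _ x Ox).
- by move=> y ry; exact: cplx_sqr.
- by move=> y u v ry; exact: cplx_hermitian.
- by move=> y u w ry; exact: cplx_parallel.
- by move=> y u v /OD Dy; rewrite !ddE; exact: isom.
(* Of the Lagrangian condition, the fact that [J] sends tangent vectors to normal ones gives the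
   orthogonality required. *)
- move=> y u v /OD Dy; have [tn _] := lagr i j y Dy.
  have : Defs.normal_space gN f i j y (dd u F y *m cplx J j (F y)).
    by rewrite -tn; exists (dd u F y) => //; exists u => //; rewrite ddE.
  by apply; exists v => //; rewrite ddE.
- move=> a; apply: smooth_on_smx => //.
  by apply: (smx_sub _ _ _ _ _ _ ((vE a).1 i)) => y [[ry _] Wy].
- by move=> a b y [[ry _] Wy]; exact: onE.
- by move=> y u v w ry; exact: csf.
- by move=> y [Dy Wy]; exact: bih oW (conj vE onE) i j y Dy Wy.
- move=> y [Dy Wy]; have [h1 h2 h3 h4] := hE i j y Dy Wy z erefl.
  have e a : ff (cplx J j) F (fun a => E a i) a y =
     push F (E a i) y *m cplx J j (F y) by rewrite /ff /fe ddE.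
  by split=> [|b|b|b c]; rewrite ?e; [exact: h1|exact: h2|exact: h3|exact: h4].
Qed.
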